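(* Let $n\ge1$, let $0\le\alpha\le\frac12$, and let $f=(f_1,\dots,f_n)':D^n\to\mathbb{C}^n$ be a normalized almost starlike mapping of order $\alpha$ on the unit polydisk $D^n$. Put $a_{ml}=\frac{1}{2!}\frac{\partial^2f_m(0)}{\partial z_m\partial z_l}$ for $m,l=1,\dots,n$. Suppose that for every $z\in D^n\setminus\{0\}$, with $z_0=\frac{z}{\|z\|}$, and every $k=1,\dots,n$, $$2z_k\frac{D^2f_k(0)}{2!}\left(z_0,\frac{D^2f(0)(z_0^2)}{2!}\right)\|z\|-\frac{1}{1-\alpha}\left[\frac{D^2f_k(0)(z_0^2)}{2!}\right]^2\|z\|^2=\frac{1-2\alpha}{1-\alpha}z_k^2\left(\sum_{m=1}^n a_{km}\frac{z_m}{\|z\|}\left(\sum_{l=1}^n a_{ml}\frac{z_l}{\|z\|}\right)\right).$$ Then $$\frac{\|D^3f(0)(z^3)\|}{3!}\le(1-\alpha)(3-4\alpha)\|z\|^3\qquad\text{for all } z\in D^n .$$ This estimate is sharp: for each $n$ and $\alpha$ the constant $(1-\alpha)(3-4\alpha)$ cannot be replaced by a smaller one valid for all such $f$ and all $z\in D^n$.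
   Context: $\mathbb{C}^n$ carries the norm $\|z\|=\max_{1\le k\le n}|z_k|$, and $D^n=\{z\in\mathbb{C}^n:\|z\|<1\}$ is its open unit ball. For $x\ne0$, $T(x)=\{T_x\in(\mathbb{C}^n)^*:\|T_x\|=1,\ T_x(x)=\|x\|\}$. For a holomorphic map $f$ on $D^n$, $D^mf(x)$ is the $m$-th Fréchet derivative at $x$ (a symmetric $m$-linear map), $D^mf(x)(y^m)=D^mf(x)(y,\dots,y)$, $\frac{D^2f_k(0)}{2!}(x,y)=\frac12D^2f_k(0)(x,y)$, and $D^mf_k$ denotes the derivative of the $k$-th component. $f:D^n\to\mathbb{C}^n$ is normalized if $f(0)=0$, $Df(0)=I$, and locally biholomorphic if $Df(x)$ is invertible for each $x\in D^n$. A normalized locally biholomorphic mapping $f:D^n\to\mathbb{C}^n$ is almost starlike of order $\alpha$ if $\mathrm{Re}\{T_x[(Df(x))^{-1}f(x)]\}\ge\alpha\|x\|$ for all $x\in D^n\setminus\{0\}$ and all $T_x\in T(x)$. *)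

(* Defs.v *)
From HB Require Import structures.
From mathcomp Require Import all_boot all_order all_algebra.
From mathcomp Require Import complex.
From mathcomp Require Import all_classical all_reals all_analysis.

Set Implicit Arguments.
Unset Strict Implicit.
Unset Printing Implicit Defensive.
Import Order.TTheory GRing.Theory Num.Theory.
Import numFieldNormedType.Exports.
Local Open Scope classical_set_scope.
Local Open Scope ring_scope.
Local Open Scope complex_scope.

(* As numFieldNormedType does for abstract fields: R[i] gets the normed space
   structure that the library puts on its alias R[i]^o. *)
HB.instance Definition _ (R : rcfType) := GRing.ComAlgebra.copy R[i] R[i]^o.
HB.instance Definition _ (R : rcfType) := Vector.copy R[i] R[i]^o.
HB.instance Definition _ (R : rcfType) := NormedModule.copy R[i] R[i]^o.

(* C^n is 'rV[R[i]]_n, whose library norm `|z| is the max norm, with values in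
   the nonnegative reals of R[i].  A map on the polydisk is a total function;
   its values outside the polydisk are never constrained. *)

Definition polydisk (R : realType) (n : nat) : set 'rV[R[i]]_n :=
  [set z | `|z| < 1].

Definition component (R : realType) (n : nat) (f : 'rV[R[i]]_n -> 'rV[R[i]]_n)
    (k : 'I_n) : 'rV[R[i]]_n -> R[i] :=
  fun z => f z 0 k.

(* frechet f [:: v_1; ...; v_m] x is D^m f(x)(v_1, ..., v_m).  The m-th Frechet
   derivative is the Frechet derivative of y |-> D^(m-1) f(y), and evaluation
   at (v_2, ..., v_m) is linear and continuous, whence
   D^m f(x)(v_1, ..., v_m) = D(y |-> D^(m-1) f(y)(v_2, ..., v_m))(x)(v_1). *)
Fixpoint frechet (R : realType) (V W : normedModType R[i]) (f : V -> W)
    (vs : seq V) (x : V) : W :=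
  if vs is v :: vs' then 'd (frechet f vs') x v else f x.

Definition opnorm (R : realType) (n : nat)
    (T : {linear 'rV[R[i]]_n -> R[i]}) : R :=
  sup [set complex.Re `|T v| | v in [set v : 'rV[R[i]]_n | `|v| <= 1]].

(* The set T(x); by finite dimension every linear functional is continuous. *)
Definition supporting (R : realType) (n : nat) (x : 'rV[R[i]]_n) :
    set {linear 'rV[R[i]]_n -> R[i]} :=
  [set T | opnorm T = 1 /\ T x = `|x|].

Definition holomorphic (R : realType) (n : nat)
    (f : 'rV[R[i]]_n -> 'rV[R[i]]_n) : Prop :=
  forall z : 'rV[R[i]]_n, polydisk z -> differentiable f z.

(* 'J f x is the matrix of Df(x) acting on row vectors from the right:
   Df(x)(v) = v *m 'J f x, so that (Df(x))^-1(v) = v *m invmx ('J f x). *)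
Definition normalized (R : realType) (n : nat)
    (f : 'rV[R[i]]_n -> 'rV[R[i]]_n) : Prop :=
  f 0 = 0 /\ 'J f 0 = 1%:M.

Definition locally_biholomorphic (R : realType) (n : nat)
    (f : 'rV[R[i]]_n -> 'rV[R[i]]_n) : Prop :=
  holomorphic f /\
  forall x : 'rV[R[i]]_n, polydisk x -> 'J f x \in unitmx.

Definition almost_starlike (R : realType) (n : nat) (alpha : R)
    (f : 'rV[R[i]]_n -> 'rV[R[i]]_n) : Prop :=
  [/\ normalized f, locally_biholomorphic f &
    forall x : 'rV[R[i]]_n, polydisk x -> x != 0 ->
    forall T, supporting x T ->
      alpha * complex.Re `|x| <= complex.Re (T (f x *m invmx ('J f x)))].

(* a_{ml} = (1/2!) d^2 f_m (0) / dz_m dz_l *)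
Definition coef2 (R : realType) (n : nat) (f : 'rV[R[i]]_n -> 'rV[R[i]]_n)
    (m l : 'I_n) : R[i] :=
  (2`!)%:R^-1 *
  'D_(delta_mx 0 m) (fun z => 'D_(delta_mx 0 l) (component f m) z) 0.

Definition quadratic_condition (R : realType) (n : nat) (alpha : R)
    (f : 'rV[R[i]]_n -> 'rV[R[i]]_n) : Prop :=
  forall z : 'rV[R[i]]_n, polydisk z -> z != 0 -> forall k : 'I_n,
  let z0 := `|z|^-1 *: z in
  let B u v : R[i] := (2`!)%:R^-1 * frechet (component f k) [:: u; v] 0 in
  let P := (2`!)%:R^-1 *: frechet f [:: z0; z0] 0 in
  2 * z 0 k * B z0 P * `|z| - ((1 - alpha)^-1)%:C * B z0 z0 ^+ 2 * `|z| ^+ 2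
  = ((1 - 2 * alpha) / (1 - alpha))%:C * z 0 k ^+ 2 *
    \sum_(m < n) coef2 f k m * (z 0 m / `|z|) *
      (\sum_(l < n) coef2 f m l * (z 0 l / `|z|)).

(* Main.v *)
From HB Require Import structures.
Require Import Defs.
From mathcomp Require Import all_boot all_order all_algebra.
From mathcomp Require Import complex ring lra.
From mathcomp Require Import all_classical all_reals all_analysis.
Import Order.TTheory GRing.Theory Num.Theory.
Import numFieldNormedType.Exports.
Local Open Scope ring_scope.
Local Open Scope complex_scope.
Set Implicit Arguments.
Unset Strict Implicit.

(* Let h(t) = Df(t z0)^-1 f(t z0) with |z0| = 1.  When |z0_k| = 1, the supporting
   functional at coordinate k makes h_k(t) / (z0_k t) a function of real part at
   least alpha, so Caratheodory's inequality |q2 - q1^2/2| <= 2 - |q1|^2/2 bounds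
   its second and third order Taylor coefficients.  These coefficients are
   expressed by the derivatives of f by comparing f = h . Df and z0 . Df with
   their derivatives along the line, and the quadratic condition turns D^3 f_k(z0^3)
   into the sum of a Caratheodory term and a form in the a_{ml}.  That form is at
   most 4 (1 - alpha)^2, because sum_l |a_{ml}| <= 2 (1 - alpha).  The maximum
   modulus principle in the k-th coordinate removes the restriction |z0_k| = 1.
   Sharpness is seen on maps acting by one polynomial in every coordinate.

   Holomorphic functions are handled through circle means: Goursat's theorem in
   the coordinates w |-> exp (2 pi w) shows that they do not depend on the radius,
   and this gives Taylor coefficients, the maximum principle, and the existence
   and symmetry of higher derivatives. *)

(** * Modulus and differentials *)

(** On the torus [nr (z0 0 k) = 1], let q1, q2 be the Taylor coefficients of (h_k(t) / (z0_k t) -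
    alpha) / (1 - alpha), and put c = z0_k, b = 1 - alpha, S = the form in the a_{ml}. The quadratic
    condition eliminates the mixed term D^2 f_k(z0, D^2 f(z0^2)) and leaves D^3 f_k(z0^3) = 3 c ((1
    - 2 alpha) / b S + b q1^2 / 2 - b (q2 - q1^2 / 2)). This dictates the refined form of
    Caratheodory's inequality: its term - |q1|^2 / 2 cancels the modulus of q1^2 / 2, which the
    cruder |q2| <= 2 would leave over. With |S| <= 4 b^2 the total is 3 (4 (1 - 2 alpha) b + 2 b) =
    6 b (3 - 4 alpha); alpha <= 1/2 makes the factor of S nonnegative. The row sums of |a_{ml}|
    involve all phases at once, so they are not controlled by one point z0: they come from |q1| <= 2
    at every point of the torus, averaged over rotations of the coordinates other than the m-th. For
    a map acting by one polynomial F in every coordinate, the quadratic condition holds whatever F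
    is, so sharpness becomes a question about starlike functions of one variable. *)

Definition nr {R : realType} {V : normedModType R[i]} (v : V) : R :=
  complex.Re `|v|.

(* A monomorphic copy of [conjc], so that rewriting finds its instances. *)
Definition cj {R : realType} (z : R[i]) : R[i] := conjc z.

Section Modulus.
Variable R : realType.
Implicit Types (V W : normedModType R[i]) (x y z : R[i]) (r s : R).

(** The order of [R[i]] is partial; [nr] moves every inequality into [R], where [lra] and [nra]
    apply. *)
Lemma normE V (v : V) : `|v| = (nr v)%:C.
Proof. by rewrite /nr RRe_real// normr_real. Qed.

Lemma nr_ge0 V (v : V) : 0 <= nr v.
Proof. by rewrite -ler0c -normE. Qed.

Lemma nr0 V : nr (0 : V) = 0.
Proof. by rewrite /nr normr0. Qed.

Lemma nr_eq0 V (v : V) : nr v = 0 -> v = 0.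
Proof. by move=> h; apply/eqP; rewrite -normr_eq0 normE h. Qed.

Lemma nr_gt0 V (v : V) : v != 0 -> 0 < nr v.
Proof.
move=> v0; rewrite lt_neqAle nr_ge0 andbT eq_sym; apply: contra_neq v0.
exact: nr_eq0.
Qed.

Lemma nrN V (v : V) : nr (- v) = nr v.
Proof. by rewrite /nr normrN. Qed.

Lemma nrD V (v w : V) : nr (v + w) <= nr v + nr w.
Proof. by have := ler_normD v w; rewrite !normE -rmorphD lecR. Qed.

Lemma nrB V (v w : V) : nr (v - w) <= nr v + nr w.
Proof. by rewrite -(nrN w); exact: nrD. Qed.

Lemma nr_distC V (v w : V) : nr (v - w) = nr (w - v).
Proof. by rewrite -nrN opprB. Qed.

Lemma nrZ V (a : R[i]) (v : V) : nr (a *: v) = nr a * nr v.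
Proof. by apply: complexI; rewrite rmorphM/= -!normE normrZ. Qed.

Lemma nrM x y : nr (x * y) = nr x * nr y.
Proof. by apply: complexI; rewrite rmorphM/= -!normE normrM. Qed.

Lemma nrX x n : nr (x ^+ n) = nr x ^+ n.
Proof. by apply: complexI; rewrite rmorphXn/= -!normE normrX. Qed.

Lemma nrV x : nr x^-1 = (nr x)^-1.
Proof. by apply: complexI; rewrite fmorphV/= -!normE normfV. Qed.

Lemma nr_eq x : nr x = Num.sqrt (complex.Re x ^+ 2 + complex.Im x ^+ 2).
Proof. by rewrite /nr normc_def. Qed.

Lemma nr_sqr x : nr x ^+ 2 = complex.Re x ^+ 2 + complex.Im x ^+ 2.
Proof. by rewrite nr_eq sqr_sqrtr// addr_ge0// sqr_ge0. Qed.

Lemma nrR r : nr (r%:C : R[i]) = `|r|.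
Proof. by rewrite nr_eq/= expr0n addr0 sqrtr_sqr. Qed.

Lemma nr1 : nr (1 : R[i]) = 1.
Proof. by rewrite /nr normr1. Qed.

Lemma nr_nat n : nr (n%:R : R[i]) = n%:R.
Proof. by rewrite -(rmorph_nat (real_complex R)) nrR ger0_norm. Qed.

Lemma nr_sum V n (F : 'I_n -> V) : nr (\sum_i F i) <= \sum_i nr (F i).
Proof.
elim/big_ind2: _ => [|x x' y y' h1 h2|//]; first by rewrite nr0.
by apply: le_trans (nrD _ _) _; exact: lerD.
Qed.

Lemma nrJ x : nr (cj x) = nr x.
Proof. by rewrite !nr_eq; case: x => a b /=; rewrite sqrrN. Qed.

Lemma mulJ x : x * cj x = (nr x ^+ 2)%:C.
Proof. by rewrite nr_sqr /cj; case: x => a b; simpc; congr Complex; ring. Qed.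

Lemma cjM x y : cj (x * y) = cj x * cj y.
Proof. exact: rmorphM. Qed.

Lemma cjD x y : cj (x + y) = cj x + cj y.
Proof. exact: rmorphD. Qed.

Lemma cjV x : cj x^-1 = (cj x)^-1.
Proof. exact: fmorphV. Qed.

Lemma cjN x : cj (- x) = - cj x.
Proof. exact: rmorphN. Qed.

Lemma cjK x : cj (cj x) = x.
Proof. exact: conjcK. Qed.

Lemma cjR r : cj r%:C = r%:C.
Proof. exact: conjc_real. Qed.

Lemma cj1 : cj 1 = 1 :> R[i].
Proof. exact: conjc1. Qed.

Lemma cj_nat n : cj n%:R = n%:R :> R[i].
Proof. exact: conjc_nat. Qed.

Lemma normRe_le x : `|complex.Re x| <= nr x.
Proof. by rewrite nr_eq -sqrtr_sqr ler_wsqrtr// lerDl sqr_ge0. Qed.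

Lemma normIm_le x : `|complex.Im x| <= nr x.
Proof. by rewrite nr_eq -sqrtr_sqr ler_wsqrtr// lerDr sqr_ge0. Qed.

Lemma Re_le x : complex.Re x <= nr x.
Proof. exact: le_trans (ler_norm _) (normRe_le _). Qed.

Lemma nr_le x : nr x <= `|complex.Re x| + `|complex.Im x|.
Proof.
rewrite -(@ler_pXn2r _ 2)// ?nnegrE ?nr_ge0 ?addr_ge0//.
rewrite nr_sqr -(real_normK (num_real (complex.Re x))).
rewrite -(real_normK (num_real (complex.Im x))).
have := normr_ge0 (complex.Re x); have := normr_ge0 (complex.Im x); nra.
Qed.

Lemma ReM x y : complex.Re (x * y) =
  complex.Re x * complex.Re y - complex.Im x * complex.Im y.
Proof. by case: x => a b; case: y. Qed.

Lemma ImM x y : complex.Im (x * y) =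
  complex.Re x * complex.Im y + complex.Im x * complex.Re y.
Proof. by case: x => a b; case: y. Qed.

Lemma ReD x y : complex.Re (x + y) = complex.Re x + complex.Re y.
Proof. by case: x => a b; case: y. Qed.

Lemma ImD x y : complex.Im (x + y) = complex.Im x + complex.Im y.
Proof. by case: x => a b; case: y. Qed.

Lemma ReN x : complex.Re (- x) = - complex.Re x.
Proof. by case: x. Qed.

Lemma ImN x : complex.Im (- x) = - complex.Im x.
Proof. by case: x. Qed.

Lemma eqC x y : complex.Re x = complex.Re y -> complex.Im x = complex.Im y ->
  x = y.
Proof. by case: x => a b; case: y => c d /= -> ->. Qed.

Lemma dominates_le (a b c : R) : 0 <= c ->
  (forall e, 0 < e -> a <= b + e * c) -> a <= b.
Proof.
move=> c0 h; apply/ler_addgt0Pr => e e0.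
have c1 : 0 < c + 1 by apply: ltr_wpDl.
(* Dividing by [c + 1] instead of [c] covers [c = 0]; the same device recurs below as [nr v + 1]. *)
apply: le_trans (h (e / (c + 1)) _) _; first by rewrite divr_gt0.
rewrite lerD2l mulrAC ler_pdivrMr// ler_wpM2l ?(ltW e0)//; lra.
Qed.

Lemma small_nr V (v : V) : (forall e, 0 < e -> nr v <= e) -> v = 0.
Proof.
move=> h; apply: nr_eq0; apply/eqP; rewrite eq_le nr_ge0 andbT.
by apply/ler_addgt0Pr => e e0; rewrite add0r; exact: h.
Qed.

Lemma near0P V (P : V -> Prop) : (\forall h \near (0 : V), P h)%classic <->
  exists2 d : R, 0 < d & forall h, nr h < d -> P h.
Proof.
split.
  case/nbhs_norm0P => e /= e0 he.
  have e_real : (complex.Re e)%:C = e by apply: RRe_real; exact: gtr0_real.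
  exists (complex.Re e); first by rewrite -ltcR e_real.
  by move=> h hd; apply: he; rewrite /= normE -e_real ltcR.
case=> d d0 hd; apply/nbhs_norm0P; exists d%:C; first by rewrite /= ltcR.
by move=> h /=; rewrite normE ltcR; exact: hd.
Qed.

End Modulus.

(** Frechet differentiability in epsilon-delta form. [L] is a bare function; linearity and
    boundedness are supplied separately when [hd_diff] returns to the library notion. *)
Definition hd {R : realType} {V W : normedModType R[i]}
    (f : V -> W) (x : V) (L : V -> W) : Prop :=
  forall e : R, 0 < e -> exists2 d : R, 0 < d &
  forall h, nr h < d -> nr (f (x + h) - f x - L h) <= e * nr h.

Section Differential.
Variable R : realType.
Implicit Types V W : normedModType R[i].

Lemma diff_hd V W (f : V -> W) x : differentiable f x -> hd f x ('d f x).
Proof.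
case/diff_locallyP => _ /eqaddoP h e e0.
have e0' : 0 < e%:C :> R[i] by rewrite ltcR.
have /near0P[d d0 hd0] := h _ e0'; exists d => // k kd.
move: (hd0 _ kd); rewrite !normE -rmorphM/= lecR.
by rewrite !fctE/= opprD addrA (addrC k).
Qed.

Lemma diff_bounded V W (f : V -> W) x : differentiable f x ->
  exists2 K : R, 0 <= K & forall h, nr ('d f x h) <= K * nr h.
Proof.
case/diff_locallyP => cont _.
have /cvgr_dist_lt/(_ 1 ltr01) := cont 0.
rewrite linear0 => /near0P[d d0 hd0].
(* [h] is rescaled to norm [d / 2], inside the ball where continuity at 0 makes the image smaller
   than 1. *)
exists (2 / d); first by rewrite divr_ge0// ltW.
move=> h; have [->|h0] := eqVneq h 0; first by rewrite linear0 !nr0 mulr0.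
have nh0 := nr_gt0 h0; pose c := d / 2 / nr h.
have c0 : 0 < c by rewrite !divr_gt0.
have := hd0 (c%:C *: h); rewrite nrZ nrR (gtr0_norm c0).
have lt : c * nr h < d by rewrite /c divfK ?gt_eqF//; lra.
move/(_ lt).
rewrite sub0r normrN linearZ normE nrZ nrR (gtr0_norm c0).
rewrite -[1]/(1%:C) ltcR => lt1.
rewrite -(ler_pM2l c0) (le_trans (ltW lt1))// le_eqVlt; apply/orP; left.
by apply/eqP; rewrite /c; field; rewrite !gt_eqF.
Qed.

Lemma hd_diff V W (f : V -> W) x (L : V -> W) K : linear L ->
  (forall h, nr (L h) <= K * nr h) -> hd f x L ->
  differentiable f x /\ 'd f x =1 L.
Proof.
move=> linL bndL hdL.
pose LM := GRing.isLinear.Build _ _ _ _ L linL.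
pose L' : {linear V -> W} := HB.pack L LM.
have K0 : 0 < `|K| + 1 by rewrite ltr_wpDl.
have contL : continuous L'.
  move=> y; apply/cvgrPdist_le => e /[dup] e0 /gtr0_real/RRe_real eE.
  have e0' : 0 < complex.Re e by rewrite -ltcR eE.
  apply/nbhs_normP => /=; exists (complex.Re e / (`|K| + 1))%:C.
    by rewrite /= ltcR divr_gt0.
  move=> z /=; rewrite -[X in _ -> `|X| <= _](linearB L') /=; set h := y - z.
  rewrite !normE ltcR -eE lecR => hlt.
  apply: le_trans (bndL h) _; apply: le_trans (_ : (`|K| + 1) * nr h <= _).
    by rewrite ler_wpM2r ?nr_ge0// (le_trans (ler_norm _))// lerDl.
  by rewrite mulrC -ler_pdivlMr// ltW.
have hE : f \o shift x = cst (f x) + L' +o_ (0 : V) id.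
  apply/eqaddoP => e /[dup] e0 /gtr0_real/RRe_real eE.
  have e0' : 0 < complex.Re e by rewrite -ltcR eE.
  have [d d0 hd0] := hdL _ e0'.
  apply/near0P; exists d => // h hh; rewrite !normE -eE -rmorphM/= lecR.
  by rewrite !fctE/= opprD addrA (addrC h); exact: hd0.
have dE : 'd f x = L' :> (V -> W) by apply: diff_unique.
split; last by move=> h; rewrite dE.
by apply/diff_locallyP; rewrite dE.
Qed.

End Differential.

(** * Complex derivatives in one variable *)

Definition ccont {R : realType} {V W : normedModType R[i]}
    (f : V -> W) (x : V) : Prop :=
  forall e : R, 0 < e -> exists2 d : R, 0 < d &
  forall h, nr h < d -> nr (f (x + h) - f x) < e.

Definition cder {R : realType} (g : R[i] -> R[i]) (z a : R[i]) : Prop :=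
  hd g z (fun h => a * h).

Section ComplexDerivative.
Variable R : realType.
Implicit Types V W : normedModType R[i].

Lemma hd_cont V W (f : V -> W) x (L : V -> W) K : hd f x L ->
  (forall h, nr (L h) <= K * nr h) -> ccont f x.
Proof.
move=> hf bL e e0; have [d d0 hd0] := hf 1 ltr01.
have K0 : 0 < `|K| + 2 by rewrite ltr_wpDl.
exists (Num.min d (e / (`|K| + 2))); first by rewrite lt_min d0 divr_gt0.
move=> h; rewrite lt_min ltr_pdivlMr// => /andP[/hd0 h1 h2].
have -> : f (x + h) - f x = (f (x + h) - f x - L h) + L h by rewrite subrK.
apply: le_lt_trans (nrD _ _) _; move: (bL h) (ler_norm K) (nr_ge0 h).
nra.
Qed.

Lemma hd_near V W (f g : V -> W) x L : hd f x L ->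
  (exists2 d : R, 0 < d & forall h, nr h < d -> f (x + h) = g (x + h)) ->
  hd g x L.
Proof.
move=> hf [d d0 fg] e e0; have [d' d'0 hd0] := hf e e0.
exists (Num.min d d'); first by rewrite lt_min d0 d'0.
move=> h; rewrite lt_min => /andP[/fg <- h2].
have /fg : nr (0 : V) < d by rewrite nr0.
by rewrite addr0 => <-; exact: hd0.
Qed.

Lemma cder_cont g z (a : R[i]) : cder g z a -> ccont g z.
Proof. by move=> ha; apply: hd_cont ha _ => h; rewrite nrM. Qed.

Lemma cder_unique g z (a b : R[i]) : cder g z a -> cder g z b -> a = b.
Proof.
move=> ha hb; apply/eqP; rewrite -subr_eq0; apply/eqP; apply: small_nr => e e0.
have e2 : 0 < e / 2 by rewrite divr_gt0.
have [d d0 ha0] := ha _ e2; have [d' d'0 hb0] := hb _ e2.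
have m0 : 0 < Num.min d d' by rewrite lt_min d0.
pose t := Num.min d d' / 2; have t0 : 0 < t by rewrite divr_gt0.
have td : nr (t%:C : R[i]) < Num.min d d'.
  by rewrite nrR gtr0_norm// /t; move: m0; set m := Num.min d d'; lra.
move: (td); rewrite lt_min => /andP[/ha0 h1 /hb0 h2].
have /(le_trans _) := lerD h2 h1.
move=> /(_ (nr ((a - b) * t%:C))) le; suff : nr ((a - b) * t%:C) <= e * t.
  by rewrite nrM nrR gtr0_norm// ler_pM2r.
apply: le_trans (le _) _; last by rewrite nrR gtr0_norm// -mulrDl -splitr.
set u := g _ - _.
have -> : (a - b) * t%:C = (u - b * t%:C) - (u - a * t%:C) by ring.
exact: nrB.
Qed.

Lemma cder_cst z (c : R[i]) : cder (fun=> c) z 0.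
Proof.
move=> e e0; exists 1 => // h _.
by rewrite subrr mul0r subr0 nr0 mulr_ge0 ?nr_ge0// ltW.
Qed.

Lemma cder_id (z : R[i]) : cder id z 1.
Proof.
move=> e e0; exists 1 => // h _.
have -> : id (z + h) - id z - 1 * h = 0 by rewrite /=; ring.
by rewrite nr0 mulr_ge0 ?nr_ge0// ltW.
Qed.

Lemma cderD f g z (a b : R[i]) : cder f z a -> cder g z b ->
  cder (fun w => f w + g w) z (a + b).
Proof.
move=> ha hb e e0; have e2 : 0 < e / 2 by rewrite divr_gt0.
have [d d0 ha0] := ha _ e2; have [d' d'0 hb0] := hb _ e2.
exists (Num.min d d'); first by rewrite lt_min d0.
move=> h; rewrite lt_min => /andP[/ha0 h1 /hb0 h2].
have -> : f (z + h) + g (z + h) - (f z + g z) - (a + b) * h =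
  (f (z + h) - f z - a * h) + (g (z + h) - g z - b * h) by ring.
apply: le_trans (nrD _ _) _; lra.
Qed.

Lemma cderM f g z (a b : R[i]) : cder f z a -> cder g z b ->
  cder (fun w => f w * g w) z (a * g z + f z * b).
Proof.
move=> ha hb e e0.
pose M := nr a + nr b + nr (f z) + nr (g z) + 2.
have M0 : 0 < M by rewrite ltr_wpDl// !addr_ge0 ?nr_ge0.
pose e' := Num.min 1 (e / M / 2).
have e'0 : 0 < e' by rewrite lt_min ltr01 !divr_gt0.
have e'1 : e' <= 1 by rewrite ge_min lexx.
have e'e : e' * M <= e / 2.
  by rewrite -ler_pdivlMr// ge_min (mulrAC e) lexx orbT.
have [d d0 ha0] := ha _ e'0; have [d' d'0 hb0] := hb _ e'0.
have [d1 d10 gc] := cder_cont hb e'0.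
exists (Num.min d (Num.min d' d1)); first by rewrite !lt_min d0 d'0.
move=> h; rewrite !lt_min => /and3P[/ha0 h1 /hb0 h2 /gc h3].
have -> : f (z + h) * g (z + h) - f z * g z - (a * g z + f z * b) * h =
  (f (z + h) - f z - a * h) * (g (z + h) - g z)
  + (f (z + h) - f z - a * h) * g z
  + f z * (g (z + h) - g z - b * h) + a * h * (g (z + h) - g z) by ring.
apply: le_trans (nrD _ _) _.
apply: le_trans (lerD (nrD _ _) (lexx _)) _.
apply: le_trans (lerD (lerD (nrD _ _) (lexx _)) (lexx _)) _.
rewrite !nrM; set u := nr (_ - a * h) in h1 *; set v := nr (_ - b * h) in h2 *.
set w := nr (g (z + h) - g z) in h3 *; set H := nr h in h1 h2 *.
have H0 : 0 <= H := nr_ge0 _; have u0 : 0 <= u := nr_ge0 _.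
have w0 : 0 <= w := nr_ge0 _; have v0 : 0 <= v := nr_ge0 _.
have [A0 B0] : 0 <= nr a /\ 0 <= nr b by split; exact: nr_ge0.
have [F0 G0] : 0 <= nr (f z) /\ 0 <= nr (g z) by split; exact: nr_ge0.
have p1 : u * w <= e' * H.
  apply: le_trans (_ : u * 1 <= _); last by rewrite mulr1.
  by rewrite ler_wpM2l//; lra.
have p2 : u * nr (g z) <= e' * H * nr (g z) by rewrite ler_wpM2r.
have p3 : nr (f z) * v <= nr (f z) * (e' * H) by rewrite ler_wpM2l.
have p4 : nr a * H * w <= nr a * H * e' by rewrite ler_wpM2l ?mulr_ge0// ltW.
have p5 : e' * M * H <= e * H by rewrite ler_wpM2r//; lra.
apply: le_trans p5; rewrite /M.
have : 0 <= e' * H * (nr b + 1) by rewrite !mulr_ge0 ?addr_ge0// ltW.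
nra.
Qed.

Lemma cderZ f z (a c : R[i]) : cder f z a -> cder (fun w => c * f w) z (c * a).
Proof.
by move=> /(cderM (cder_cst z c)); rewrite mul0r add0r.
Qed.

Lemma cderN f z (a : R[i]) : cder f z a -> cder (fun w => - f w) z (- a).
Proof.
move=> /(cderZ (-1)); rewrite mulN1r; congr cder; apply: funext => w.
by rewrite mulN1r.
Qed.

Lemma cderB f g z (a b : R[i]) : cder f z a -> cder g z b ->
  cder (fun w => f w - g w) z (a - b).
Proof. by move=> ha /cderN; exact: cderD. Qed.

Lemma cder_comp f g z (a b : R[i]) : cder f z a -> cder g (f z) b ->
  cder (fun w => g (f w)) z (b * a).
Proof.
move=> ha hb e e0.
pose M := nr a + nr b + 2.
have M0 : 0 < M by rewrite ltr_wpDl// !addr_ge0 ?nr_ge0.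
pose e' := Num.min 1 (e / M).
have e'0 : 0 < e' by rewrite lt_min ltr01 !divr_gt0.
have e'1 : e' <= 1 by rewrite ge_min lexx.
have e'e : e' * M <= e by rewrite -ler_pdivlMr// ge_min lexx orbT.
have [d d0 ha0] := ha _ e'0; have [d' d'0 hb0] := hb _ e'0.
have [d1 d10 fc] := cder_cont ha d'0.
exists (Num.min d d1); first by rewrite !lt_min d0.
move=> h; rewrite !lt_min => /andP[/ha0 h1 /fc /hb0].
have -> : f z + (f (z + h) - f z) = f (z + h) by ring.
set k := f (z + h) - f z in h1 * => h2.
have -> : g (f (z + h)) - g (f z) - b * a * h =
  (g (f (z + h)) - g (f z) - b * k) + b * (k - a * h) by ring.
apply: le_trans (nrD _ _) _; rewrite nrM.
have k1 : nr k <= (e' + nr a) * nr h.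
  rewrite -[k](subrK (a * h)); apply: le_trans (nrD _ _) _.
  by rewrite nrM mulrDl lerD2r.
have p1 : nr b * nr (k - a * h) <= nr b * (e' * nr h).
  by rewrite ler_wpM2l ?nr_ge0.
have p2 : e' * nr k <= e' * ((e' + nr a) * nr h) by rewrite ler_wpM2l// ltW.
have p5 : e' * M * nr h <= e * nr h by rewrite ler_wpM2r ?nr_ge0.
apply: le_trans p5; rewrite /M.
have p6 : e' * (nr h * e') <= e' * (nr h * 1).
  by rewrite ler_wpM2l ?ler_wpM2l ?nr_ge0// ltW.
have : 0 <= e' * nr h by rewrite mulr_ge0 ?nr_ge0// ltW.
nra.
Qed.

Lemma cder_inv (z : R[i]) : z != 0 -> cder (fun w => w^-1) z (- z^-2).
Proof.
move=> z0 e e0; have nz := nr_gt0 z0.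
(* The remainder is [h ^+ 2 / (z ^+ 2 * (z + h))]. The first bound keeps [nr (z + h)] above
   [nr z / 2]; the second then makes the remainder at most [e * nr h]. *)
pose d := Num.min (nr z / 2) (e * nr z ^+ 3 / 2).
have d0 : 0 < d by rewrite lt_min !divr_gt0 ?mulr_gt0 ?exprn_gt0.
exists d => // h; rewrite lt_min => /andP[h1 h2].
have nzh : nr z / 2 <= nr (z + h).
  have := nrB (z + h) h; rewrite addrK; lra.
have zh0 : z + h != 0.
  apply/eqP => zh; move: nzh; rewrite zh nr0; lra.
have -> : (z + h)^-1 - z^-1 - - z^-2 * h = (z ^+ 2 * (z + h))^-1 * h ^+ 2.
  by field; rewrite z0 zh0.
rewrite nrM nrV nrM !nrX expr2 mulrA ler_wpM2r ?nr_ge0//.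
have p0 : 0 < nr z ^+ 2 * nr (z + h).
  rewrite mulr_gt0 ?exprn_gt0//; lra.
rewrite mulrC ler_pdivrMr//; apply: le_trans (ltW h2) _.
rewrite -mulrA ler_wpM2l ?(ltW e0)// exprSr -mulrA ler_wpM2l//.
by rewrite exprn_ge0// ltW.
Qed.

Lemma cderV f z (a : R[i]) : f z != 0 -> cder f z a ->
  cder (fun w => (f w)^-1) z (- (f z)^-2 * a).
Proof. by move=> f0 ha; apply: cder_comp ha _; exact: cder_inv. Qed.

Lemma cder_horner (p : {poly R[i]}) z : cder (horner p) z p^`().[z].
Proof.
elim/poly_ind: p => [|p c ih].
  rewrite deriv0 horner0; have := cder_cst z 0; congr cder.
  by apply: funext => w; rewrite horner0.
rewrite derivD derivC addr0 derivM derivX mulr1 !hornerE.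
have := cderD (cderM ih (cder_id z)) (cder_cst z c).
rewrite addr0 mulr1; congr cder.
by apply: funext => w; rewrite !hornerE.
Qed.

Lemma hd_line V (F : V -> R[i]) x v z (L : {linear V -> R[i]}) :
  hd F (x + z *: v) L -> cder (fun w => F (x + w *: v)) z (L v).
Proof.
move=> hF e e0.
have v0 : 0 < nr v + 1 by rewrite ltr_wpDl// nr_ge0.
have e1 : 0 < e / (nr v + 1) by rewrite divr_gt0.
have [d d0 hd0] := hF _ e1.
exists (d / (nr v + 1)); first by rewrite divr_gt0.
move=> h; rewrite ltr_pdivlMr// => hh.
have := hd0 (h *: v); rewrite linearZ/= nrZ.
have -> : x + z *: v + h *: v = x + (z + h) *: v by rewrite scalerDl addrA.
rewrite -[h *: L v]/(h * L v) (mulrC h (L v)) => le.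
have hv : nr h * nr v < d.
  by apply: le_lt_trans hh; rewrite ler_wpM2l ?nr_ge0// lerDl.
apply: le_trans (le hv) _; rewrite mulrAC ler_pdivrMr//.
by rewrite mulrA ler_wpM2l ?lerDl// mulr_ge0 ?nr_ge0// ltW.
Qed.

End ComplexDerivative.

Section RealDerivative.
Variable R : realType.
Implicit Types (u : R -> R) (t l : R).

(** Both directions serve: one brings the real exponential, sine and cosine to [cder], the other
    delivers a [cder] to the real mean value theorem. *)
Lemma is_derive_epsP u t l : is_derive t 1 u l <->
  forall e : R, 0 < e -> exists2 d : R, 0 < d &
  forall s, `|s| < d -> `|u (t + s) - u t - l * s| <= e * `|s|.
Proof.
split.
  move=> [du ul] e e0; move: du; rewrite /derivable => /cvg_ex[l' cl].
  have ll : l' = l by rewrite -ul /derive; symmetry; apply/cvg_lim.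
  move: cl => /cvgrPdist_le/(_ e e0)/nbhs_normP[d /= d0 hd0].
  exists d => // s sd; have [->|s0] := eqVneq s 0.
    by rewrite addr0 mulr0 subrr subr0 normr0 mulr0.
  have ns : 0 < `|s| by rewrite normr_gt0.
  have := hd0 s; rewrite /= sub0r normrN => /(_ sd s0).
  rewrite distrC -(ler_pM2r ns) -normrM mulrBl.
  rewrite -[s^-1 *: _]/(s^-1 * _) mulrAC mulVf// mul1r.
  by rewrite -[s *: 1]/(s * 1) mulr1 (addrC s) ll.
move=> h.
have c : ((s^-1 *: ((u \o shift t) (s *: (1 : R)) - u t))
    @[s --> (0 : R)^'] --> l)%classic.
  apply/cvgrPdist_le => e e0; have [d d0 hd0] := h e e0.
  apply/nbhs_normP; exists d => // s /=; rewrite sub0r normrN => sd s0.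
  have ns : 0 < `|s| by rewrite normr_gt0.
  rewrite distrC -(ler_pM2r ns) -normrM mulrBl.
  rewrite -[s^-1 *: _]/(s^-1 * _) mulrAC mulVf// mul1r.
  rewrite -[s *: 1]/(s * 1) mulr1 (addrC s); exact: hd0.
split; first by apply/cvg_ex; exists l.
by rewrite /derive; apply/cvg_lim.
Qed.
End RealDerivative.

Section MeanValue.
Variable R : realType.

(** A unimodular factor turns a bound on a modulus into a bound on a real part; real theorems are
    transferred to complex values in this way throughout. *)
Lemma rotate_norm (z : R[i]) :
  exists2 c : R[i], nr c = 1 & c * z = (nr z)%:C.
Proof.
have [->|z0] := eqVneq z 0; first by exists 1; rewrite ?nr1 ?nr0 ?mulr0.
have nz := nr_gt0 z0.
exists (cj z * ((nr z)^-1)%:C).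
  by rewrite nrM nrJ nrR gtr0_norm ?invr_gt0// mulfV// gt_eqF.
rewrite mulrAC (mulrC _ z) mulJ -rmorphM/=.
by congr _%:C; field; rewrite gt_eqF.
Qed.

Lemma cder_real_line (g : R[i] -> R[i]) (z h c a : R[i]) (t : R) :
  cder g (z + t%:C * h) a ->
  is_derive t 1 (fun t : R => complex.Re (c * g (z + t%:C * h)))
    (complex.Re (c * (a * h))).
Proof.
move=> ga; apply/is_derive_epsP => e e0.
have M0 : 0 < nr c * nr h + 1 by rewrite ltr_wpDl// mulr_ge0 ?nr_ge0.
have h0 : 0 < nr h + 1 by rewrite ltr_wpDl// nr_ge0.
have e1 : 0 < e / (nr c * nr h + 1) by rewrite divr_gt0.
have [d d0 hd0] := ga _ e1; exists (d / (nr h + 1)); first by rewrite divr_gt0.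
move=> s; rewrite ltr_pdivlMr// => sd.
have sh : nr (s%:C * h) < d.
  by apply: le_lt_trans sd; rewrite nrM nrR ler_wpM2l// lerDl.
have := hd0 _ sh.
have -> : z + t%:C * h + s%:C * h = z + (t + s)%:C * h by rewrite rmorphD/=; ring.
set A := g (z + (t + s)%:C * h); set B := g (z + t%:C * h) => le.
have -> : complex.Re (c * A) - complex.Re (c * B) - complex.Re (c * (a * h)) * s
   = complex.Re (c * (A - B - a * (s%:C * h))).
  have -> : c * (A - B - a * (s%:C * h)) = c * A - c * B - s%:C * (c * (a * h)).
    by ring.
  by rewrite !ReD !ReN (ReM s%:C)/= mul0r subr0; ring.
apply: le_trans (normRe_le _) _; rewrite nrM.
apply: le_trans (ler_wpM2l (nr_ge0 _) le) _.
rewrite nrM nrR mulrCA; set C := nr c * nr h + 1 in M0 *.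
have -> : e / C * (nr c * (`|s| * nr h)) = e * `|s| * (nr c * nr h / C).
  by field; rewrite gt_eqF.
rewrite ler_piMr ?mulr_ge0 ?(ltW e0)//.
by rewrite ler_pdivrMr// mul1r lerDl.
Qed.

(** The real mean value theorem is applied to the real part of [c * g], where [c] rotates the
    increment of [g] onto its modulus. *)
Lemma mean_value_ineq (g : R[i] -> R[i]) (z h : R[i]) (M : R) :
  (forall t : R, 0 <= t <= 1 ->
    exists2 a, cder g (z + t%:C * h) a & nr (a * h) <= M) ->
  nr (g (z + h) - g z) <= M.
Proof.
move=> hg; have [c c1 cE] := rotate_norm (g (z + h) - g z).
pose u (t : R) := complex.Re (c * g (z + t%:C * h)).
have du (t : R) : 0 <= t <= 1 -> derivable u t 1.
  by move=> /hg[a ga _]; have [] := cder_real_line c ga.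
have cu : {within `[0, 1], continuous u}%classic.
  apply: derivable_within_continuous => t; rewrite in_itv/=; exact: du.
have du' (t : R) : t \in `]0, 1[ -> is_derive t 1 u ('D_1 u t).
  by rewrite in_itv/= => /andP[t0 t1]; apply/derivableP/du; rewrite !ltW.
have [t] := MVT_segment ler01 du' cu.
rewrite in_itv/= => t01; have [a ga na] := hg t t01.
have [_] := cder_real_line c ga; rewrite -/u => ->.
rewrite subr0 mulr1 /u rmorph1 rmorph0 mul1r mul0r addr0 => uE.
have -> : nr (g (z + h) - g z) = complex.Re (c * (a * h)).
  by rewrite -uE -ReN -ReD -mulrBr cE.
by apply: le_trans (Re_le _) _; rewrite nrM c1 mul1r.
Qed.

End MeanValue.

Definition expc {R : realType} (z : R[i]) : R[i] :=
  Complex (expR (complex.Re z) * cos (complex.Im z))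
          (expR (complex.Re z) * sin (complex.Im z)).

Section Exponential.
Variable R : realType.
Implicit Types z w : R[i].

Lemma expcD z w : expc (z + w) = expc z * expc w.
Proof.
case: z => a b; case: w => c d; rewrite /expc; simpc => /=.
by rewrite expRD cosD sinD; congr Complex; ring.
Qed.

Lemma nr_expc z : nr (expc z) = expR (complex.Re z).
Proof.
rewrite nr_eq /= !exprMn -mulrDr cos2Dsin2 mulr1 sqrtr_sqr ger0_norm//.
Qed.

(** The addition formula reduces the claim to [expc h - 1 - h], which is expressed by the
    first-order remainders of the real exponential, cosine and sine at 0. *)
Lemma cder_expc z : cder expc z (expc z).
Proof.
move=> e e0.
(* 9 = 4 + 5, the factors found below for the real and the imaginary part of the remainder. *)
pose K := 9 * (expR (complex.Re z) + 1).
have E0 := expR_gt0 (complex.Re z).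
have K0 : 0 < K by rewrite /K; lra.
pose e' := Num.min 1 (e / K).
have e'0 : 0 < e' by rewrite lt_min ltr01 divr_gt0.
have e'1 : e' <= 1 by rewrite ge_min lexx.
have e'e : e' * K <= e by rewrite -ler_pdivlMr// ge_min lexx orbT.
have /is_derive_epsP/(_ _ e'0)[d1 d10 h1] := is_derive_expR (0 : R).
have /is_derive_epsP/(_ _ e'0)[d2 d20 h2] := is_derive_cos (0 : R).
have /is_derive_epsP/(_ _ e'0)[d3 d30 h3] := is_derive_sin (0 : R).
exists (Num.min e' (Num.min d1 (Num.min d2 d3))).
  by rewrite lt_min e'0 /= lt_min d10 /= lt_min d20.
case=> a b; set h := Complex a b.
rewrite lt_min => /andP[l0]; rewrite lt_min => /andP[l1].
rewrite lt_min => /andP[l2 l3].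
have ah : `|a| <= nr h := normRe_le h.
have bh : `|b| <= nr h := normIm_le h.
have := h1 _ (le_lt_trans ah l1); have := h2 _ (le_lt_trans bh l2).
have := h3 _ (le_lt_trans bh l3).
rewrite !add0r expR0 cos0 sin0 oppr0 !mul0r !mul1r !subr0 addr0.
set rs := sin b - b; set rc := cos b - 1; set re := expR a - 1 - a.
move=> b3 b2 b1.
rewrite expcD -[X in _ - X - _]mulr1 -mulrBr -mulrBr nrM nr_expc.
have -> : expc h - 1 - h = Complex (re + rc * (1 + a + re))
    ((a + re) * b + rs * (1 + a + re)).
  by rewrite /expc /h; apply: eqC => /=; rewrite /re /rc /rs; ring.
have := nr_le (Complex (re + rc * (1 + a + re))
  ((a + re) * b + rs * (1 + a + re))); rewrite /= => le.
have H0 := nr_ge0 h; set H := nr h in ah bh l0 H0 *.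
have q1 : `|re| <= e' * H by apply: le_trans b1 _; rewrite ler_pM2l.
have q2 : `|rc| <= e' * H by apply: le_trans b2 _; rewrite ler_pM2l.
have q3 : `|rs| <= e' * H by apply: le_trans b3 _; rewrite ler_pM2l.
have eH : e' * H <= H by rewrite ler_piMl.
have q4 : `|a + re| <= 2 * e'.
  by apply: le_trans (ler_normD _ _) _; nra.
have q5 : `|1 + a + re| <= 3.
  rewrite -addrA; apply: le_trans (ler_normD _ _) _; rewrite normr1; lra.
have q6 : `|re + rc * (1 + a + re)| <= 4 * (e' * H).
  apply: le_trans (ler_normD _ _) _; rewrite normrM.
  have := ler_pM (normr_ge0 _) (normr_ge0 _) q2 q5; lra.
have q7 : `|(a + re) * b + rs * (1 + a + re)| <= 5 * (e' * H).
  apply: le_trans (ler_normD _ _) _; rewrite !normrM.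
  have := ler_pM (normr_ge0 _) (normr_ge0 _) q3 q5.
  have := ler_pM (normr_ge0 _) (normr_ge0 _) q4 bh; lra.
have q8 : e' * K * H <= e * H by rewrite ler_wpM2r.
apply: le_trans q8; apply: le_trans (ler_wpM2l (ltW E0) le) _.
apply: le_trans (ler_wpM2l (ltW E0) (lerD q6 q7)) _.
rewrite /K; have : 0 <= e' * H by rewrite mulr_ge0 // ltW.
nra.
Qed.

End Exponential.

(** * Contour integrals and circle means *)

Definition ccs {R : realType} (a b : R) (phi : R -> R[i]) : Prop :=
  forall t, a <= t <= b -> forall e : R, 0 < e -> exists2 d : R, 0 < d &
  forall s, a <= s <= b -> `|s - t| < d -> nr (phi s - phi t) < e.

Definition cint {R : realType} (a b : R) (phi : R -> R[i]) : R[i] :=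
  Complex
    (\int[lebesgue_measure]_(t in [set` `[a, b]]) complex.Re (phi t))
    (\int[lebesgue_measure]_(t in [set` `[a, b]]) complex.Im (phi t)).

Section ComplexIntegral.
Variable R : realType.
Implicit Types (a b c : R) (phi psi : R -> R[i]).
Local Notation mu := (@lebesgue_measure R).

Lemma eps_integrable a b (u : R -> R) :
  (forall t, a <= t <= b -> forall e : R, 0 < e -> exists2 d : R, 0 < d &
    forall s, a <= s <= b -> `|s - t| < d -> `|u s - u t| < e) ->
  mu.-integrable [set` `[a, b]] (EFin \o u).
Proof.
move=> h; apply: continuous_compact_integrable; first exact: segment_compact.
apply/subspace_continuousP => t /=; rewrite in_itv/= => tab.
apply/cvgrPdist_lt => e e0; have [d d0 hd0] := h t tab e e0.
apply/nbhs_normP; exists d => // s /= st; rewrite in_itv/= => sab.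
by rewrite distrC; apply: hd0 => //; rewrite distrC.
Qed.

Lemma ccs_Re a b phi : ccs a b phi ->
  mu.-integrable [set` `[a, b]] (EFin \o (fun t => complex.Re (phi t))).
Proof.
move=> h; apply: eps_integrable => t /h{}h e /h[d d0 hd0]; exists d => // s.
move=> sab /(hd0 s sab); apply: le_lt_trans.
by rewrite -ReN -ReD; exact: normRe_le.
Qed.

Lemma ccs_Im a b phi : ccs a b phi ->
  mu.-integrable [set` `[a, b]] (EFin \o (fun t => complex.Im (phi t))).
Proof.
move=> h; apply: eps_integrable => t /h{}h e /h[d d0 hd0]; exists d => // s.
move=> sab /(hd0 s sab); apply: le_lt_trans.
by rewrite -ImN -ImD; exact: normIm_le.
Qed.

Lemma ccs_sub a b a' b' phi : a <= a' -> b' <= b -> ccs a b phi ->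
  ccs a' b' phi.
Proof.
move=> aa bb h t /andP[t1 t2] e e0.
have [|d d0 hd0] := h t _ e e0; first by rewrite (le_trans aa) ?(le_trans t2).
exists d => // s /andP[s1 s2]; apply: hd0.
by rewrite (le_trans aa) ?(le_trans s2).
Qed.

Lemma ccsD a b phi psi : ccs a b phi -> ccs a b psi ->
  ccs a b (fun t => phi t + psi t).
Proof.
move=> h1 h2 t tab e e0; have e2 : 0 < e / 2 by rewrite divr_gt0.
have [d d0 hd] := h1 t tab _ e2; have [d' d'0 hd'] := h2 t tab _ e2.
exists (Num.min d d'); first by rewrite lt_min d0.
move=> s sab; rewrite lt_min => /andP[/(hd s sab) l1 /(hd' s sab) l2].
have -> : phi s + psi s - (phi t + psi t) = (phi s - phi t) + (psi s - psi t).
  by ring.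
apply: le_lt_trans (nrD _ _) _; lra.
Qed.

Lemma ccsZ a b phi (k : R[i]) : ccs a b phi -> ccs a b (fun t => k * phi t).
Proof.
move=> h t tab e e0; have k0 : 0 < nr k + 1 by rewrite ltr_wpDl// nr_ge0.
have e1 : 0 < e / (nr k + 1) by rewrite divr_gt0.
have [d d0 hd] := h t tab _ e1; exists d => // s sab /(hd s sab).
rewrite ltr_pdivlMr// -mulrBr nrM; apply: le_lt_trans.
by rewrite mulrC ler_wpM2l ?nr_ge0// lerDl.
Qed.

Lemma ccs_cst a b (k : R[i]) : ccs a b (fun=> k).
Proof. by move=> t tab e e0; exists 1 => // s _ _; rewrite subrr nr0. Qed.

Lemma ccsB a b phi psi : ccs a b phi -> ccs a b psi ->
  ccs a b (fun t => phi t - psi t).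
Proof.
move=> h1 /(ccsZ (-1)) h2; have := ccsD h1 h2; congr ccs.
by apply: funext => t; rewrite mulN1r.
Qed.

Lemma eq_cint a b phi psi : (forall t, a <= t <= b -> phi t = psi t) ->
  cint a b phi = cint a b psi.
Proof.
move=> h; congr Complex; apply: eq_Rintegral => t;
  by rewrite inE/= in_itv/= => /h ->.
Qed.

Lemma cintD a b phi psi : ccs a b phi -> ccs a b psi ->
  cint a b (fun t => phi t + psi t) = cint a b phi + cint a b psi.
Proof.
move=> h1 h2; rewrite /cint; simpc; congr Complex.
  under eq_Rintegral do rewrite ReD.
  by rewrite RintegralD//; exact: ccs_Re.
under eq_Rintegral do rewrite ImD.
by rewrite RintegralD//; exact: ccs_Im.
Qed.

Lemma cintZ a b phi (k : R[i]) : ccs a b phi ->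
  cint a b (fun t => k * phi t) = k * cint a b phi.
Proof.
move=> h; have [h1 h2] := (ccs_Re h, ccs_Im h).
have hZ (r : R) (u : R -> R) : mu.-integrable [set` `[a, b]] (EFin \o u) ->
    mu.-integrable [set` `[a, b]] (EFin \o (fun t => r * u t)).
  move=> iu; have -> : EFin \o (fun t => r * u t) =
      (fun t => r%:E * (EFin \o u) t)%E by [].
  exact: integrableZl.
case: k => x y; rewrite /cint; simpc; congr Complex.
  under eq_Rintegral do rewrite ReM/=.
  by rewrite RintegralB ?RintegralZl//; exact: hZ.
under eq_Rintegral do rewrite ImM/=.
by rewrite RintegralD ?RintegralZl//; exact: hZ.
Qed.

Lemma cintB a b phi psi : ccs a b phi -> ccs a b psi ->
  cint a b (fun t => phi t - psi t) = cint a b phi - cint a b psi.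
Proof.
move=> h1 h2; rewrite -[- cint _ _ _]mulN1r -cintZ// -cintD//; last exact: ccsZ.
by apply: eq_cint => t _; rewrite mulN1r.
Qed.

Lemma cint_cst a b (k : R[i]) : a <= b -> cint a b (fun=> k) = k * (b - a)%:C.
Proof.
move=> ab; rewrite /cint !Rintegral_cst//= lebesgue_measure_itv/= lte_fin.
have -> : fine (if a < b then (b%:E + (- a)%:E)%E else 0%E) = b - a.
  by case: ltgtP ab => //= -> _; rewrite subrr.
by case: k => x y; simpc.
Qed.

Lemma cint_split a b c phi : a <= c -> c <= b -> ccs a b phi ->
  cint a b phi = cint a c phi + cint c b phi.
Proof.
move=> ac cb h; have [h1 h2] := (ccs_Re h, ccs_Im h).
have split (u : R -> R) : mu.-integrable [set` `[a, b]] (EFin \o u) ->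
    \int[mu]_(t in [set` `[a, b]]) u t = \int[mu]_(t in [set` `[a, c]]) u t
     + \int[mu]_(t in [set` `[c, b]]) u t.
  move=> iu; rewrite -(@Rintegral_itv_obnd_cbnd _ c (BRight b)).
    by rewrite -(Rintegral_itvB iu) ?bnd_simp//; ring.
  apply: integrableS iu => //; apply: subset_itv; by rewrite bnd_simp.
by rewrite /cint (split _ h1) (split _ h2); simpc.
Qed.

Lemma cint_le a b phi (M : R) : a <= b -> ccs a b phi ->
  (forall t, a <= t <= b -> nr (phi t) <= M) ->
  nr (cint a b phi) <= M * (b - a).
Proof.
move=> ab h hM; have [k k1 kE] := rotate_norm (cint a b phi).
have := congr1 (@complex.Re R) kE; rewrite -cintZ//= => <-.
have := congr1 (@complex.Re R) (cint_cst M%:C ab); rewrite -rmorphM/= => <-.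
apply: le_Rintegral => //.
- exact: ccs_Re (ccsZ k h).
- by have := ccs_Re (ccs_cst (a := a) (b := b) M%:C).
- move=> t; rewrite /= in_itv/= => /hM tM.
  by apply: le_trans (Re_le _) _; rewrite nrM k1 mul1r.
Qed.

Lemma cint_Re_ge0 a b phi :
  (forall t, a <= t <= b -> 0 <= complex.Re (phi t)) ->
  0 <= complex.Re (cint a b phi).
Proof. by move=> h; apply: Rintegral_ge0 => t; rewrite /= in_itv; exact: h. Qed.

End ComplexIntegral.

(** * Goursat's theorem on rectangles, by bisection *)

Section Bisection.
Variable R : realType.
Implicit Types a b c d x y : R.

Lemma half_pow_lt (s e : R) : 0 < e -> exists n, s / 2 ^+ n < e.
Proof.
move=> e0; have [s0|s0] := leP s 0.
  by exists 0%N; rewrite expr0 divr1; exact: le_lt_trans e0.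
have := archi_boundP (ltW (divr_gt0 s0 e0)); set n := Num.bound _ => hn.
exists n; rewrite ltr_pdivrMr ?exprn_gt0// mulrC -ltr_pdivrMr//.
by apply: lt_trans hn _; rewrite -natrX ltr_nat ltn_expl.
Qed.

Lemma nested_point (l r : nat -> R) :
  (forall n, l n <= l n.+1) -> (forall n, r n.+1 <= r n) ->
  (forall n, l n <= r n) ->
  exists x, forall n, l n <= x <= r n.
Proof.
move=> hl hr hlr.
have lmono m n : (m <= n)%N -> l m <= l n.
  elim: n => [|n ih]; first by rewrite leqn0 => /eqP ->.
  by rewrite leq_eqVlt => /predU1P[->//|/ih/le_trans]; apply.
have rmono m n : (m <= n)%N -> r n <= r m.
  elim: n => [|n ih]; first by rewrite leqn0 => /eqP ->.
  by rewrite leq_eqVlt => /predU1P[->//|/ih]; apply: le_trans.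
have lr m n : l m <= r n.
  apply: le_trans (lmono _ _ (leq_maxl m n)) _.
  exact: le_trans (hlr _) (rmono _ _ (leq_maxr m n)).
have supl : has_sup (range l).
  by split; [exists (l 0%N), 0%N | exists (r 0%N) => _ [n _ <-]].
exists (sup (range l)) => n; apply/andP; split.
  by apply: ub_le_sup; [case: supl | exists n].
by apply: ge_sup; [case: supl | move=> _ [m _ <-]].
Qed.

(** If [P] failed, every bad rectangle would have a bad quarter. The nested bad rectangles shrink to
    a point, where the local hypothesis contradicts them. *)
Lemma bisection (P : R -> R -> R -> R -> Prop) a0 b0 c0 d0 :
  a0 <= b0 -> c0 <= d0 ->
  (forall a b c d, a <= b -> c <= d ->
    P a ((a + b) / 2) c ((c + d) / 2) -> P a ((a + b) / 2) ((c + d) / 2) d ->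
    P ((a + b) / 2) b c ((c + d) / 2) -> P ((a + b) / 2) b ((c + d) / 2) d ->
    P a b c d) ->
  (forall x y, a0 <= x <= b0 -> c0 <= y <= d0 ->
    exists2 e : R, 0 < e & forall a b c d, a0 <= a -> b <= b0 -> c0 <= c ->
      d <= d0 -> a <= x <= b -> c <= y <= d -> (b - a) + (d - c) < e ->
      P a b c d) ->
  P a0 b0 c0 d0.
Proof.
move=> ab0 cd0 Psub Ploc; apply: contrapT => nP.
pose Q (s : R * R * R * R) := let: (a, b, c, d) := s in
  [/\ a <= b, c <= d & ~ P a b c d].
pose T (s t : R * R * R * R) :=
  let: (a, b, c, d) := s in let: (a', b', c', d') := t in
  [/\ a <= a', b' <= b, c <= c', d' <= d &
   (b' - a') + (d' - c') = ((b - a) + (d - c)) / 2].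
(* Stated for every [s], with [Q s] inside the conclusion, because [choice] asks for a total
   relation; a rectangle that is not bad is simply returned. *)
have step s : exists t, Q s -> Q t /\ T s t.
  case: s => [[[a b] c] d]; have [|nq] := pselect (Q (a, b, c, d)); last first.
    by exists (a, b, c, d).
  move=> [ab cd np].
  have [p1|n1] := pselect (P a ((a + b) / 2) c ((c + d) / 2)); last first.
    exists (a, (a + b) / 2, c, (c + d) / 2) => _.
    by split; split => //; try field; lra.
  have [p2|n2] := pselect (P a ((a + b) / 2) ((c + d) / 2) d); last first.
    exists (a, (a + b) / 2, (c + d) / 2, d) => _.
    by split; split => //; try field; lra.
  have [p3|n3] := pselect (P ((a + b) / 2) b c ((c + d) / 2)); last first.
    exists ((a + b) / 2, b, c, (c + d) / 2) => _.
    by split; split => //; try field; lra.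
  have [p4|n4] := pselect (P ((a + b) / 2) b ((c + d) / 2) d); last first.
    exists ((a + b) / 2, b, (c + d) / 2, d) => _.
    by split; split => //; try field; lra.
  by exfalso; apply: np; exact: Psub.
have [f hf] := choice step.
pose s n := iter n f (a0, b0, c0, d0).
have Qs n : Q (s n).
  by elim: n => [|n /hf[]]; [split | rewrite /s iterS].
have Ts n : T (s n) (s n.+1) by have [] := hf _ (Qs n).
pose A n := (s n).1.1.1; pose B n := (s n).1.1.2.
pose C n := (s n).1.2; pose D n := (s n).2.
have sE n : s n = (A n, B n, C n, D n).
  by rewrite /A /B /C /D; case: (s n) => [[[]]].
have QE n : [/\ A n <= B n, C n <= D n & ~ P (A n) (B n) (C n) (D n)].
  by have := Qs n; rewrite sE.
have TE n : [/\ A n <= A n.+1, B n.+1 <= B n, C n <= C n.+1, D n.+1 <= D n &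
   (B n.+1 - A n.+1) + (D n.+1 - C n.+1) = ((B n - A n) + (D n - C n)) / 2].
  by have := Ts n; rewrite !sE.
have [x hx] : exists x, forall n, A n <= x <= B n.
  by apply: nested_point => n; [case: (TE n)|case: (TE n)|case: (QE n)].
have [y hy] : exists y, forall n, C n <= y <= D n.
  by apply: nested_point => n; [case: (TE n)|case: (TE n)|case: (QE n)].
have [e e0 he] := Ploc x y (hx 0%N) (hy 0%N).
have size n : (B n - A n) + (D n - C n) = ((b0 - a0) + (d0 - c0)) / 2 ^+ n.
  elim: n => [|n ih]; first by rewrite expr0 divr1.
  by have [_ _ _ _ ->] := TE n; rewrite ih exprSr invfM mulrA.
have bnd n : [/\ a0 <= A n, B n <= b0, c0 <= C n & D n <= d0].
  elim: n => [|n [h1 h2 h3 h4]]; first by split.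
  have [k1 k2 k3 k4 _] := TE n; split.
  - exact: le_trans k1.
  - exact: le_trans h2.
  - exact: le_trans k3.
  - exact: le_trans h4.
have [n] := half_pow_lt ((b0 - a0) + (d0 - c0)) e0; rewrite -size => sz.
have [_ _] := QE n; apply; have [h1 h2 h3 h4] := bnd n; exact: he.
Qed.

End Bisection.

Section Goursat.
Variable R : realType.
Implicit Types (F : R[i] -> R[i]) (a b c d x y : R).

(** The integral of [F] over the boundary of the rectangle, counterclockwise: bottom minus top, then
    right minus left with dz = i dy. *)
Definition rect_int F a b c d : R[i] :=
  cint a b (fun x => F (Complex x c) - F (Complex x d)) +
  'i * cint c d (fun y => F (Complex b y) - F (Complex a y)).

Definition cont_rect F a b c d := forall x y, a <= x <= b -> c <= y <= d ->
  ccont F (Complex x y).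

Lemma ccs_horizontal F a b c d y : cont_rect F a b c d -> c <= y <= d ->
  ccs a b (fun x => F (Complex x y)).
Proof.
move=> hF cyd x xab e e0; have [r r0 hr] := hF x y xab cyd e e0.
exists r => // s sab sx; have := hr (s - x)%:C; rewrite nrR => /(_ sx).
by have -> : Complex x y + (s - x)%:C = Complex s y by simpc; rewrite addrC subrK.
Qed.

Lemma ccs_vertical F a b c d x : cont_rect F a b c d -> a <= x <= b ->
  ccs c d (fun y => F (Complex x y)).
Proof.
move=> hF axb y ycd e e0; have [r r0 hr] := hF x y axb ycd e e0.
exists r => // s scd sy; have := hr ((s - y)%:C * 'i).
have -> : nr ((s - y)%:C * 'i) = `|s - y|.
  by rewrite nrM nrR [nr 'i]nr_eq/= expr0n expr1n add0r sqrtr1 mulr1.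
move=> /(_ sy).
have -> : Complex x y + (s - y)%:C * 'i = Complex x s => //.
by simpc; rewrite addrC subrK.
Qed.

Lemma rect_int_split F a b c d m n : cont_rect F a b c d ->
  a <= m <= b -> c <= n <= d ->
  rect_int F a b c d = rect_int F a m c n + rect_int F a m n d +
    (rect_int F m b c n + rect_int F m b n d).
Proof.
move=> hF /andP[am mb] /andP[cn nd].
have ab := le_trans am mb; have cd := le_trans cn nd.
have H y : c <= y <= d -> [/\ ccs a b (fun x => F (Complex x y)),
   ccs a m (fun x => F (Complex x y)) & ccs m b (fun x => F (Complex x y))].
  move=> hy; have h := ccs_horizontal hF hy.
  by split=> //; apply: ccs_sub h.
have V x : a <= x <= b -> [/\ ccs c d (fun y => F (Complex x y)),
   ccs c n (fun y => F (Complex x y)) & ccs n d (fun y => F (Complex x y))].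
  move=> hx; have h := ccs_vertical hF hx.
  by split=> //; apply: ccs_sub h.
have cc : c <= c <= d by rewrite lexx.
have dd : c <= d <= d by rewrite lexx andbT.
have nn : c <= n <= d by rewrite cn.
have aa : a <= a <= b by rewrite lexx.
have bb : a <= b <= b by rewrite lexx andbT.
have mm : a <= m <= b by rewrite am.
have [Hc1 Hc2 Hc3] := H c cc; have [Hd1 Hd2 Hd3] := H d dd.
have [Hn1 Hn2 Hn3] := H n nn.
have [Va1 Va2 Va3] := V a aa; have [Vb1 Vb2 Vb3] := V b bb.
have [Vm1 Vm2 Vm3] := V m mm.
rewrite /rect_int !cintB// (cint_split am mb Hc1) (cint_split am mb Hd1).
by rewrite (cint_split cn nd Va1) (cint_split cn nd Vb1); ring.
Qed.

(** An affine function has boundary integral 0, so [F] may be replaced by its first-order remainder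
    [G]. Each integrand is a difference of two values of [G], hence at most [2 * e * s], and the two
    lengths add up to [s]. *)
Lemma rect_int_small F (z0 A : R[i]) a b c d (e s : R) :
  a <= b -> c <= d -> cont_rect F a b c d ->
  (b - a) + (d - c) = s ->
  (forall x y, a <= x <= b -> c <= y <= d ->
    nr (F (Complex x y) - F z0 - A * (Complex x y - z0)) <= e * s) ->
  nr (rect_int F a b c d) <= 2 * e * s ^+ 2.
Proof.
move=> ab cd hF sE hE.
have cc : c <= c <= d by rewrite lexx.
have dd : c <= d <= d by rewrite lexx andbT.
have aa : a <= a <= b by rewrite lexx.
have bb : a <= b <= b by rewrite lexx andbT.
pose G z := F z - F z0 - A * (z - z0).
have h1 : ccs a b (fun x => F (Complex x c) - F (Complex x d)).
  by apply: ccsB; apply: (ccs_horizontal hF).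
have h2 : ccs c d (fun y => F (Complex b y) - F (Complex a y)).
  by apply: ccsB; apply: (ccs_vertical hF).
(* The constant contributions of the affine part to the two integrands; [k1 * (b - a)%:C] and
   ['i * k2 * (d - c)%:C] cancel. *)
pose k1 := A * 'i * (c - d)%:C; pose k2 := A * (b - a)%:C.
have -> : rect_int F a b c d =
    cint a b (fun x => G (Complex x c) - G (Complex x d)) +
    'i * cint c d (fun y => G (Complex b y) - G (Complex a y)).
  have -> : cint a b (fun x => G (Complex x c) - G (Complex x d)) =
      cint a b (fun x => F (Complex x c) - F (Complex x d)) - k1 * (b - a)%:C.
    rewrite -cint_cst// -cintB//; last exact: ccs_cst.
    apply: eq_cint => x _; rewrite /G /k1.
    have -> : A * 'i * (c - d)%:C = A * (Complex x c - Complex x d).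
      by rewrite -mulrA; congr (A * _); apply: eqC => /=; ring.
    ring.
  have -> : cint c d (fun y => G (Complex b y) - G (Complex a y)) =
      cint c d (fun y => F (Complex b y) - F (Complex a y)) - k2 * (d - c)%:C.
    rewrite -cint_cst// -cintB//; last exact: ccs_cst.
    apply: eq_cint => y _; rewrite /G /k2.
    have -> : (b - a)%:C = Complex b y - Complex a y :> R[i].
      by apply: eqC => /=; ring.
    ring.
  rewrite /rect_int /k1 /k2 !rmorphB/=; ring.
have G1 y : c <= y <= d -> ccs a b (fun x => G (Complex x y)).
  move=> hy; apply: ccsB; last apply: ccsZ; apply: ccsB;
    by [exact: (ccs_horizontal hF)|exact: ccs_cst|
        apply: (@ccs_horizontal id a b c d) => // x' y' _ _;
        exact: cder_cont (cder_id _)].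
have G2 x : a <= x <= b -> ccs c d (fun y => G (Complex x y)).
  move=> hx; apply: ccsB; last apply: ccsZ; apply: ccsB;
    by [exact: (ccs_vertical hF)|exact: ccs_cst|
        apply: (@ccs_vertical id a b c d) => // x' y' _ _;
        exact: cder_cont (cder_id _)].
apply: le_trans (nrD _ _) _; rewrite nrM.
have -> : nr ('i : R[i]) = 1 by rewrite nr_eq/= expr0n expr1n add0r sqrtr1.
rewrite mul1r.
have B1 : nr (cint a b (fun x => G (Complex x c) - G (Complex x d))) <=
    (2 * e * s) * (b - a).
  apply: cint_le => //; first by apply: ccsB; exact: G1.
  move=> x hx; apply: le_trans (nrB _ _) _.
  have := hE x c hx cc; have := hE x d hx dd; rewrite -!/(G _); lra.
have B2 : nr (cint c d (fun y => G (Complex b y) - G (Complex a y))) <=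
    (2 * e * s) * (d - c).
  apply: cint_le => //; first by apply: ccsB; exact: G2.
  move=> y hy; apply: le_trans (nrB _ _) _.
  have := hE a y aa hy; have := hE b y bb hy; rewrite -!/(G _); lra.
apply: le_trans (lerD B1 B2) _; rewrite -mulrDr sE; lra.
Qed.

(** The bound [2 * e * s ^+ 2], with [s] half the perimeter, passes from the quarters to the whole:
    quartering halves [s], so each quarter carries a fourth of the bound. Near a point it follows
    from differentiability there. *)
Theorem goursat F a b c d : a <= b -> c <= d ->
  (forall x y, a <= x <= b -> c <= y <= d -> exists A, cder F (Complex x y) A) ->
  rect_int F a b c d = 0.
Proof.
move=> ab cd hF.
have cF : cont_rect F a b c d.
  by move=> x y hx hy; have [A hA] := hF x y hx hy; exact: cder_cont hA.
apply: small_nr => e0 e00.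
have S0 : 0 < 2 * ((b - a) + (d - c)) ^+ 2 + 1.
  by rewrite ltr_wpDl// mulr_ge0// sqr_ge0.
pose e := e0 / (2 * ((b - a) + (d - c)) ^+ 2 + 1).
have e1 : 0 < e by rewrite divr_gt0.
pose P a' b' c' d' := a <= a' -> b' <= b -> c <= c' -> d' <= d ->
  nr (rect_int F a' b' c' d') <= 2 * e * ((b' - a') + (d' - c')) ^+ 2.
suff : P a b c d.
  move=> /(_ (lexx _) (lexx _) (lexx _) (lexx _))/le_trans; apply.
  rewrite /e; set S := 2 * _ ^+ 2 in S0 *.
  have -> : 2 * (e0 / (S + 1)) * ((b - a) + (d - c)) ^+ 2 = e0 * (S / (S + 1)).
    by rewrite /S; field; rewrite gt_eqF.
  by rewrite ler_piMr ?(ltW e00)// ler_pdivrMr// mul1r lerDl.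
apply: bisection => //.
  move=> a' b' c' d' ab' cd' p1 p2 p3 p4 la lb lc ld.
  have m1 : a' <= (a' + b') / 2 <= b' by apply/andP; split; lra.
  have m2 : c' <= (c' + d') / 2 <= d' by apply/andP; split; lra.
  have cF' : cont_rect F a' b' c' d'.
    move=> x y /andP[x1 x2] /andP[y1 y2]; apply: cF; apply/andP; split; lra.
  rewrite (rect_int_split cF' m1 m2).
  have lm : a <= (a' + b') / 2 by lra.
  have mb : (a' + b') / 2 <= b by lra.
  have ln : c <= (c' + d') / 2 by lra.
  have nd : (c' + d') / 2 <= d by lra.
  have := p1 la mb lc nd; have := p2 la mb ln ld.
  have := p3 lm lb lc nd; have := p4 lm lb ln ld.
  have -> : (a' + b') / 2 - a' = (b' - a') / 2 by field.
  have -> : b' - (a' + b') / 2 = (b' - a') / 2 by field.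
  have -> : (c' + d') / 2 - c' = (d' - c') / 2 by field.
  have -> : d' - (c' + d') / 2 = (d' - c') / 2 by field.
  have -> : 2 * e * (b' - a' + (d' - c')) ^+ 2 =
    4 * (2 * e * ((b' - a') / 2 + (d' - c') / 2) ^+ 2) by field.
  set X := 2 * e * _ ^+ 2 => q4 q3 q2 q1.
  apply: le_trans (nrD _ _) _.
  apply: le_trans (lerD (nrD _ _) (nrD _ _)) _.
  have -> : 4 * X = X + X + (X + X) by ring.
  by apply: lerD; exact: lerD.
move=> x y hx hy; have [A hA] := hF x y hx hy.
have [r r0 hr] := hA _ e1; exists r => // a' b' c' d' la lb lc ld hx' hy' sz.
move=> _ _ _ _.
have ab' : a' <= b' by case/andP: hx'; exact: le_trans.
have cd' : c' <= d' by case/andP: hy'; exact: le_trans.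
apply: (rect_int_small (z0 := Complex x y) (A := A)) => //.
  move=> x' y' /andP[x1 x2] /andP[y1 y2].
  by apply: cF; apply/andP; split; lra.
move=> x' y' hx1 hy1.
have ds : nr (Complex x' y' - Complex x y) <= (b' - a') + (d' - c').
  apply: le_trans (nr_le _) _; simpc => /=.
  case/andP: hx1 => ? ?; case/andP: hy1 => ? ?.
  case/andP: hx' => ? ?; case/andP: hy' => ? ?.
  by apply: lerD; rewrite ler_norml; apply/andP; split; lra.
have := hr (Complex x' y' - Complex x y) (le_lt_trans ds sz).
have -> : Complex x y + (Complex x' y' - Complex x y) = Complex x' y' by ring.
move=> /le_trans; apply.
by rewrite ler_wpM2l// ltW.
Qed.

End Goursat.

(** Parametrised over [[0, 1]], so that [mean] is an average without a factor 1 / (2 pi). *)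
Definition circ {R : realType} (t : R) : R[i] := expc (Complex 0 (2 * pi * t)).

Definition mean {R : realType} (psi : R[i] -> R[i]) (r : R) : R[i] :=
  cint 0 1 (fun t => psi (r%:C * circ t)).

(* With [l = -1] this is holomorphy on the disc of radius [u]; with [l = 0], on
   the punctured disc. *)
Definition hol_on {R : realType} (psi : R[i] -> R[i]) (l u : R) : Prop :=
  forall z, l < nr z < u -> exists A, cder psi z A.

Section Means.
Variable R : realType.
Implicit Types (psi : R[i] -> R[i]) (r l u : R) (z : R[i]).

Lemma nr_circ (t : R) : nr (circ t) = 1.
Proof. by rewrite nr_expc/= expR0. Qed.

(** In the coordinate w |-> exp (2 pi w), circles about 0 become vertical segments of height 1 and
    annuli become rectangles. *)
Lemma circ_polar r y : 0 < r ->
  expc ((2 * pi)%:C * Complex (ln r / (2 * pi)) y) = r%:C * circ y.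
Proof.
move=> r0; have p0 : 0 < 2 * pi :> R by rewrite mulr_gt0// pi_gt0.
have -> : (2 * pi)%:C * Complex (ln r / (2 * pi)) y =
    Complex (ln r) (2 * pi * y).
  by apply: eqC => /=; rewrite !mul0r ?subr0 ?addr0// mulrC divfK// gt_eqF.
rewrite /circ /expc /= expR0 lnK// !mul1r; by simpc.
Qed.

Lemma cder_polar psi (w A : R[i]) : cder psi (expc ((2 * pi)%:C * w)) A ->
  exists B, cder (fun w => psi (expc ((2 * pi)%:C * w))) w B.
Proof.
move=> h; have h1 := cderZ (2 * pi)%:C (cder_id w).
have h2 := @cder_comp _ (fun w => (2 * pi)%:C * w) expc _ _ _ h1 (cder_expc _).
by eexists; exact: (@cder_comp _ (fun w => expc ((2 * pi)%:C * w)) psi _ _ _ h2 h).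
Qed.

Lemma ccont_comp (f g : R[i] -> R[i]) z : ccont f z -> ccont g (f z) ->
  ccont (fun w => g (f w)) z.
Proof.
move=> hf hg e /hg[d d0 hd]; have [d' d'0 hd'] := hf d d0.
exists d' => // h /hd' /hd.
by have -> : f z + (f (z + h) - f z) = f (z + h) by ring.
Qed.

Lemma ccs_circ psi r : 0 < r -> (forall z, nr z = r -> ccont psi z) ->
  ccs 0 1 (fun t => psi (r%:C * circ t)).
Proof.
move=> r0 h; pose x := ln r / (2 * pi).
pose F w := psi (expc ((2 * pi)%:C * w)).
have hF : cont_rect F x x 0 1.
  move=> x' y; rewrite -eq_le => /eqP <- _.
  apply: (@ccont_comp (fun w => expc ((2 * pi)%:C * w))).
    have h1 := cderZ (2 * pi)%:C (cder_id (Complex x y)).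
    apply: cder_cont.
    exact: (@cder_comp _ (fun w => (2 * pi)%:C * w) expc _ _ _ h1 (cder_expc _)).
  by apply: h; rewrite circ_polar// nrM nrR gtr0_norm// nr_circ mulr1.
have : ccs 0 1 (fun y => F (Complex x y)).
  by apply: (ccs_vertical hF); rewrite lexx.
congr ccs; apply: funext => t; by rewrite /F circ_polar.
Qed.

Lemma hol_ccont psi l u z : hol_on psi l u -> l < nr z < u -> ccont psi z.
Proof. by move=> h /h[A]; exact: cder_cont. Qed.

Lemma hol_ccs psi l u r : hol_on psi l u -> l < r < u -> 0 < r ->
  ccs 0 1 (fun t => psi (r%:C * circ t)).
Proof.
by move=> h lru r0; apply: ccs_circ => // z zr; apply: (hol_ccont h); rewrite zr.
Qed.

Lemma hol_sub psi l u l' u' : hol_on psi l u -> l <= l' -> u' <= u ->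
  hol_on psi l' u'.
Proof.
move=> h ll uu z /andP[z1 z2]; apply: h.
by rewrite (le_lt_trans ll)// (lt_le_trans z2).
Qed.

Lemma hol_cst (c : R[i]) l u : hol_on (fun=> c) l u.
Proof. by move=> z _; exists 0; exact: cder_cst. Qed.

Lemma hol_id l u : hol_on (@id R[i]) l u.
Proof. by move=> z _; exists 1; exact: cder_id. Qed.

Lemma holD psi phi l u : hol_on psi l u -> hol_on phi l u ->
  hol_on (fun z => psi z + phi z) l u.
Proof.
move=> h1 h2 z hz; have [A hA] := h1 z hz; have [B hB] := h2 z hz.
by exists (A + B); exact: cderD.
Qed.

Lemma holM psi phi l u : hol_on psi l u -> hol_on phi l u ->
  hol_on (fun z => psi z * phi z) l u.
Proof.
move=> h1 h2 z hz; have [A hA] := h1 z hz; have [B hB] := h2 z hz.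
by eexists; exact: cderM hA hB.
Qed.

Lemma holZ psi (c : R[i]) l u : hol_on psi l u ->
  hol_on (fun z => c * psi z) l u.
Proof. by move=> h; apply: holM => //; exact: hol_cst. Qed.

Lemma holB psi phi l u : hol_on psi l u -> hol_on phi l u ->
  hol_on (fun z => psi z - phi z) l u.
Proof.
move=> h1 h2 z hz; have [A hA] := h1 z hz; have [B hB] := h2 z hz.
by exists (A - B); exact: cderB.
Qed.

Lemma hol_pow n l u : hol_on (fun z : R[i] => z ^+ n) l u.
Proof.
elim: n => [|n ih]; first exact: hol_cst.
have -> : (fun z : R[i] => z ^+ n.+1) = (fun z => z * z ^+ n).
  by apply: funext => z; rewrite exprS.
by apply: holM => //; exact: hol_id.
Qed.

Lemma hol_inv psi l u : hol_on psi l u ->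
  (forall z, l < nr z < u -> psi z != 0) -> hol_on (fun z => (psi z)^-1) l u.
Proof.
move=> h h0 z hz; have [A hA] := h z hz.
by eexists; exact: cderV (h0 z hz) hA.
Qed.

Lemma hol_powV n u : hol_on (fun z : R[i] => z ^- n) 0 u.
Proof.
apply: hol_inv; first exact: hol_pow.
move=> z /andP[z0 _]; rewrite expf_neq0//.
by apply: contraTneq z0 => ->; rewrite nr0 ltxx.
Qed.

Lemma eq_mean psi phi r : 0 < r -> (forall z, nr z = r -> psi z = phi z) ->
  mean psi r = mean phi r.
Proof.
move=> r0 h; apply: eq_cint => t _; apply: h.
by rewrite nrM nrR gtr0_norm// nr_circ mulr1.
Qed.

Lemma mean_le psi r (M : R) : 0 < r -> (forall z, nr z = r -> ccont psi z) ->
  (forall z, nr z = r -> nr (psi z) <= M) -> nr (mean psi r) <= M.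
Proof.
move=> r0 h hM; have := @cint_le R 0 1 _ M ler01 (ccs_circ r0 h).
rewrite subr0 mulr1; apply => t _; apply: hM.
by rewrite nrM nrR gtr0_norm// nr_circ mulr1.
Qed.

Lemma mean_cst (c : R[i]) r : mean (fun=> c) r = c.
Proof. by rewrite /mean cint_cst// subr0 mulr1. Qed.

Lemma meanD psi phi l u r : hol_on psi l u -> hol_on phi l u -> l < r < u ->
  0 < r -> mean (fun z => psi z + phi z) r = mean psi r + mean phi r.
Proof.
move=> h1 h2 hr r0; rewrite /mean cintD//.
  exact: hol_ccs h1 _ _.
exact: hol_ccs h2 _ _.
Qed.

Lemma meanZ psi (c : R[i]) l u r : hol_on psi l u -> l < r < u ->
  0 < r -> mean (fun z => c * psi z) r = c * mean psi r.
Proof. by move=> h1 hr r0; rewrite /mean cintZ//; exact: hol_ccs h1 _ _. Qed.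

(** Goursat's theorem on the rectangle that covers the annulus: its vertical sides give the two
    means, and its horizontal sides cancel. *)
Theorem mean_const psi u r1 r2 : hol_on psi 0 u -> 0 < r1 -> r1 <= r2 ->
  r2 < u -> mean psi r1 = mean psi r2.
Proof.
move=> h r10 r12 r2u; have r20 := lt_le_trans r10 r12.
have p0 : 0 < 2 * pi :> R by rewrite mulr_gt0// pi_gt0.
pose F w := psi (expc ((2 * pi)%:C * w)).
pose x1 := ln r1 / (2 * pi); pose x2 := ln r2 / (2 * pi).
have x12 : x1 <= x2 by rewrite /x1 ler_pM2r ?invr_gt0// ler_ln.
have hF x y : x1 <= x <= x2 -> 0 <= y <= 1 -> exists A, cder F (Complex x y) A.
  rewrite /x1 /x2 ler_pdivrMr// ler_pdivlMr// (mulrC x) => /andP[xa xb] _.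
  have [|A hA] := h (expc ((2 * pi)%:C * Complex x y)).
    rewrite nr_expc /= mul0r subr0 expR_gt0 /=; apply: le_lt_trans r2u.
    by rewrite -[leRHS]lnK ?posrE// ler_expR.
  exact: cder_polar hA.
have := goursat x12 ler01 hF; rewrite /rect_int.
(* exp (2 pi w) has period i, so [F] agrees on the bottom and top sides. *)
have -> : cint x1 x2 (fun x => F (Complex x 0) - F (Complex x 1)) = 0.
  rewrite (@eq_cint _ _ _ _ (fun=> 0)) ?cint_cst ?mul0r// => x _.
  have -> : F (Complex x 1) = F (Complex x 0); last by rewrite subrr.
  congr psi; rewrite /expc /= !mulr1 !mulr0 !mul0r !subr0 !addr0.
  by rewrite (mulr_natl pi 2) cos2pi sin2pi cos0 sin0.
rewrite add0r => /eqP; rewrite mulf_eq0 => /orP[|/eqP].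
  by rewrite eq_complex/= oner_eq0 andbF.
rewrite cintB.
- move=> /eqP; rewrite subr_eq0 => /eqP hm.
  have E r : 0 < r -> mean psi r =
      cint 0 1 (fun y => F (Complex (ln r / (2 * pi)) y)).
    by move=> r0; apply: eq_cint => t _; rewrite /F circ_polar.
  by rewrite (E _ r10) (E _ r20) hm.
- have := hol_ccs h _ r20; rewrite r20 r2u => /(_ isT); congr ccs.
  by apply: funext => t; rewrite /F circ_polar.
- have r1u := le_lt_trans r12 r2u.
  have := hol_ccs h _ r10; rewrite r10 r1u => /(_ isT); congr ccs.
  by apply: funext => t; rewrite /F circ_polar.
Qed.

(** This replaces the removal of singularities: the mean does not depend on the radius, so it equals
    the limit of [psi] at 0, whatever value [psi] takes there. *)
Lemma mean_lim psi u r (k : R[i]) : hol_on psi 0 u -> 0 < r < u ->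
  (forall e : R, 0 < e -> exists2 d : R, 0 < d &
    forall z, 0 < nr z < d -> nr (psi z - k) <= e) ->
  mean psi r = k.
Proof.
move=> h /andP[r0 ru] hk; apply/eqP; rewrite -subr_eq0; apply/eqP.
apply: small_nr => e e0; have [d d0 hd] := hk e e0.
pose s := Num.min r (d / 2).
have s0 : 0 < s by rewrite lt_min r0 divr_gt0.
have sr : s <= r by rewrite ge_min lexx.
have sd : s < d.
  apply: le_lt_trans (_ : d / 2 < d); last by lra.
  by rewrite ge_min lexx orbT.
rewrite -(mean_const h s0 sr ru).
have -> : mean psi s - k = mean (fun z => psi z - k) s.
  rewrite -{1}(mean_cst k s) /mean cintB//; last exact: ccs_cst.
  by apply: (hol_ccs h) => //; rewrite s0 (le_lt_trans sr).
apply: mean_le => //.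
  move=> z zs; apply: (@hol_ccont _ 0 u).
    by apply: holB => //; exact: hol_cst.
  by rewrite zs s0 (le_lt_trans sr).
by move=> z zs; apply: hd; rewrite zs s0.
Qed.

(* Rescaling the circle multiplies the mean of a negative power by a factor
   different from 1, but the mean does not depend on the radius. *)
Lemma mean_powV n r : 0 < r -> mean (fun z => z ^- n.+1) r = 0.
Proof.
move=> r0; set psi := fun z : R[i] => z ^- n.+1.
have E : mean psi (2 * r) = (2 ^- n.+1) * mean psi r.
  have hr : 0 < r < r + 1 by rewrite r0 /= ltrDl.
  rewrite -(meanZ _ (@hol_powV n.+1 _) hr r0).
  apply: eq_cint => t _; rewrite /psi rmorphM/= -mulrA exprMn invfM.
  by rewrite rmorph_nat.
have H : mean psi r = mean psi (2 * r).
  apply: (@mean_const _ (2 * r + 1)) => //; [exact: hol_powV|lra|].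
  by rewrite ltrDl.
move: E; rewrite -H => /eqP; rewrite -subr_eq0 -{1}[mean psi r]mul1r -mulrBl.
rewrite mulf_eq0 => /orP[|/eqP//]; rewrite subr_eq0 => /eqP h.
have := congr1 (@nr R _) h; rewrite nr1 nrV nrX (nr_nat _ 2).
move=> /esym/eqP; rewrite invr_eq1 => /eqP h2.
exfalso; have : 1 < (2 : R) ^+ n.+1 by rewrite -natrX ltr1n (ltn_exp2l 0).
by rewrite h2 ltxx.
Qed.

End Means.

(** * Caratheodory's coefficient inequality *)

Section Caratheodory.
Variable R : realType.

(** [q] will be a quotient by [z], meaningful off 0 only, so its behaviour at 0 enters through a
    second-order expansion rather than through holomorphy. *)
Lemma moment_first (q : R[i] -> R[i]) (q1 q2 : R[i]) (r : R) :
  hol_on q 0 1 -> 0 < r < 1 ->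
  (forall e : R, 0 < e -> exists2 d : R, 0 < d & forall z : R[i], 0 < nr z < d ->
    nr (q z - 1 - q1 * z - q2 * z ^+ 2) <= e * nr z ^+ 2) ->
  [/\ mean q r = 1, mean (fun z => q z * z) r = 0 &
      mean (fun z => q z * z ^+ 2) r = 0].
Proof.
move=> hq hr hE.
have hbnd : forall e : R, 0 < e -> exists2 d : R, 0 < d & forall z : R[i],
    0 < nr z < d -> nr (q z - 1) <= e.
  move=> e e0; have [d d0 hd] := hE 1 ltr01.
  have K0 : 0 < nr q1 + nr q2 + 1 by rewrite ltr_wpDl// addr_ge0 ?nr_ge0.
  exists (Num.min d (Num.min 1 (e / (nr q1 + nr q2 + 1)))).
    by rewrite !lt_min d0 ltr01 divr_gt0.
  move=> z /andP[z0]; rewrite !lt_min ltr_pdivlMr// => /and3P[zd z1 ze].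
  have := hd z; rewrite z0 zd mul1r => /(_ isT) h.
  have -> : q z - 1 = (q z - 1 - q1 * z - q2 * z ^+ 2) + q1 * z + q2 * z ^+ 2.
    by ring.
  apply: le_trans (nrD _ _) _; apply: le_trans (lerD (nrD _ _) (lexx _)) _.
  rewrite (nrM q1) (nrM q2) nrX.
  have z2 : nr z ^+ 2 <= nr z by rewrite expr2 ler_piMr ?nr_ge0// ltW.
  have := ler_wpM2l (nr_ge0 q2) z2; lra.
have hpow n : mean (fun z => q z * z ^+ n.+1) r = 0.
  apply: (@mean_lim _ _ 1) => //; first by apply: holM => //; exact: hol_pow.
  move=> e e0; have e2 : 0 < e / 2 by rewrite divr_gt0.
  have [d d0 hd] := hbnd 1 ltr01.
  exists (Num.min d (Num.min 1 (e / 2))); first by rewrite !lt_min d0 ltr01.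
  move=> z /andP[z0]; rewrite !lt_min => /and3P[zd z1 ze].
  have := hd z; rewrite z0 zd => /(_ isT) h.
  have qz : nr (q z) <= 2.
    rewrite -(subrK 1 (q z)); apply: le_trans (nrD _ _) _; rewrite nr1; lra.
  rewrite subr0 nrM nrX exprS.
  have zn : nr z * nr z ^+ n <= nr z.
    by rewrite ler_piMr ?nr_ge0// exprn_ile1 ?nr_ge0// ltW.
  have := ler_pM (nr_ge0 _) _ qz zn; rewrite -exprS exprn_ge0 ?nr_ge0//.
  move=> /(_ isT); lra.
split; last exact: hpow.
  exact: mean_lim hq hr hbnd.
exact: (hpow 0%N).
Qed.

(** Negative powers of [z] have mean 0, so the lower Taylor terms of [q] may be subtracted; what
    remains has a limit at 0. *)
Lemma moment_second (q : R[i] -> R[i]) (q1 q2 : R[i]) (r : R) :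
  hol_on q 0 1 -> 0 < r < 1 ->
  (forall e : R, 0 < e -> exists2 d : R, 0 < d & forall z : R[i], 0 < nr z < d ->
    nr (q z - 1 - q1 * z - q2 * z ^+ 2) <= e * nr z ^+ 2) ->
  mean (fun z => q z * z^-1) r = q1 /\ mean (fun z => q z * z ^- 2) r = q2.
Proof.
move=> hq hr hE; have r0 : 0 < r by case/andP: hr.
have hz z : nr z = r -> z != 0.
  by move=> zr; apply/eqP => z0; move: r0; rewrite -zr z0 nr0 ltxx.
have V1 : hol_on (fun z : R[i] => z^-1) 0 1 by exact: (hol_powV 1).
have V2 := @hol_powV R 2 1.
have m1 : mean (fun z : R[i] => z^-1) r = 0 by exact: (mean_powV 0 r0).
have m2 : mean (fun z : R[i] => z ^- 2) r = 0 by exact: (mean_powV 1 r0).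
have Q1 : hol_on (fun z => (q z - 1) * z^-1) 0 1.
  by apply: holM => //; apply: holB => //; exact: hol_cst.
have Q2 : hol_on (fun z => (q z - 1 - q1 * z) * z ^- 2) 0 1.
  apply: holM => //; apply: holB; first by apply: holB => //; exact: hol_cst.
  by apply: holZ; exact: hol_id.
split.
  have -> : mean (fun z => q z * z^-1) r =
      mean (fun z => (q z - 1) * z^-1 + z^-1) r.
    by apply: eq_mean => // z _; ring.
  rewrite (meanD Q1 V1)// m1 addr0.
  apply: (mean_lim Q1 hr) => e e0; have [d d0 hd] := hE 1 ltr01.
  have K0 : 0 < nr q2 + 1 by rewrite ltr_wpDl// nr_ge0.
  exists (Num.min d (e / (nr q2 + 1))); first by rewrite lt_min d0 divr_gt0.
  move=> z /andP[z0]; rewrite lt_min ltr_pdivlMr// => /andP[zd ze].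
  have := hd z; rewrite z0 zd => /(_ isT) h.
  have zN0 : z != 0 by apply: contraTneq z0 => ->; rewrite nr0 ltxx.
  have -> : (q z - 1) * z^-1 - q1 =
    ((q z - 1 - q1 * z - q2 * z ^+ 2) + q2 * z ^+ 2) * z^-1 by field.
  rewrite nrM nrV ler_pdivrMr//; apply: le_trans (nrD _ _) _.
  rewrite nrM nrX; rewrite mul1r in h.
  apply: le_trans (lerD h (lexx _)) _; nra.
have -> : mean (fun z => q z * z ^- 2) r =
    mean (fun z => (q z - 1 - q1 * z) * z ^- 2 + (z ^- 2 + q1 * z^-1)) r.
  by apply: eq_mean => // z /hz z0; field.
have W : hol_on (fun z => z ^- 2 + q1 * z^-1) 0 1.
  by apply: holD => //; exact: holZ.
rewrite (meanD Q2 W)// (meanD V2 (holZ q1 V1))// (meanZ q1 V1)// m1 m2.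
rewrite mulr0 !addr0.
apply: (mean_lim Q2 hr) => e e0; have [d d0 hd] := hE e e0.
exists d => // z /[dup] /andP[z0 zd] /hd h.
have zN0 : z != 0 by apply: contraTneq z0 => ->; rewrite nr0 ltxx.
have -> : (q z - 1 - q1 * z) * z ^- 2 - q2 =
    (q z - 1 - q1 * z - q2 * z ^+ 2) * z ^- 2 by field.
by rewrite nrM nrV nrX ler_pdivrMr// exprn_gt0.
Qed.

(** The limit r -> 1: circle means are available for [r < 1] only, while the coefficient inequality
    corresponds to [r = 1]. *)
Lemma quadratic_limit (A B C : R) :
  (forall r : R, 0 < r < 1 -> 0 <= A + B * r + C * r ^+ 2) -> 0 <= A + B + C.
Proof.
move=> h; rewrite -(opprK (A + B + C)) oppr_ge0.
apply: (@dominates_le _ _ 0 (`|B| + 2 * `|C|)).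
  by rewrite addr_ge0 ?mulr_ge0.
move=> e e0; rewrite add0r.
pose t := Num.min (1 / 2) e.
have t0 : 0 < t by rewrite lt_min e0 andbT; lra.
have t1 : t <= 1 / 2 by rewrite ge_min lexx.
have te : t <= e by rewrite ge_min lexx orbT.
have /h : 0 < 1 - t < 1 by apply/andP; split; lra.
have p1 : `|B| * t <= `|B| * e by rewrite ler_wpM2l.
have p2 : `|C| * t <= `|C| * e by rewrite ler_wpM2l.
have := ler_norm (- B); have := ler_norm (- C); rewrite !normrN => c b.
have p3 := ler_wpM2r (ltW t0) b.
have t2 : 0 <= t * (2 - t) by apply: mulr_ge0; lra.
have p4 := ler_wpM2r t2 c.
have p5 : `|C| * (t * (2 - t)) <= `|C| * (2 * t).
  by rewrite ler_wpM2l//; nra.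
nra.
Qed.

(** Average [q] against the nonnegative weight |W|^2, where W = 1 + x w + l w^2 and w = z / r. On
    the circle conj z = r^2 / z, so |W|^2 is a Laurent polynomial in [z], and its means against [q]
    are the moments found above. *)
Lemma herglotz_form (q : R[i] -> R[i]) (q1 q2 : R[i]) (x l : R[i]) :
  hol_on q 0 1 -> nr l = 1 ->
  (forall z : R[i], 0 < nr z < 1 -> 0 <= complex.Re (q z)) ->
  (forall e : R, 0 < e -> exists2 d : R, 0 < d & forall z : R[i], 0 < nr z < d ->
    nr (q z - 1 - q1 * z - q2 * z ^+ 2) <= e * nr z ^+ 2) ->
  0 <= complex.Re (2 + x * cj x + (cj x + cj l * x) * q1 + cj l * q2).
Proof.
move=> hq l1 hre hE.
have ll : l * cj l = 1 by rewrite mulJ l1 expr1n.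
have -> : complex.Re (2 + x * cj x + (cj x + cj l * x) * q1 + cj l * q2) =
    complex.Re (2 + x * cj x) + complex.Re ((cj x + cj l * x) * q1) +
    complex.Re (cj l * q2) by rewrite !ReD.
apply: quadratic_limit => r hr; have r0 : 0 < r by case/andP: hr.
have [M0 M1 M2] := moment_first hq hr hE.
have [N1 N2] := moment_second hq hr hE.
pose W z := 1 + x * (z * (r%:C)^-1) + l * (z * (r%:C)^-1) ^+ 2.
have rC0 : r%:C != 0 :> R[i] by rewrite eq_complex/= gt_eqF.
have ccJ (z : R[i]) : nr z = r ->
    W z * cj (W z) = (2 + x * cj x) + (x + l * cj x) * (r%:C)^-1 * z
      + l * (r%:C)^-2 * z ^+ 2 + (cj x + cj l * x) * r%:C * z^-1
      + cj l * r%:C ^+ 2 * z ^- 2.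
  move=> zr; have z0 : z != 0.
    by apply/eqP => z0; move: r0; rewrite -zr z0 nr0 ltxx.
  have eJ : cj (z * (r%:C)^-1) = r%:C * z^-1.
    rewrite cjM cjV cjR.
    have : z * cj z = r%:C ^+ 2 by rewrite mulJ zr rmorphXn.
    move=> zz; have -> : cj z = r%:C ^+ 2 * z^-1.
      by rewrite -zz mulrAC mulfV// mul1r.
    by field; rewrite z0.
  have WJ : cj (W z) = 1 + cj x * (r%:C * z^-1) + cj l * (r%:C * z^-1) ^+ 2.
    rewrite /W; move: (z / r%:C) eJ => w eJ.
    by rewrite !expr2 !(cjD, cjM) eJ cj1.
  rewrite WJ /W.
  transitivity (1 + l * cj l + x * cj x + (x + l * cj x) * (r%:C)^-1 * z
      + l * (r%:C)^-2 * z ^+ 2 + (cj x + cj l * x) * r%:C * z^-1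
      + cj l * r%:C ^+ 2 * z ^- 2); last by rewrite ll.
  by field; rewrite z0 rC0.
have V1 : hol_on (fun z : R[i] => z^-1) 0 1 by exact: (hol_powV 1).
have V2 := @hol_powV R 2 1.
have P1 : hol_on (fun z => q z * z) 0 1 by apply: holM => //; exact: hol_id.
have P2 : hol_on (fun z => q z * z ^+ 2) 0 1 by apply: holM => //; exact: hol_pow.
have S1 : hol_on (fun z => q z * z^-1) 0 1 by exact: holM.
have S2 : hol_on (fun z => q z * z ^- 2) 0 1 by exact: holM.
have E : mean (fun z => q z * (W z * cj (W z))) r =
   (2 + x * cj x) + (cj x + cj l * x) * q1 * r%:C + cj l * q2 * r%:C ^+ 2.
  transitivity (mean (fun z => (2 + x * cj x) * q z
      + ((x + l * cj x) * (r%:C)^-1 * (q z * z)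
      + (l * (r%:C)^-2 * (q z * z ^+ 2)
      + ((cj x + cj l * x) * r%:C * (q z * z^-1)
      + cj l * r%:C ^+ 2 * (q z * z ^- 2))))) r).
    by apply: eq_mean => // z zr; rewrite (ccJ z zr); ring.
  have T4 := holZ (cj l * r%:C ^+ 2) S2.
  have T3 := holZ ((cj x + cj l * x) * r%:C) S1.
  have T2 := holZ (l * (r%:C)^-2) P2.
  have T1 := holZ ((x + l * cj x) * (r%:C)^-1) P1.
  have T0 := holZ (2 + x * cj x) hq.
  have T34 := holD T3 T4; have T234 := holD T2 T34; have T14 := holD T1 T234.
  rewrite (meanD T0 T14)// (meanD T1 T234)// (meanD T2 T34)// (meanD T3 T4)//.
  rewrite (meanZ _ hq)// (meanZ _ P1)// (meanZ _ P2)// (meanZ _ S1)//.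
  by rewrite (meanZ _ S2)// M0 M1 M2 N1 N2; ring.
have pos : 0 <= complex.Re (mean (fun z => q z * (W z * cj (W z))) r).
  apply: cint_Re_ge0 => t _; set z := r%:C * circ t.
  rewrite mulJ mulrC ReM /= mul0r subr0 mulr_ge0 ?sqr_ge0//.
  by apply: hre; rewrite nrM nrR nr_circ mulr1 gtr0_norm.
move: pos; rewrite E !ReD -rmorphXn/= !(mulrC _ (_ %:C)) !(ReM (_ %:C))/=.
by rewrite !mul0r !subr0 !(mulrC (r ^+ 2)) !(mulrC r).
Qed.

Theorem caratheodory (q : R[i] -> R[i]) (q1 q2 : R[i]) : hol_on q 0 1 ->
  (forall z : R[i], 0 < nr z < 1 -> 0 <= complex.Re (q z)) ->
  (forall e : R, 0 < e -> exists2 d : R, 0 < d & forall z : R[i], 0 < nr z < d ->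
    nr (q z - 1 - q1 * z - q2 * z ^+ 2) <= e * nr z ^+ 2) ->
  nr (q2 - q1 ^+ 2 / 2) <= 2 - nr q1 ^+ 2 / 2.
Proof.
move=> hq hre hE; have [c c1 cE] := rotate_norm (q1 ^+ 2 / 2 - q2).
have cJ : nr (cj c) = 1 by rewrite nrJ.
(* With [l = cj c], the part of the form depending on [x] is |x|^2 + Re (conj x * s), minimal at x =
   - s / 2. *)
pose s := q1 + cj c * cj q1.
have cc : c * cj c = 1 by rewrite mulJ c1 expr1n.
have sJ : cj s = cj q1 + c * q1 by rewrite /s cjD cjM !cjK.
have h2 : cj (- (2 : R[i])^-1) = - 2^-1.
  by rewrite cjN cjV cj_nat.
have := herglotz_form (- 2^-1 * s) hq cJ hre hE.
rewrite cjK cjM h2.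
(* The terms that do not combine into moduli form [cj w - w], which is purely imaginary. *)
pose w := c * q1 ^+ 2 / 4.
have wJ : cj w = cj c * (cj q1) ^+ 2 / 4.
  by rewrite /w !cjM cjV cj_nat.
have -> : 2 + - 2^-1 * s * (- 2^-1 * cj s) +
   (- 2^-1 * cj s + c * (- 2^-1 * s)) * q1 + c * q2 =
   2 - q1 * cj q1 / 2 - c * (q1 ^+ 2 / 2 - q2) + (cj w - w).
  have e1 : c * s = c * q1 + cj q1 by rewrite /s mulrDr mulrA cc mul1r.
  have e2 : s * cj s = 2 * q1 * cj q1 + c * q1 ^+ 2 + cj c * (cj q1) ^+ 2.
    rewrite sJ; transitivity (q1 * cj q1 + (c * cj c) * (q1 * cj q1)
      + c * q1 ^+ 2 + cj c * (cj q1) ^+ 2); first by rewrite /s; ring.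
    by rewrite cc; ring.
  transitivity (2 + 4^-1 * (s * cj s) - 2^-1 * cj s * q1 - 2^-1 * (c * s) * q1
    + c * q2); first by field.
  by rewrite e1 e2 sJ wJ /w; field.
have -> : complex.Re (2 - q1 * cj q1 / 2 - c * (q1 ^+ 2 / 2 - q2) + (cj w - w))
   = 2 - nr q1 ^+ 2 / 2 - nr (q1 ^+ 2 / 2 - q2).
  rewrite cE mulJ.
  have -> : (nr q1 ^+ 2)%:C / 2 = (nr q1 ^+ 2 / 2)%:C :> R[i].
    by rewrite [RHS]rmorphM fmorphV rmorph_nat.
  have -> : 2 = (2 : R)%:C :> R[i] by rewrite rmorph_nat.
  by rewrite !ReD !ReN /=; case: (w) => a b /=; ring.
by rewrite subr_ge0 nr_distC.
Qed.
End Caratheodory.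

(** * Higher derivatives of holomorphic maps *)

Section MeanContinuous.
Variable R : realType.
Implicit Types (psi phi : R[i] -> R[i]) (r : R).

Lemma ccontD psi phi (z : R[i]) : ccont psi z -> ccont phi z ->
  ccont (fun w => psi w + phi w) z.
Proof.
move=> h1 h2 e e0; have e2 : 0 < e / 2 by rewrite divr_gt0.
have [d d0 hd1] := h1 _ e2; have [d' d'0 hd2] := h2 _ e2.
exists (Num.min d d'); first by rewrite lt_min d0.
move=> h; rewrite lt_min => /andP[/hd1 l1 /hd2 l2].
have -> : psi (z + h) + phi (z + h) - (psi z + phi z) =
  (psi (z + h) - psi z) + (phi (z + h) - phi z) by ring.
apply: le_lt_trans (nrD _ _) _; lra.
Qed.

Lemma ccontM psi phi (z : R[i]) : ccont psi z -> ccont phi z ->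
  ccont (fun w => psi w * phi w) z.
Proof.
move=> h1 h2 e e0; pose M := nr (psi z) + nr (phi z) + 1.
have M0 : 0 < M by rewrite ltr_wpDl// addr_ge0 ?nr_ge0.
pose e' := Num.min 1 (e / M).
have e'0 : 0 < e' by rewrite lt_min ltr01 divr_gt0.
have e'1 : e' <= 1 by rewrite ge_min lexx.
have e'e : e' * M <= e by rewrite -ler_pdivlMr// ge_min lexx orbT.
have [d d0 hd1] := h1 _ e'0; have [d' d'0 hd2] := h2 _ e'0.
exists (Num.min d d'); first by rewrite lt_min d0.
move=> h; rewrite lt_min => /andP[/hd1 l1 /hd2 l2].
have -> : psi (z + h) * phi (z + h) - psi z * phi z =
  (psi (z + h) - psi z) * (phi (z + h) - phi z) +
  (psi (z + h) - psi z) * phi z + psi z * (phi (z + h) - phi z) by ring.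
apply: le_lt_trans (nrD _ _) _.
apply: le_lt_trans (lerD (nrD _ _) (lexx _)) _; rewrite !nrM.
set u := nr (psi _ - _) in l1 *; set v := nr (phi _ - _) in l2 *.
have u0 : 0 <= u := nr_ge0 _; have v0 : 0 <= v := nr_ge0 _.
have p1 : u * v <= u * 1 by rewrite ler_wpM2l// (le_trans (ltW l2)).
have p2 : u * nr (phi z) <= e' * nr (phi z) by rewrite ler_wpM2r ?nr_ge0// ltW.
have p3 : nr (psi z) * v <= nr (psi z) * e' by rewrite ler_wpM2l ?nr_ge0// ltW.
apply: lt_le_trans e'e; rewrite /M; lra.
Qed.

Lemma ccont_cst (c z : R[i]) : ccont (fun=> c) z.
Proof. by move=> e e0; exists 1 => // h _; rewrite subrr nr0. Qed.

Lemma ccontB psi phi (z : R[i]) : ccont psi z -> ccont phi z ->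
  ccont (fun w => psi w - phi w) z.
Proof.
move=> h1 h2; have := ccontD h1 (ccontM (ccont_cst (-1) z) h2); congr ccont.
by apply: funext => w; rewrite mulN1r.
Qed.

Lemma ccont_invz (z : R[i]) : z != 0 -> ccont (fun w : R[i] => w^-1) z.
Proof. by move=> z0; exact: cder_cont (cder_inv z0). Qed.

Definition ccirc psi r := forall z, nr z = r -> ccont psi z.

(** Linearity from continuity on the circle alone: the derivatives that are averaged below are not
    yet known to be holomorphic. *)
Lemma mean_addC psi phi r : 0 < r -> ccirc psi r -> ccirc phi r ->
  mean (fun z => psi z + phi z) r = mean psi r + mean phi r.
Proof. by move=> r0 h1 h2; rewrite /mean cintD//; exact: ccs_circ. Qed.

Lemma mean_subC psi phi r : 0 < r -> ccirc psi r -> ccirc phi r ->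
  mean (fun z => psi z - phi z) r = mean psi r - mean phi r.
Proof. by move=> r0 h1 h2; rewrite /mean cintB//; exact: ccs_circ. Qed.

Lemma mean_scaleC psi (c : R[i]) r : 0 < r -> ccirc psi r ->
  mean (fun z => c * psi z) r = c * mean psi r.
Proof. by move=> r0 h; rewrite /mean cintZ//; exact: ccs_circ. Qed.

(** Cauchy's formula for the derivative, as a circle mean of the difference quotient. *)
Lemma cder_mean phi (a : R[i]) u r : hol_on phi (-1) u -> cder phi 0 a ->
  0 < r < u -> a = mean (fun z => (phi z - phi 0) * z^-1) r.
Proof.
move=> hphi ha hr; symmetry; apply: mean_lim hr _.
  apply: holM; last exact: (hol_powV 1).
  apply: holB; last exact: hol_cst.
  by apply: hol_sub hphi _ (lexx _); lra.
move=> e e0; have [d d0 hd] := ha e e0; exists d => // z /andP[z0 zd].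
have zN0 : z != 0 by apply: contraTneq z0 => ->; rewrite nr0 ltxx.
have -> : (phi z - phi 0) * z^-1 - a = (phi z - phi 0 - a * z) * z^-1 by field.
by rewrite nrM nrV ler_pdivrMr//; have := hd z zd; rewrite add0r.
Qed.

End MeanContinuous.

Section HolomorphicDerivative.
Variables (R : realType) (V : normedModType R[i]).
Implicit Types (g : V -> R[i]) (x y h v : V).

Lemma cder_line g x v (z : R[i]) : differentiable g (x + z *: v) ->
  cder (fun w => g (x + w *: v)) z ('d g (x + z *: v) v).
Proof. by move=> /diff_hd; exact: hd_line. Qed.

Lemma diff_ccont g x : differentiable g x -> ccont g x.
Proof.
move=> hg; have [K _ hK] := diff_bounded hg.
exact: hd_cont (diff_hd hg) hK.
Qed.

Lemma diff_mean g x v (u r : R) :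
  (forall z : R[i], nr z < u -> differentiable g (x + z *: v)) -> 0 < r < u ->
  'd g x v = mean (fun z => (g (x + z *: v) - g x) * z^-1) r.
Proof.
move=> hg hr; have u0 : 0 < u by case/andP: hr => /lt_trans; apply.
have := @cder_mean R (fun w => g (x + w *: v)) ('d g x v) u r.
rewrite scale0r addr0; apply => //.
  by move=> z /andP[_ /hg] /cder_line; exists ('d g (x + z *: v) v).
by have := @cder_line g x v 0; rewrite scale0r addr0; apply; have := hg 0;
  rewrite nr0 scale0r addr0; apply.
Qed.

Lemma diff_axpy g x (a : R[i]) h v :
  'd g x (a *: h + v) = a * 'd g x h + 'd g x v.
Proof. exact: linearP. Qed.

Lemma nr_shift x y v (z : R[i]) (a b : R) : nr (y - x) < a -> nr z * nr v <= b ->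
  nr (y + z *: v - x) < a + b.
Proof.
move=> yx zv; rewrite addrAC; apply: le_lt_trans (nrD _ _) _.
by rewrite nrZ ltr_leD.
Qed.

(* The derivative in a fixed direction is a circle mean of difference quotients
   of [g]; the Lipschitz bounds below make the remainder of those quotients
   quadratic uniformly on the circle, so one may differentiate under the mean. *)
Section LocalBounds.
Variables (g : V -> R[i]) (x0 : V) (d : R).
Hypothesis d_gt0 : 0 < d.
Hypothesis g_diff : forall y, nr (y - x0) < 4 * d -> differentiable g y.
Hypothesis g_bnd : forall y, nr (y - x0) < 4 * d -> nr (g y - g x0) <= 1.

(** For [nr z = rad h] the displacement [z *: h] has norm [d / 2] whatever [h] is, so the estimates
    come out linear in [nr h]. The balls of radii 4d, 3d and 2d leave room for such a displacement
    at each stage. *)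
Let rad (h : V) := d / (2 * nr h).

Let rad_gt0 h : h != 0 -> 0 < rad h.
Proof. by move=> h0; rewrite divr_gt0// mulr_gt0// nr_gt0. Qed.

Let rad_half h : h != 0 -> rad h * nr h = d / 2.
Proof. by move=> h0; rewrite /rad; field; rewrite gt_eqF// nr_gt0. Qed.

Let diff_meanE y h : nr (y - x0) < 3 * d -> h != 0 ->
  'd g y h = mean (fun z => (g (y + z *: h) - g y) * z^-1) (rad h).
Proof.
have d0 := d_gt0.
move=> hy h0; apply: (@diff_mean g y h (2 * rad h)).
  move=> z hz; apply: g_diff; have -> : 4 * d = 3 * d + d by ring.
  apply: nr_shift hy _; have -> : d = 2 * rad h * nr h.
    by rewrite -mulrA rad_half//; field.
  by rewrite ler_wpM2r ?nr_ge0// ltW.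
by rewrite rad_gt0//=; have := rad_gt0 h0; lra.
Qed.

Let quot_ccirc y h : nr (y - x0) < 3 * d -> h != 0 ->
  ccirc (fun z => (g (y + z *: h) - g y) * z^-1) (rad h).
Proof.
have d0 := d_gt0.
move=> hy h0 z zr; apply: ccontM; last first.
  apply: ccont_invz; apply/eqP => z0; have := rad_gt0 h0.
  by rewrite -zr z0 nr0 ltxx.
apply: ccontB; last exact: ccont_cst.
have : differentiable g (y + z *: h).
  apply: g_diff; have -> : 4 * d = 3 * d + d by ring.
  by apply: nr_shift hy _; rewrite zr rad_half//; lra.
by move=> /cder_line; exact: cder_cont.
Qed.

(** Cauchy's estimate: the numerator of the quotient is at most 2, and 2 / [rad h] is
    [4 / d * nr h]. *)
Lemma diff_le y h : nr (y - x0) < 3 * d -> nr ('d g y h) <= 4 / d * nr h.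
Proof.
have d0 := d_gt0.
move=> hy; have [->|h0] := eqVneq h 0; first by rewrite linear0 !nr0 mulr0.
rewrite (diff_meanE hy h0); apply: mean_le; [exact: rad_gt0|exact: quot_ccirc|].
move=> z zr; rewrite nrM nrV zr ler_pdivrMr ?rad_gt0//.
have -> : 4 / d * nr h * rad h = 2.
  by rewrite -mulrA (mulrC (nr h)) rad_half//; field; rewrite gt_eqF.
have -> : g (y + z *: h) - g y = (g (y + z *: h) - g x0) - (g y - g x0) by ring.
apply: le_trans (nrB _ _) _; have -> : (2 : R) = 1 + 1 by [].
apply: lerD; apply: g_bnd.
  have -> : 4 * d = 3 * d + d by ring.
  by apply: nr_shift hy _; rewrite zr rad_half//; lra.
lra.
Qed.

Lemma nr_segment y h (t : R) : nr (y - x0) < 3 * d ->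
  nr (y + h - x0) < 3 * d -> 0 <= t <= 1 -> nr (y + t%:C *: h - x0) < 3 * d.
Proof.
have d0 := d_gt0.
move=> hy hyh /andP[t0 t1].
have -> : y + t%:C *: h - x0 =
    (1 - t)%:C *: (y - x0) + t%:C *: (y + h - x0).
  have seg k : k + t%:C *: h = (1 - t)%:C *: k + t%:C *: (k + h).
    by rewrite scalerDr addrA -scalerDl -rmorphD/= subrK scale1r.
  by rewrite addrAC [y + h - x0]addrAC; exact: seg.
apply: le_lt_trans (nrD _ _) _; rewrite !nrZ !nrR !ger0_norm ?subr_ge0//.
have [->|tN0] := eqVneq t 0; first by rewrite subr0 mul1r mul0r addr0.
have tp : 0 < t by rewrite lt_neqAle eq_sym tN0.
have -> : 3 * d = (1 - t) * (3 * d) + t * (3 * d) by ring.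
apply: ler_ltD; last by rewrite ltr_pM2l.
by apply: ler_wpM2l; [rewrite subr_ge0|exact: ltW].
Qed.

Lemma lipschitz_le y h : nr (y - x0) < 3 * d -> nr (y + h - x0) < 3 * d ->
  nr (g (y + h) - g y) <= 4 / d * nr h.
Proof.
have d0 := d_gt0.
move=> hy hyh.
have := @mean_value_ineq R (fun w => g (y + w *: h)) 0 1 (4 / d * nr h).
rewrite add0r scale1r scale0r addr0; apply => t t01.
rewrite add0r mulr1; exists ('d g (y + t%:C *: h) h).
  apply: cder_line; apply: g_diff; apply: lt_trans (nr_segment hy hyh t01) _.
  by rewrite ltr_pM2r// ltr_nat.
by rewrite mulr1; apply: diff_le; exact: nr_segment.
Qed.

(** Cauchy's estimate again, now for the increment of [g] by [k], which [lipschitz_le] bounds at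
    both ends of the quotient. *)
Lemma diff_lipschitz y k h : nr (y - x0) < 2 * d -> nr (y + k - x0) < 2 * d ->
  nr ('d g (y + k) h - 'd g y h) <= 16 / d ^+ 2 * nr k * nr h.
Proof.
have d0 := d_gt0.
move=> hy hyk; have [->|h0] := eqVneq h 0.
  by rewrite !linear0 addr0 !nr0 mulr0.
have r0 := rad_gt0 h0.
have y3 : nr (y - x0) < 3 * d by lra.
have yk3 : nr (y + k - x0) < 3 * d by lra.
rewrite (diff_meanE y3 h0) (diff_meanE yk3 h0) -mean_subC//;
  [|exact: quot_ccirc|exact: quot_ccirc].
apply: mean_le => //.
  by move=> z zr; apply: ccontB; exact: quot_ccirc.
move=> z zr.
have -> : (g (y + k + z *: h) - g (y + k)) * z^-1 - (g (y + z *: h) - g y) * z^-1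
  = ((g (y + z *: h + k) - g (y + z *: h)) - (g (y + k) - g y)) * z^-1.
  by rewrite -mulrBl (addrAC y k); congr (_ * _); ring.
rewrite nrM nrV zr ler_pdivrMr//.
have -> : 16 / d ^+ 2 * nr k * nr h * rad h = 4 / d * nr k + 4 / d * nr k.
  rewrite -[_ * nr h * _]mulrA (mulrC (nr h)) rad_half//.
  by field; rewrite gt_eqF.
apply: le_trans (nrB _ _) _; apply: lerD; apply: lipschitz_le => //.
  have -> : 3 * d = 2 * d + d by ring.
  by apply: nr_shift hy _; rewrite zr rad_half//; lra.
have -> : y + z *: h + k = y + k + z *: h by rewrite addrAC.
have -> : 3 * d = 2 * d + d by ring.
by apply: nr_shift hyk _; rewrite zr rad_half//; lra.
Qed.

(** The mean value inequality along the segment, after subtracting the linear term: the derivative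
    left over is an increment of ['d g], bounded by [diff_lipschitz]. *)
Lemma remainder_le y h : nr (y - x0) < d -> nr h < d ->
  nr (g (y + h) - g y - 'd g y h) <= 16 / d ^+ 2 * nr h ^+ 2.
Proof.
have d0 := d_gt0.
move=> hy hh; pose a := 'd g y h.
have ball t : 0 <= t <= 1 -> nr (y + t%:C *: h - x0) < 2 * d.
  case/andP=> t0 t1; have -> : 2 * d = d + d by ring.
  apply: nr_shift hy _; rewrite nrR ger0_norm//.
  by rewrite (le_trans _ (ltW hh))// ler_piMl ?nr_ge0.
have := @mean_value_ineq R (fun w => g (y + w *: h) - w * a) 0 1
  (16 / d ^+ 2 * nr h ^+ 2).
rewrite add0r scale1r scale0r addr0 mul1r mul0r subr0.
have -> : g (y + h) - a - g y = g (y + h) - g y - a by ring.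
apply => t t01; rewrite add0r mulr1.
exists ('d g (y + t%:C *: h) h - a).
  apply: cderB; last by have := cderM (cder_id t%:C) (cder_cst t%:C a);
    rewrite mul1r mulr0 addr0.
  by apply: cder_line; apply: g_diff; have := ball t t01; lra.
rewrite mulr1; have y2 : nr (y - x0) < 2 * d by lra.
apply: le_trans (diff_lipschitz h y2 (ball t t01)) _.
rewrite nrZ nrR; case/andP: t01 => t0 t1; rewrite ger0_norm//.
have -> : 16 / d ^+ 2 * (t * nr h) * nr h = t * (16 / d ^+ 2 * nr h ^+ 2) by ring.
have K0 : 0 <= 16 / d ^+ 2 by rewrite divr_ge0// exprn_ge0// ltW.
by rewrite ler_piMl// mulr_ge0// exprn_ge0// nr_ge0.
Qed.

Lemma diff_diff_local v (r : R) : 0 < r -> r * nr v < d / 2 ->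
  differentiable (fun y => 'd g y v) x0 /\
  forall h, 'd (fun y => 'd g y v) x0 h =
    mean (fun z => ('d g (x0 + z *: v) h - 'd g x0 h) * z^-1) r.
Proof.
have d0 := d_gt0.
move=> r0 rv.
have xx : nr (x0 - x0) < d by rewrite subrr nr0.
have xz (z : R[i]) : nr z = r -> nr (x0 + z *: v - x0) < d.
  by move=> zr; rewrite addrAC subrr add0r nrZ zr; lra.
have zN0 (z : R[i]) : nr z = r -> z != 0.
  by move=> zr; apply/eqP => z0; move: r0; rewrite -zr z0 nr0 ltxx.
have K0 : 0 <= 16 / d ^+ 2 by rewrite divr_ge0// exprn_ge0// ltW.
have cD h : ccirc (fun z => ('d g (x0 + z *: v) h - 'd g x0 h) * z^-1) r.
  move=> z zr; apply: ccontM; last exact: ccont_invz (zN0 z zr).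
  apply: ccontB; last exact: ccont_cst.
  move=> e e0; have k0 : 0 < 16 / d ^+ 2 * nr v * nr h + 1.
    by rewrite ltr_wpDl// mulr_ge0 ?nr_ge0// mulr_ge0 ?nr_ge0.
  have v0 : 0 < nr v + 1 by rewrite ltr_wpDl// nr_ge0.
  exists (Num.min (d / (nr v + 1)) (e / (16 / d ^+ 2 * nr v * nr h + 1))).
    by rewrite lt_min !divr_gt0.
  move=> w; rewrite lt_min !ltr_pdivlMr// => /andP[w1 w2].
  rewrite scalerDl addrA.
  have l1 : nr (x0 + z *: v - x0) < 2 * d by have := xz z zr; lra.
  have l2 : nr (x0 + z *: v + w *: v - x0) < 2 * d.
    have -> : 2 * d = d + d by ring.
    apply: nr_shift (xz z zr) _; have := nr_ge0 w; lra.
  apply: le_lt_trans (diff_lipschitz h l1 l2) _; rewrite nrZ.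
  have := nr_ge0 w; lra.
pose L h := mean (fun z => ('d g (x0 + z *: v) h - 'd g x0 h) * z^-1) r.
have linL : linear L.
  move=> a h k; rewrite /L -[_ *: mean _ _]/(_ * mean _ _).
  rewrite -mean_scaleC// -mean_addC//; last first.
    by move=> z zr; apply: ccontM; [exact: ccont_cst|exact: cD].
  by apply: eq_mean => // z _; rewrite !diff_axpy; ring.
have bndL h : nr (L h) <= 16 / d ^+ 2 * nr v * nr h.
  apply: mean_le => //; first exact: cD.
  move=> z zr; rewrite nrM nrV zr ler_pdivrMr//.
  have l1 : nr (x0 - x0) < 2 * d by lra.
  have l2 : nr (x0 + z *: v - x0) < 2 * d by have := xz z zr; lra.
  apply: le_trans (diff_lipschitz h l1 l2) _; rewrite nrZ zr.
  by rewrite le_eqVlt; apply/orP; left; apply/eqP; ring.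
apply: (hd_diff linL bndL) => e e0.
pose K := 2 * (16 / d ^+ 2) / r + 1.
have K2 : 0 <= 2 * (16 / d ^+ 2) / r.
  by apply: divr_ge0; [apply: mulr_ge0|exact: ltW].
have K1 : 0 < K by rewrite ltr_wpDl.
exists (Num.min (d / 2) (e / K)); first by rewrite lt_min !divr_gt0.
move=> h; rewrite lt_min (ltr_pdivlMr _ _ K1) => /andP[h1 h2].
have meanv y : nr (y - x0) < d -> [/\ 'd g y v =
      mean (fun z => (g (y + z *: v) - g y) * z^-1) r &
      ccirc (fun z => (g (y + z *: v) - g y) * z^-1) r].
  move=> hy; have hz (z : R[i]) : nr z < r + r -> differentiable g (y + z *: v).
    move=> hz; apply: g_diff; have -> : 4 * d = d + 3 * d by ring.
    apply: nr_shift hy _.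
    have := ler_wpM2r (nr_ge0 v) (ltW hz); lra.
  split; first by apply: (diff_mean hz); rewrite r0 ltrDl.
  move=> z zr; apply: ccontM; last exact: ccont_invz (zN0 z zr).
  apply: ccontB; last exact: ccont_cst.
  have := hz z; rewrite zr ltrDl r0 => /(_ isT).
  by move=> /cder_line; exact: cder_cont.
have xh : nr (x0 + h - x0) < d by rewrite addrAC subrr add0r; lra.
have [-> c1] := meanv _ xh; have [-> c2] := meanv _ xx.
rewrite /L -mean_subC// -mean_subC//; last first.
  by move=> z zr; apply: ccontB; [exact: c1|exact: c2].
apply: le_trans (_ : 2 * (16 / d ^+ 2) / r * nr h ^+ 2 <= _); last first.
  have := nr_ge0 h; move: h2; rewrite /K; set S := 2 * _ / r => h2 h0.
  have : nr h * (S + 1) * nr h <= e * nr h by rewrite ler_wpM2r// ltW.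
  by have := mulr_ge0 h0 h0; nra.
apply: mean_le => //.
  by move=> z zr; apply: ccontB; [apply: ccontB; [exact: c1|exact: c2]|exact: cD].
move=> z zr.
(* Regrouped by the direction [h], the quotients form a difference of two first-order remainders of
   [g], at [x0 + z *: v] and at [x0]; each is quadratic in [h]. *)
have -> : (g (x0 + h + z *: v) - g (x0 + h)) * z^-1 -
    (g (x0 + z *: v) - g x0) * z^-1 -
    ('d g (x0 + z *: v) h - 'd g x0 h) * z^-1 =
  ((g (x0 + z *: v + h) - g (x0 + z *: v) - 'd g (x0 + z *: v) h) -
   (g (x0 + h) - g x0 - 'd g x0 h)) * z^-1.
  by rewrite -!mulrBl (addrAC x0 h); congr (_ * _); ring.
rewrite nrM nrV zr ler_pdivrMr// mulrAC divfK ?gt_eqF//.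
have hd' : nr h < d by lra.
apply: le_trans (nrB _ _) _.
have := remainder_le (xz z zr) hd'; have := remainder_le xx hd'; lra.
Qed.

End LocalBounds.

Lemma local_bound g x0 (d : R) : 0 < d ->
  (forall y, nr (y - x0) < d -> differentiable g y) ->
  exists2 d' : R, 0 < d' & forall y, nr (y - x0) < 4 * d' ->
    differentiable g y /\ nr (g y - g x0) <= 1.
Proof.
move=> d0 hg; have gx : differentiable g x0 by apply: hg; rewrite subrr nr0.
have [e e0 he] := diff_ccont gx ltr01.
have m0 : 0 < Num.min d e by rewrite lt_min d0.
exists (Num.min d e / 4); first by rewrite divr_gt0.
move=> y; have -> : 4 * (Num.min d e / 4) = Num.min d e by field.
rewrite lt_min => /andP[/hg yd ye]; split=> //.
have E : x0 + (y - x0) = y by rewrite addrC subrK.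
by have := he _ ye; rewrite E => /ltW.
Qed.

Theorem differentiable_diff g x0 v (d : R) : 0 < d ->
  (forall y, nr (y - x0) < d -> differentiable g y) ->
  differentiable (fun y => 'd g y v) x0.
Proof.
move=> d0 /(local_bound d0)[e e0 he].
have v0 : 0 < nr v + 1 by rewrite ltr_wpDl// nr_ge0.
pose r := e / 2 / (nr v + 1).
have r0 : 0 < r by rewrite !divr_gt0.
have rv : r * nr v < e / 2.
  rewrite mulrAC ltr_pdivrMr// ltr_pM2l ?divr_gt0//; lra.
by have [] := @diff_diff_local g x0 e e0 (fun y hy => (he y hy).1)
  (fun y hy => (he y hy).2) v r r0 rv.
Qed.

(** The circle mean that represents the left side is the one that [diff_mean] gives for the
    derivative of ['d g y u] in the direction [v]. *)
Theorem diff_diffC g x0 u v (d : R) : 0 < d ->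
  (forall y, nr (y - x0) < d -> differentiable g y) ->
  'd (fun y => 'd g y v) x0 u = 'd (fun y => 'd g y u) x0 v.
Proof.
move=> d0 hg; have [e e0 he] := local_bound d0 hg.
have v0 : 0 < nr v + 1 by rewrite ltr_wpDl// nr_ge0.
have m0 : 0 < Num.min d e by rewrite lt_min d0.
pose r := Num.min d e / 2 / (nr v + 1).
have r0 : 0 < r by rewrite !divr_gt0.
have rvm : r * nr v < Num.min d e / 2.
  rewrite mulrAC ltr_pdivrMr// ltr_pM2l ?divr_gt0//; lra.
have md : Num.min d e <= d by rewrite ge_min lexx.
have me : Num.min d e <= e by rewrite ge_min lexx orbT.
have rv : r * nr v < e / 2 by lra.
have [_ E] := @diff_diff_local g x0 e e0 (fun y hy => (he y hy).1)
  (fun y hy => (he y hy).2) v r r0 rv.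
apply: (etrans (E u)); symmetry.
apply: (@diff_mean (fun y => 'd g y u) x0 v (r + r)).
  move=> z zr.
  have lt : nr (x0 + z *: v - x0) < d.
    rewrite addrAC subrr add0r nrZ.
    have := ler_wpM2r (nr_ge0 v) (ltW zr); lra.
  apply: (@differentiable_diff g _ u (d - nr (x0 + z *: v - x0))).
    by rewrite subr_gt0.
  move=> y hy; apply: hg.
  have -> : y - x0 = (y - (x0 + z *: v)) + (x0 + z *: v - x0).
    by rewrite addrA subrK.
  by apply: le_lt_trans (nrD _ _) _; lra.
by rewrite r0 ltrDl.
Qed.

End HolomorphicDerivative.

(** * Coordinates and iterated derivatives *)

Section RowVectors.
Variables (R : realType) (n : nat).
Implicit Types w : 'rV[R[i]]_n.

Lemma nr_coord w j : nr (w 0 j) <= nr w.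
Proof.
rewrite -lecR -!normE [leRHS]mx_normE -[leLHS]nngE num_le.
exact: (le_bigmax _ _ (ord0, j)).
Qed.

Lemma nr_attained w : w != 0 -> exists k, nr (w 0 k) = nr w.
Proof.
move=> w0; have [|[i k]] := @mx_norm_neq0 _ _ _ w.
  by apply: contra_neq w0 => /mx_norm_eq0.
rewrite /= (ord1 i) => h; exists k; apply: complexI; rewrite -!normE.
by rewrite -h.
Qed.

Lemma nr_row_le w (M : R) : 0 <= M -> (forall j, nr (w 0 j) <= M) -> nr w <= M.
Proof.
move=> M0 h; have [->|/nr_attained[k <-]] := eqVneq w 0; first by rewrite nr0.
exact: h.
Qed.

Lemma polydiskE w : polydisk w <-> nr w < 1.
Proof. by rewrite /polydisk/= normE -[1 : R[i]]/(1%:C) ltcR. Qed.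

Lemma nr_delta k : nr (delta_mx 0 k : 'rV[R[i]]_n) = 1.
Proof.
apply/eqP; rewrite eq_le; apply/andP; split.
  apply: nr_row_le => // j; rewrite mxE eqxx/=.
  by case: (j == k); rewrite ?nr1 ?nr0.
by have := nr_coord (delta_mx 0 k) k; rewrite mxE !eqxx nr1.
Qed.

End RowVectors.

Section Components.
Variables (R : realType) (n : nat) (V : normedModType R[i]).
Implicit Types (f g : V -> 'rV[R[i]]_n) (x v : V).

Lemma diff_coord f x k : differentiable f x ->
  differentiable (fun y => f y 0 k) x /\
  forall v, 'd (fun y => f y 0 k) x v = 'd f x v 0 k.
Proof.
move=> hf; have [K K0 hK] := diff_bounded hf.
apply: (@hd_diff R V _ _ x (fun v => 'd f x v 0 k) K).
- by move=> a u v; rewrite linearP !mxE.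
- by move=> h; apply: le_trans (nr_coord _ _) (hK h).
move=> e e0; have [d d0 hd] := diff_hd hf e0; exists d => // h /hd.
apply: le_trans; apply: le_trans (nr_coord _ k); rewrite !mxE; exact: lexx.
Qed.

Lemma diff_row f x : (forall k, differentiable (fun y => f y 0 k) x) ->
  differentiable f x.
Proof.
move=> hf; pose L v : 'rV[R[i]]_n := \row_k 'd (fun y => f y 0 k) x v.
have linL : linear L.
  by move=> a u v; apply/rowP => k; rewrite !mxE linearP.
have /choice[K hK] : forall k, exists K : R, 0 <= K /\
    forall h, nr ('d (fun y => f y 0 k) x h) <= K * nr h.
  by move=> k; have [K K0 hK] := diff_bounded (hf k); exists K.
have bndL h : nr (L h) <= (\sum_k K k) * nr h.
  apply: nr_row_le => [|j]; rewrite ?mxE.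
    by rewrite mulr_ge0 ?nr_ge0// sumr_ge0// => k _; case: (hK k).
  apply: le_trans ((hK j).2 h) _; rewrite ler_wpM2r ?nr_ge0//.
  by rewrite (bigD1 j)//= lerDl sumr_ge0// => k _; case: (hK k).
suff hL : hd f x L by have [] := hd_diff linL bndL hL.
move=> e e0.
have : (\forall h \near (0 : V), forall k,
    nr (f (x + h) 0 k - f x 0 k - L h 0 k) <= e * nr h)%classic.
  apply: filter_forall => k; apply/near0P.
  by have [d d0 hd] := diff_hd (hf k) e0; exists d => // h /hd; rewrite mxE.
case/near0P => d d0 hd; exists d => // h /hd hk; apply: nr_row_le.
  by rewrite mulr_ge0 ?nr_ge0// ltW.
by move=> k; have := hk k; rewrite !mxE.
Qed.

Lemma diff_eq_near (W : normedModType R[i]) (f g : V -> W) x (d : R) : 0 < d ->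
  (forall y, nr (y - x) < d -> f y = g y) -> differentiable f x ->
  differentiable g x /\ 'd g x =1 'd f x.
Proof.
move=> d0 fg hf; have [K K0 hK] := diff_bounded hf.
apply: (hd_diff (linearP _) hK); apply: hd_near (diff_hd hf) _.
by exists d => // h hh; apply: fg; rewrite addrAC subrr add0r.
Qed.

End Components.

Section IteratedDerivatives.
Variables (R : realType) (V : normedModType R[i]) (g : V -> R[i]).
Hypothesis g_diff : forall x, nr x < 1 -> differentiable g x.
Implicit Types (x u v w : V).

Lemma ball_sub x : nr x < 1 ->
  0 < 1 - nr x /\ forall y, nr (y - x) < 1 - nr x -> nr y < 1.
Proof.
move=> hx; split; first by rewrite subr_gt0.
by move=> y hy; rewrite -(subrK x y); apply: le_lt_trans (nrD _ _) _; lra.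
Qed.

Lemma frechet_diff (vs : seq V) x : nr x < 1 -> differentiable (frechet g vs) x.
Proof.
elim: vs x => [|v vs ih] x hx; first exact: g_diff.
have [d0 hd] := ball_sub hx.
by apply: (differentiable_diff v d0) => y /hd; exact: ih.
Qed.

Lemma frechet_head (vs : seq V) x (a : R[i]) u v :
  frechet g (a *: u + v :: vs) x =
  a * frechet g (u :: vs) x + frechet g (v :: vs) x.
Proof. exact: diff_axpy. Qed.

Lemma frechet_swap (vs : seq V) x u v : nr x < 1 ->
  frechet g (u :: v :: vs) x = frechet g (v :: u :: vs) x.
Proof.
move=> hx; have [d0 hd] := ball_sub hx.
by apply: (diff_diffC u v d0) => y /hd; exact: frechet_diff.
Qed.

(** The inner two directions may be exchanged on a whole neighbourhood of [x], and that equality is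
    then differentiated. *)
Lemma frechet_swap2 x u v w : nr x < 1 ->
  frechet g [:: u; v; w] x = frechet g [:: u; w; v] x.
Proof.
move=> hx; have [d0 hd] := ball_sub hx.
have [] := @diff_eq_near R V _ (frechet g [:: w; v]) (frechet g [:: v; w]) x _ d0.
- by move=> y /hd hy; exact: frechet_swap.
- exact: frechet_diff.
- by move=> _ h; exact: h.
Qed.

Lemma cder_frechet_line (vs : seq V) v (z : R[i]) : nr (z *: v) < 1 ->
  cder (fun t => frechet g vs (t *: v)) z (frechet g (v :: vs) (z *: v)).
Proof.
move=> hz; have := @cder_line R V (frechet g vs) 0 v z.
rewrite add0r => h; have := h (frechet_diff vs hz); congr cder.
by apply: funext => t; rewrite add0r.
Qed.

End IteratedDerivatives.

Section VectorFrechet.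
Variables (R : realType) (n : nat) (V : normedModType R[i]).
Variable f : V -> 'rV[R[i]]_n.
Hypothesis f_diff : forall x, nr x < 1 -> differentiable f x.
Implicit Types (x v : V).

Let fc k : V -> R[i] := fun x => f x 0 k.

Let fc_diff k x : nr x < 1 -> differentiable (fc k) x.
Proof. by move=> /f_diff/(diff_coord k)[]. Qed.

(** The two claims need one another: the coordinate formula near [x] transfers differentiability
    from scalar to vector derivatives, and that differentiability lets the formula be differentiated
    once more. *)
Lemma frechet_coord (vs : seq V) x k : nr x < 1 ->
  differentiable (frechet f vs) x /\ frechet f vs x 0 k = frechet (fc k) vs x.
Proof.
elim: vs x k => [|v vs ih] x k hx; first by split=> //; exact: f_diff.
have [d0 hd] := ball_sub hx.
have E j y : nr y < 1 -> frechet (fc j) (v :: vs) y = frechet f (v :: vs) y 0 j.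
  move=> hy; have [d0' hd'] := ball_sub hy.
  have [dj ej] := diff_coord j (ih y j hy).1.
  rewrite /= -ej.
  have [] := @diff_eq_near R V _ (fun y => frechet f vs y 0 j)
    (frechet (fc j) vs) y _ d0'.
  - by move=> y' /hd' hy'; exact: (ih y' j hy').2.
  - exact: dj.
  - by move=> _ h; exact: h.
split; last by rewrite E.
apply: diff_row => j.
have [] := @diff_eq_near R V _ (frechet (fc j) (v :: vs))
  (fun y => frechet f (v :: vs) y 0 j) x _ d0.
- by move=> y /hd; exact: E.
- by apply: frechet_diff => // y; exact: fc_diff.
- by [].
Qed.

End VectorFrechet.

(** * Holomorphy of inverse matrices and Taylor expansion in one variable *)

Section HolomorphicAlgebra.
Variable R : realType.

Lemma cder_sum (I : finType) (F : I -> R[i] -> R[i]) (a : I -> R[i]) (z : R[i]) :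
  (forall i, cder (F i) z (a i)) ->
  cder (fun w => \sum_i F i w) z (\sum_i a i).
Proof.
move=> hF; have gen (s : seq I) :
    cder (fun w => \sum_(i <- s) F i w) z (\sum_(i <- s) a i).
  elim: s => [|i s ih].
    rewrite big_nil; have := cder_cst z 0; congr cder.
    by apply: funext => w; rewrite big_nil.
  rewrite big_cons; have := cderD (hF i) ih; congr cder.
  by apply: funext => w; rewrite big_cons.
exact: gen.
Qed.

Lemma hol_sum (I : finType) (F : I -> R[i] -> R[i]) (l u : R) :
  (forall i, hol_on (F i) l u) -> hol_on (fun w => \sum_i F i w) l u.
Proof.
move=> hF z hz; have /choice[a ha] : forall i, exists a, cder (F i) z a.
  by move=> i; exact: hF.
by exists (\sum_i a i); exact: cder_sum.
Qed.

Lemma hol_prod (I : finType) (F : I -> R[i] -> R[i]) (l u : R) :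
  (forall i, hol_on (F i) l u) -> hol_on (fun w => \prod_i F i w) l u.
Proof.
move=> hF; have gen (s : seq I) : hol_on (fun w => \prod_(i <- s) F i w) l u.
  elim: s => [|i s ih].
    have := @hol_cst R 1 l u; congr hol_on.
    by apply: funext => w; rewrite big_nil.
  have := holM (hF i) ih; congr hol_on.
  by apply: funext => w; rewrite big_cons.
exact: gen.
Qed.

Lemma hol_det n (A : R[i] -> 'M[R[i]]_n) (l u : R) :
  (forall i j, hol_on (fun z => A z i j) l u) ->
  hol_on (fun z => \det (A z)) l u.
Proof.
move=> hA; apply: hol_sum => s; apply: holZ; apply: hol_prod => i; exact: hA.
Qed.

(** By Cramer's rule the coordinate is a polynomial in the entries divided by the determinant. *)
Lemma hol_mul_invmx n (A : R[i] -> 'M[R[i]]_n) (v : R[i] -> 'rV[R[i]]_n)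
    (l u : R) k :
  (forall i j, hol_on (fun z => A z i j) l u) ->
  (forall j, hol_on (fun z => v z 0 j) l u) ->
  (forall z, l < nr z < u -> A z \in unitmx) ->
  hol_on (fun z => (v z *m invmx (A z)) 0 k) l u.
Proof.
move=> hA hv hU.
have h : hol_on (fun z => \sum_j v z 0 j *
    ((\det (A z))^-1 * cofactor (A z) k j)) l u.
  apply: hol_sum => j; apply: holM => //; apply: holM.
    apply: hol_inv; first exact: hol_det.
    by move=> z /hU; rewrite unitmxE unitfE.
  apply: holZ; apply: hol_det => i1 i2.
  have := hA (lift k i1) (lift j i2); congr hol_on.
  by apply: funext => z; rewrite !mxE.
move=> z hz; have [a ha] := h z hz; exists a.
(* [invmx] follows Cramer's rule only at invertible matrices, so the derivative is transferred on a
   disc inside the annulus. *)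
pose d := Num.min (nr z - l) (u - nr z).
have d0 : 0 < d by case/andP: hz => h1 h2; rewrite lt_min !subr_gt0 h1.
apply: hd_near ha _; exists d => // w; rewrite lt_min => /andP[w1 w2].
have hw : l < nr (z + w) < u.
  apply/andP; split; last by apply: le_lt_trans (nrD _ _) _; lra.
  by have := nrB (z + w) w; rewrite addrK; lra.
rewrite mxE; apply: eq_bigr => j _.
by rewrite /invmx (hU _ hw) !mxE.
Qed.

End HolomorphicAlgebra.

Definition dn {R : realType} (h : R[i] -> R[i]) (m : nat) : R[i] -> R[i] :=
  frechet h (nseq m 1).

Section Taylor.
Variable R : realType.
Implicit Types h phi : R[i] -> R[i].

Lemma cder_diff h (z a : R[i]) : cder h z a -> differentiable h z.
Proof.
move=> ha; have lin : linear (fun w : R[i] => a * w).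
  by move=> c u v; rewrite mulrDr -![c *: _]/(c * _); ring.
have bnd (w : R[i]) : nr (a * w) <= nr a * nr w by rewrite nrM.
by have [] := @hd_diff R _ _ h z (fun w => a * w) (nr a) lin bnd ha.
Qed.

Lemma cder_dn h m (z : R[i]) : hol_on h (-1) 1 -> nr z < 1 ->
  cder (dn h m) z (dn h m.+1 z).
Proof.
move=> hh hz; have hd x : nr x < 1 -> differentiable h x.
  move=> hx; have [|a /cder_diff//] := hh x.
  by rewrite hx andbT; apply: lt_le_trans (nr_ge0 x); rewrite ltrN10.
have E (t : R[i]) : t *: (1 : R[i]) = t by rewrite -[t *: 1]/(t * 1) mulr1.
have := @cder_frechet_line R _ h hd (nseq m 1) 1 z; rewrite E => /(_ hz).
by congr cder; apply: funext => t; rewrite E.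
Qed.

(** One integration from 0 gains a power of [nr z]; the mean value inequality gives up the factor 1
    / (m + 1), which an o-estimate can afford. *)
Lemma integrate_bound phi phi' (e d : R) m : d <= 1 -> phi 0 = 0 ->
  (forall z, nr z < 1 -> cder phi z (phi' z)) ->
  (forall z, nr z < d -> nr (phi' z) <= e * nr z ^+ m) ->
  forall z, nr z < d -> nr (phi z) <= e * nr z ^+ m.+1.
Proof.
move=> d1 p0 hphi hb z hz.
have := @mean_value_ineq R phi 0 z (e * nr z ^+ m.+1).
rewrite add0r p0 subr0; apply => t /andP[t0 t1].
have tz : nr (t%:C * z) <= nr z.
  by rewrite nrM nrR ger0_norm// ler_piMl ?nr_ge0.
have tzd := le_lt_trans tz hz.
exists (phi' (t%:C * z)); rewrite ?add0r; first by apply: hphi; lra.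
have e0 : 0 <= e * nr (t%:C * z) ^+ m := le_trans (nr_ge0 _) (hb _ tzd).
rewrite nrM exprSr mulrA ler_wpM2r ?nr_ge0//.
have [z0|zN0] := eqVneq (nr z) 0.
  move: (hb _ tzd); suff -> : nr (t%:C * z) = nr z by [].
  by rewrite nrM z0 mulr0.
have zp : 0 < nr z by rewrite lt_neqAle eq_sym zN0 nr_ge0.
(* The sign of [e] is read off from the bound on [phi'] at a nonzero point. *)
have ep : 0 <= e.
  have h2 : nr (2^-1 * nr z)%:C < d.
    rewrite nrR ger0_norm ?mulr_ge0 ?nr_ge0//; lra.
  have := le_trans (nr_ge0 _) (hb (2^-1 * nr z)%:C h2).
  by rewrite pmulr_lge0// exprn_gt0// nrR normr_gt0 mulf_neq0.
apply: le_trans (hb _ tzd) _; rewrite ler_wpM2l//.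
by rewrite lerXn2r ?nnegrE ?nr_ge0.
Qed.

(** Differentiability of [dn h 2] at 0 is the expansion of that derivative to first order; two
    integrations lift it to [h]. *)
Lemma taylor3 h : hol_on h (-1) 1 ->
  forall e : R, 0 < e -> exists2 d : R, 0 < d & forall z : R[i], nr z < d ->
    nr (h z - h 0 - dn h 1 0 * z - dn h 2 0 / 2 * z ^+ 2
        - dn h 3 0 / 6 * z ^+ 3) <= e * nr z ^+ 3.
Proof.
move=> hh e e0; pose a := dn h 1 0; pose b := dn h 2 0; pose c := dn h 3 0.
have n0 : nr (0 : R[i]) < 1 by rewrite nr0.
have [d d0 hd] := cder_dn 2 hh n0 e0.
exists (Num.min d 1); first by rewrite lt_min d0 ltr01.
have hX (k : R[i]) m z : cder (fun w => k * w ^+ m.+1) z (k * (m.+1%:R * z ^+ m)).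
  apply: cderZ; have := cder_horner ('X^(m.+1)) z.
  rewrite derivXn hornerMn hornerXn -mulr_natl; congr cder.
  by apply: funext => w; rewrite hornerXn.
pose p1 z := dn h 1 z - a - b * z ^+ 1 - c / 2 * z ^+ 2.
pose p2 z := dn h 2 z - b - c * z.
pose p0 z := h z - h 0 - a * z ^+ 1 - b / 2 * z ^+ 2 - c / 6 * z ^+ 3.
have I2 (D b' c' z : R[i]) : D - b' - c' * z =
    D - 0 - b' * (1%:R * z ^+ 0) - c' / 2 * (2%:R * z ^+ 1) by field.
have I1 (D a' b' c' z : R[i]) : D - a' - b' * z ^+ 1 - c' / 2 * z ^+ 2 =
    D - 0 - a' * (1%:R * z ^+ 0) - b' / 2 * (2%:R * z ^+ 1)
      - c' / 6 * (3%:R * z ^+ 2) by field.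
have Z1 (a' b' c' : R[i]) : a' - a' - b' * 0 ^+ 1 - c' * 0 ^+ 2 = 0 by ring.
have Z0 (h' a' b' c' : R[i]) :
    h' - h' - a' * 0 ^+ 1 - b' * 0 ^+ 2 - c' * 0 ^+ 3 = 0 by ring.
have m1 : Num.min d 1 <= 1 by rewrite ge_min lexx orbT.
have B2 z : nr z < Num.min d 1 -> nr (p2 z) <= e * nr z ^+ 1.
  by rewrite lt_min => /andP[/hd + _]; rewrite add0r.
have D1 z : nr z < 1 -> cder p1 z (p2 z).
  move=> hz; have := cderB (cderB (cderB (cder_dn 1 hh hz) (cder_cst z a))
    (hX b 0%N z)) (hX (c / 2) 1%N z).
  by rewrite -I2.
have D0 z : nr z < 1 -> cder p0 z (p1 z).
  move=> hz; have := cderB (cderB (cderB (cderB (cder_dn 0 hh hz)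
    (cder_cst z (h 0))) (hX a 0%N z)) (hX (b / 2) 1%N z)) (hX (c / 6) 2%N z).
  by rewrite -I1.
have B1 : forall z, nr z < Num.min d 1 -> nr (p1 z) <= e * nr z ^+ 2.
  apply: (integrate_bound m1 _ D1 B2).
  exact: Z1.
have B0 : forall z, nr z < Num.min d 1 -> nr (p0 z) <= e * nr z ^+ 3.
  apply: (integrate_bound m1 _ D0 B1).
  exact: Z0.
exact: B0.
Qed.

(** The function (h(z) / (c z) - alpha) / (1 - alpha) tends to 1 at 0 and has nonnegative real part;
    [q1] and [q2] are its next Taylor coefficients. *)
Theorem caratheodory_map h (alpha : R) (c : R[i]) : alpha < 1 ->
  hol_on h (-1) 1 -> h 0 = 0 -> c != 0 -> dn h 1 0 = c ->
  (forall z : R[i], 0 < nr z < 1 -> alpha <= complex.Re (h z / (c * z))) ->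
  forall q1 q2, q1 = dn h 2 0 / (2 * c * (1 - alpha)%:C) ->
  q2 = dn h 3 0 / (6 * c * (1 - alpha)%:C) ->
  nr (q2 - q1 ^+ 2 / 2) <= 2 - nr q1 ^+ 2 / 2.
Proof.
move=> a1 hh h0 c0 hc hre q1 q2 q1E q2E.
have b0 : 0 < 1 - alpha by lra.
have bC0 : (1 - alpha)%:C != 0 :> R[i] by rewrite eq_complex/= gt_eqF.
pose q z := (h z / (c * z) - alpha%:C) * ((1 - alpha)^-1)%:C.
apply: (@caratheodory R q).
- apply: holM; last exact: hol_cst; apply: holB; last exact: hol_cst.
  apply: holM; first by apply: hol_sub hh _ _; lra.
  apply: hol_inv; first by apply: holZ; exact: hol_id.
  move=> z /andP[z0 _]; rewrite mulf_neq0//.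
  by apply: contraTneq z0 => ->; rewrite nr0 ltxx.
- move=> z hz; rewrite /q mulrC ReM/= mul0r subr0 mulr_ge0 ?invr_ge0 ?(ltW b0)//.
  by rewrite ReD ReN/= subr_ge0; exact: hre.
move=> e e0; have e1 : 0 < e * nr c * (1 - alpha).
  by rewrite !mulr_gt0// nr_gt0.
have [d d0 hd] := taylor3 hh e1.
exists d => // z /andP[z0 zd].
have zN0 : z != 0 by apply: contraTneq z0 => ->; rewrite nr0 ltxx.
have -> : q z - 1 - q1 * z - q2 * z ^+ 2 =
  (h z - h 0 - dn h 1 0 * z - dn h 2 0 / 2 * z ^+ 2 - dn h 3 0 / 6 * z ^+ 3)
  * (c * z * (1 - alpha)%:C)^-1.
  have I (hz b' c' k : R[i]) : k != 0 -> (hz / (c * z) - (1 - k)) * k^-1 - 1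
      - b' / (2 * c * k) * z - c' / (6 * c * k) * z ^+ 2 =
    (hz - 0 - c * z - b' / 2 * z ^+ 2 - c' / 6 * z ^+ 3) * (c * z * k)^-1.
    by move=> k0; field; rewrite k0 zN0 c0.
  rewrite /q q1E q2E h0 hc -I//; congr ((_ - _) * _ - _ - _ - _).
    by rewrite rmorphB/= rmorph1; ring.
  exact: fmorphV.
have cp : 0 < nr c := nr_gt0 c0.
rewrite nrM nrV ler_pdivrMr !nrM nrR (gtr0_norm b0).
  apply: le_trans (hd z zd) _; rewrite le_eqVlt; apply/orP; left; apply/eqP; ring.
by rewrite !mulr_gt0.
Qed.

End Taylor.

(** * Derivatives at 0 of the relations between f, h and Df *)

Section Towers.
Variables (R : realType) (n : nat).
(** To be read with [U m j], [H m j] and [A m i j] the m-th derivatives in t of f_j(t z0), of h_j(t)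
    and of the entry (i, j) of Df(t z0), and with [c] for z0. *)
Variables (U H : nat -> 'I_n -> R[i] -> R[i]).
Variables (A : nat -> 'I_n -> 'I_n -> R[i] -> R[i]) (c : 'I_n -> R[i]).
Hypothesis U_der : forall m j z, nr z < 1 -> cder (U m j) z (U m.+1 j z).
Hypothesis H_der : forall m j z, nr z < 1 -> cder (H m j) z (H m.+1 j z).
Hypothesis A_der : forall m i j z, nr z < 1 ->
  cder (A m i j) z (A m.+1 i j z).
Hypothesis U_HA : forall j z, nr z < 1 ->
  U 0%N j z = \sum_i H 0%N i z * A 0%N i j z.
Hypothesis U_cA : forall j z, nr z < 1 -> U 1%N j z = \sum_i c i * A 0%N i j z.
Hypothesis A_id : forall i j, A 0%N i j 0 = (i == j)%:R.
Hypothesis H_0 : forall j, H 0%N j 0 = 0.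

Lemma cder_disc_unique (f g : R[i] -> R[i]) (z a b : R[i]) : nr z < 1 ->
  (forall w, nr w < 1 -> f w = g w) -> cder f z a -> cder g z b -> a = b.
Proof.
move=> hz fg ha; apply: cder_unique; apply: hd_near ha _.
exists (1 - nr z); first by rewrite subr_gt0.
by move=> h hh; apply: fg; apply: le_lt_trans (nrD _ _) _; lra.
Qed.

Let U_cA2 j z : nr z < 1 -> U 2%N j z = \sum_i c i * A 1%N i j z.
Proof.
move=> hz; apply: (cder_disc_unique hz (U_cA j) (U_der 1 j hz)).
by apply: cder_sum => i; apply: cderZ; exact: A_der.
Qed.

Let U_cA3 j z : nr z < 1 -> U 3%N j z = \sum_i c i * A 2%N i j z.
Proof.
move=> hz; apply: (cder_disc_unique hz (U_cA2 j) (U_der 2 j hz)).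
by apply: cder_sum => i; apply: cderZ; exact: A_der.
Qed.

Let cHA p q i j z : nr z < 1 -> cder (fun w => H p i w * A q i j w) z
  (H p.+1 i z * A q i j z + H p i z * A q.+1 i j z).
Proof. by move=> hz; apply: cderM; [exact: H_der|exact: A_der]. Qed.

Let U_HA1 j z : nr z < 1 -> U 1%N j z =
  \sum_i (H 1%N i z * A 0%N i j z + H 0%N i z * A 1%N i j z).
Proof.
move=> hz; apply: (cder_disc_unique hz (U_HA j) (U_der 0 j hz)).
by apply: cder_sum => i; exact: cHA.
Qed.

Let U_HA2 j z : nr z < 1 -> U 2%N j z =
  \sum_i ((H 2%N i z * A 0%N i j z + H 1%N i z * A 1%N i j z) +
          (H 1%N i z * A 1%N i j z + H 0%N i z * A 2%N i j z)).
Proof.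
move=> hz; apply: (cder_disc_unique hz (U_HA1 j) (U_der 1 j hz)).
by apply: cder_sum => i; apply: cderD; exact: cHA.
Qed.

Let U_HA3 j z : nr z < 1 -> U 3%N j z =
  \sum_i (((H 3%N i z * A 0%N i j z + H 2%N i z * A 1%N i j z) +
           (H 2%N i z * A 1%N i j z + H 1%N i z * A 2%N i j z)) +
          ((H 2%N i z * A 1%N i j z + H 1%N i z * A 2%N i j z) +
           (H 1%N i z * A 2%N i j z + H 0%N i z * A 3%N i j z))).
Proof.
move=> hz; apply: (cder_disc_unique hz (U_HA2 j) (U_der 2 j hz)).
by apply: cder_sum => i; apply: cderD; apply: cderD; exact: cHA.
Qed.

Let n0 : nr (0 : R[i]) < 1. Proof. by rewrite nr0. Qed.

Let sum_A0 (x : 'I_n -> R[i]) j : \sum_i x i * A 0%N i j 0 = x j.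
Proof.
rewrite (bigD1 j)//= A_id eqxx mulr1 big1 ?addr0// => i ij.
by rewrite A_id (negbTE ij) mulr0.
Qed.

Lemma tower1 j : H 1%N j 0 = c j.
Proof.
have := U_HA1 j n0; rewrite (U_cA j n0) sum_A0 => ->.
under eq_bigr do rewrite H_0 mul0r addr0.
by rewrite sum_A0.
Qed.

(** By Leibniz's rule at 0, where h vanishes and Df is the identity, U_2 = H_2 + 2 c A_1, while U_2
    = c A_1. *)
Lemma tower2 j : H 2%N j 0 = - U 2%N j 0.
Proof.
have := U_HA2 j n0.
under eq_bigr do rewrite H_0 mul0r addr0 tower1 -addrA.
rewrite big_split/= sum_A0 big_split/= -U_cA2// => E.
have -> : H 2%N j 0 = H 2%N j 0 + (U 2%N j 0 + U 2%N j 0) - U 2%N j 0 - U 2%N j 0.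
  by ring.
by rewrite -E; ring.
Qed.

(** Likewise U_3 = H_3 + 3 H_2 A_1 + 3 c A_2 with H_2 = - U_2 and c A_2 = U_3. *)
Lemma tower3 j : H 3%N j 0 =
  - 2 * U 3%N j 0 + 3 * \sum_i U 2%N i 0 * A 1%N i j 0.
Proof.
have := U_HA3 j n0.
have -> : \sum_i (((H 3%N i 0 * A 0%N i j 0 + H 2%N i 0 * A 1%N i j 0) +
           (H 2%N i 0 * A 1%N i j 0 + H 1%N i 0 * A 2%N i j 0)) +
          ((H 2%N i 0 * A 1%N i j 0 + H 1%N i 0 * A 2%N i j 0) +
           (H 1%N i 0 * A 2%N i j 0 + H 0%N i 0 * A 3%N i j 0))) =
  \sum_i (H 3%N i 0 * A 0%N i j 0 + (- (3 * (U 2%N i 0 * A 1%N i j 0)) +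
     3 * (c i * A 2%N i j 0))).
  by apply: eq_bigr => i _; rewrite H_0 tower1 tower2; ring.
rewrite big_split/= sum_A0 big_split/= sumrN -!mulr_sumr -U_cA3//.
set S := \sum_i _ => E.
have -> : H 3%N j 0 = (H 3%N j 0 + (- (3 * S) + 3 * U 3%N j 0))
  + 3 * S - 3 * U 3%N j 0 by ring.
by rewrite -E; ring.
Qed.

End Towers.

(** * Starlike maps on complex lines *)

Section MaximumModulus.
Variable R : realType.
Implicit Types (phi psi : R[i] -> R[i]).

Lemma mean_center psi (u r : R) : hol_on psi (-1) u -> 0 < r < u ->
  mean psi r = psi 0.
Proof.
move=> hpsi hr; have u0 : 0 < u by case/andP: hr; exact: lt_trans.
apply: mean_lim hr _; first by apply: hol_sub hpsi _ (lexx _); lra.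
have [|A hA] := hpsi 0; first by rewrite nr0 u0 andbT ltrN10.
move=> e /(cder_cont hA)[d d0 hd]; exists d => // z /andP[_ /hd].
by rewrite add0r => /ltW.
Qed.

(* The Moebius map [z |-> (z + a) / (1 + conj a * z)] sends 0 to [a] and
   preserves the unit circle, so that [phi a] is a circle mean. *)
Lemma maximum_modulus phi (M : R) (a : R[i]) :
  (forall z, exists A, cder phi z A) -> (forall z, nr z = 1 -> nr (phi z) <= M) ->
  nr a < 1 -> nr (phi a) <= M.
Proof.
move=> hphi hM ha; have a0 := nr_ge0 a.
(* [u] lies above 1 and below 1 / [nr a], the modulus of the pole of [m], so [m] is holomorphic past
   the unit circle. *)
pose u := 2 / (1 + nr a); have u1 : 1 < u by rewrite /u ltr_pdivlMr; lra.
pose m z := (z + a) * (1 + cj a * z)^-1.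
have hN0 z : nr z < u -> 1 + cj a * z != 0.
  move=> hz; apply/eqP => h.
  have E : cj a * z = -1 by apply/eqP; rewrite -subr_eq0 opprK addrC h.
  have : nr (cj a * z) = 1 by rewrite E nrN nr1.
  rewrite nrM nrJ => h1; move: hz; rewrite /u ltr_pdivlMr; last by lra.
  have := nr_ge0 z; nra.
have hm : hol_on m (-1) u.
  apply: holM; first by apply: holD; [exact: hol_id|exact: hol_cst].
  apply: hol_inv; last by move=> z /andP[_]; exact: hN0.
  by apply: holD; [exact: hol_cst|apply: holZ; exact: hol_id].
have hpm : hol_on (fun z => phi (m z)) (-1) u.
  move=> z /hm[A hA]; have [B hB] := hphi (m z).
  by exists (B * A); exact: cder_comp.
have -> : phi a = mean (fun z => phi (m z)) 1.
  rewrite (mean_center hpm) ?ltr01//; congr phi.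
  by rewrite /m mulr0 addr0 invr1 mulr1 add0r.
apply: mean_le => // z z1.
  by apply: (hol_ccont hpm); rewrite z1 u1 andbT; lra.
apply: hM; rewrite /m nrM nrV.
have zz : z * cj z = 1 by rewrite mulJ z1 expr1n.
have -> : z + a = z * (1 + a * cj z).
  by rewrite mulrDr mulr1 mulrCA zz mulr1.
rewrite nrM z1 mul1r -nrJ cjD cj1 cjM cjK mulfV//.
by apply: lt0r_neq0; apply: nr_gt0; apply: hN0; rewrite z1.
Qed.

End MaximumModulus.

Lemma ReRM (R : realType) (r : R) (x : R[i]) :
  complex.Re (r%:C * x) = r * complex.Re x.
Proof. by rewrite ReM/= mul0r subr0. Qed.

Section Supporting.
Variables (R : realType) (n : nat).

(** The coordinate where the maximum is attained, rotated to be positive at [x]; its norm 1 is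
    attained at the basis vector. *)
Lemma supporting_coord (x : 'rV[R[i]]_n) k : x != 0 -> nr (x 0 k) = nr x ->
  exists2 T, supporting x T & forall v, T v = v 0 k * ((nr x)%:C / x 0 k).
Proof.
move=> x0 hk; pose c := (nr x)%:C / x 0 k.
have nx := nr_gt0 x0.
have xk0 : x 0 k != 0.
  by apply/eqP => h; move: nx; rewrite -hk h nr0 ltxx.
have nc : nr c = 1 by rewrite /c nrM nrV nrR (gtr0_norm nx) hk mulfV// gt_eqF.
have lin : linear (fun v : 'rV[R[i]]_n => v 0 k * c : R[i]).
  by move=> a u v; rewrite !mxE -[a *: (_ : R[i])]/(a * _); ring.
pose TM := GRing.isLinear.Build _ _ _ _
  (fun v : 'rV[R[i]]_n => v 0 k * c : R[i]) lin.
pose T : {linear 'rV[R[i]]_n -> R[i]} :=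
  HB.pack (fun v : 'rV[R[i]]_n => v 0 k * c : R[i]) TM.
exists T => //; split; last first.
  by rewrite normE /= /c mulrC divfK.
rewrite /opnorm; apply/eqP; rewrite eq_le; apply/andP; split.
  apply: ge_sup.
    by exists (complex.Re `|T 0|); exists 0 => //=; rewrite normr0 ler01.
  move=> _ [v /= hv <-]; rewrite -[leLHS]/(nr (v 0 k * c)) nrM nc mulr1.
  apply: le_trans (nr_coord _ _) _.
  by move: hv; rewrite normE -[1 : R[i]]/(1%:C) lecR.
apply: ub_le_sup.
  exists 1 => _ [v /= hv <-]; rewrite -[leLHS]/(nr (v 0 k * c)) nrM nc mulr1.
  apply: le_trans (nr_coord _ _) _.
  by move: hv; rewrite normE -[1 : R[i]]/(1%:C) lecR.
exists (delta_mx 0 k) => /=.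
  by rewrite normE nr_delta.
by rewrite -[LHS]/(nr (delta_mx 0 k 0 k * c)) nrM nc mulr1 mxE !eqxx nr1.
Qed.

End Supporting.

Lemma diff_row_sum (R : realType) (n : nat) (G : 'rV[R[i]]_n -> R[i]) x v :
  'd G x v = \sum_i v 0 i * 'd G x (delta_mx 0 i).
Proof.
rewrite [in LHS](row_sum_delta v) linear_sum; apply: eq_bigr => i _.
exact: linearZ.
Qed.

Section StarlikeLine.
Variables (R : realType) (n : nat) (alpha : R).
Variable f : 'rV[R[i]]_n -> 'rV[R[i]]_n.
Hypothesis alpha_lt1 : alpha < 1.
Hypothesis f_star : almost_starlike alpha f.
Implicit Types x v : 'rV[R[i]]_n.

Lemma star_diff x : nr x < 1 -> differentiable f x.
Proof. by case: f_star => _ [hol _] _ /polydiskE; exact: hol. Qed.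

Lemma star_comp_diff k x : nr x < 1 -> differentiable (component f k) x.
Proof. by move=> /star_diff/(diff_coord k)[]. Qed.

Lemma jacobian_frechet x i j : nr x < 1 ->
  ('J f x) i j = frechet (component f j) [:: delta_mx 0 i] x.
Proof.
move=> /star_diff/(diff_coord j)[_ /= E].
by rewrite /component E /jacobian mxE.
Qed.

Lemma frechet1_jacobian x v j : nr x < 1 ->
  frechet (component f j) [:: v] x = \sum_i v 0 i * ('J f x) i j.
Proof.
move=> /star_diff/(diff_coord j)[_ /= E].
by rewrite /component E -(mul_rV_lin1 ('d f x) v) mxE.
Qed.

Section Line.
Variables (z0 : 'rV[R[i]]_n) (k : 'I_n).
Hypothesis z0_norm : nr z0 = 1.
Hypothesis z0_k : nr (z0 0 k) = 1.

Let line_lt (t : R[i]) : nr t < 1 -> nr (t *: z0) < 1.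
Proof. by rewrite nrZ z0_norm mulr1. Qed.

Let h j (t : R[i]) : R[i] := (f (t *: z0) *m invmx ('J f (t *: z0))) 0 j.
Let U m j (t : R[i]) : R[i] := frechet (component f j) (nseq m z0) (t *: z0).
Let A m i j (t : R[i]) : R[i] :=
  frechet (component f j) (nseq m z0 ++ [:: delta_mx 0 i]) (t *: z0).

Let unit_jac (t : R[i]) : nr t < 1 -> 'J f (t *: z0) \in unitmx.
Proof. by move=> /line_lt/polydiskE; case: f_star => _ [_ hU] _; exact: hU. Qed.

Let U_der m j (t : R[i]) : nr t < 1 -> cder (U m j) t (U m.+1 j t).
Proof.
by move=> /line_lt; apply: cder_frechet_line => x; exact: star_comp_diff.
Qed.

Let A_der m i j (t : R[i]) : nr t < 1 -> cder (A m i j) t (A m.+1 i j t).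
Proof.
by move=> /line_lt; apply: cder_frechet_line => x; exact: star_comp_diff.
Qed.

Let A0_jac i j (t : R[i]) : nr t < 1 -> A 0 i j t = ('J f (t *: z0)) i j.
Proof. by move=> /line_lt ht; rewrite jacobian_frechet. Qed.

Lemma star_hol j : hol_on (h j) (-1) 1.
Proof.
apply: hol_mul_invmx.
- move=> i l t /andP[_ ht]; exists (A 1 i l t).
  apply: hd_near (A_der 0 i l ht) _; exists (1 - nr t); first by rewrite subr_gt0.
  move=> s hs; rewrite A0_jac//; apply: le_lt_trans (nrD _ _) _; lra.
- move=> l t /andP[_ ht]; exists (U 1 l t); exact: (U_der 0 l ht).
- by move=> t /andP[_]; exact: unit_jac.
Qed.

Let H_der m j (t : R[i]) : nr t < 1 -> cder (dn (h j) m) t (dn (h j) m.+1 t).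
Proof. by move=> ht; apply: cder_dn => //; exact: star_hol. Qed.

Let U_HA j (t : R[i]) : nr t < 1 ->
  U 0 j t = \sum_i dn (h i) 0 t * A 0 i j t.
Proof.
move=> ht; rewrite /U/= /component.
rewrite -[in LHS](mulmxKV (unit_jac ht) (f (t *: z0))) mxE.
by apply: eq_bigr => i _; rewrite A0_jac.
Qed.

Let U_cA j (t : R[i]) : nr t < 1 -> U 1 j t = \sum_i z0 0 i * A 0 i j t.
Proof.
move=> ht; rewrite -[LHS]/(frechet (component f j) [:: z0] (t *: z0)).
rewrite frechet1_jacobian ?line_lt//.
by apply: eq_bigr => i _; rewrite A0_jac.
Qed.

Let A_id i j : A 0 i j 0 = (i == j)%:R.
Proof.
by rewrite A0_jac ?nr0// scale0r; case: f_star => -[_ ->] _ _; rewrite mxE.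
Qed.

Let H_0 j : dn (h j) 0 0 = 0.
Proof.
rewrite /dn/= /h scale0r; case: f_star => -[-> _] _ _.
by rewrite mul0mx mxE.
Qed.

Lemma star_ratio (t : R[i]) : 0 < nr t < 1 ->
  alpha <= complex.Re (h k t / (z0 0 k * t)).
Proof.
move=> /andP[t0 t1]; have x1 := line_lt t1; set x := t *: z0 in x1.
have nx : nr x = nr t by rewrite nrZ z0_norm mulr1.
have x0 : x != 0 by apply/eqP => x0; move: t0; rewrite -nx x0 nr0 ltxx.
have xk : nr (x 0 k) = nr x by rewrite mxE nrM z0_k mulr1 nx.
have [T hT TE] := supporting_coord x0 xk.
case: f_star => _ _ /(_ x)/(_ ((polydiskE x).2 x1) x0 T hT).
rewrite TE -[complex.Re `|x|]/(nr x) nx -/(h k t) mxE.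
have -> : h k t * ((nr t)%:C / (t * z0 0 k)) =
  (nr t)%:C * (h k t / (z0 0 k * t)) by rewrite (mulrC t); ring.
by rewrite ReRM mulrC ler_pM2l.
Qed.

Let X := frechet (component f k) [:: z0; frechet f [:: z0; z0] 0] 0.

(** Expanding one argument in the basis identifies the sum left by [tower3] with the mixed term of
    the quadratic condition. *)
Let X_sum : \sum_i U 2 i 0 * A 1 i k 0 = X.
Proof.
have n0 : nr (0 : 'rV[R[i]]_n) < 1 by rewrite nr0.
rewrite /X (frechet_swap (g := component f k) (star_comp_diff k))//.
set v := frechet f _ 0.
have -> : frechet (component f k) [:: v; z0] 0 =
    \sum_i v 0 i * frechet (component f k) [:: delta_mx 0 i; z0] 0.
  exact: diff_row_sum.
apply: eq_bigr => i _; congr (_ * _).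
  rewrite /U scale0r /v; have [_ ->] := frechet_coord star_diff [:: z0; z0] i n0.
  by [].
rewrite /A scale0r /=.
have := frechet_swap (star_comp_diff k) [::] z0 (delta_mx 0 i) n0.
by [].
Qed.

(** At 0 the second and third derivatives of h_k are - D2 and - 2 D3 + 3 X; dividing by 2 c b and 6
    c b gives [q1] and [q2], and the relations are solved for D2 and D3. *)
Lemma star_coefficients (b : R[i]) : b = (1 - alpha)%:C ->
  let D2 := frechet (component f k) [:: z0; z0] 0 in
  let D3 := frechet (component f k) [:: z0; z0; z0] 0 in
  exists q1 q2 : R[i], [/\ nr (q2 - q1 ^+ 2 / 2) <= 2 - nr q1 ^+ 2 / 2,
    D2 = - (2 * z0 0 k * b * q1) & D3 / 3 = X / 2 - z0 0 k * b * q2].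
Proof.
move=> bE D2 D3; set c := z0 0 k.
have c0 : c != 0 by apply/eqP => c0; move: z0_k; rewrite -/c c0 nr0 => /eqP;
  rewrite eq_sym oner_eq0.
have b0 : b != 0 by rewrite bE eq_complex/= gt_eqF// subr_gt0.
have T1 := tower1 U_der H_der A_der U_HA U_cA A_id H_0 k.
have T2 := tower2 U_der H_der A_der U_HA U_cA A_id H_0 k.
have T3 := tower3 U_der H_der A_der U_HA U_cA A_id H_0 k.
have D2E : D2 = U 2 k 0 := congr1 (frechet _ [:: z0; z0]) (esym (scale0r z0)).
have D3E : D3 = U 3 k 0 :=
  congr1 (frechet _ [:: z0; z0; z0]) (esym (scale0r z0)).
rewrite X_sum -D3E in T3; rewrite -D2E in T2.
pose q1 := dn (h k) 2 0 / (2 * c * (1 - alpha)%:C).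
pose q2 := dn (h k) 3 0 / (6 * c * (1 - alpha)%:C).
exists q1, q2; split.
- exact: (caratheodory_map alpha_lt1 (star_hol k) (H_0 k) c0 T1 star_ratio
    erefl erefl).
- by rewrite /q1 T2 -bE; move: (D2) => d; field; rewrite b0 c0.
- by rewrite /q2 T3 -bE; move: (D3) (X) => d x; field; rewrite b0 c0.
Qed.

End Line.

Lemma star_second (z0 : 'rV[R[i]]_n) k : nr z0 = 1 -> nr (z0 0 k) = 1 ->
  nr (frechet (component f k) [:: z0; z0] 0) <= 4 * (1 - alpha).
Proof.
move=> hz hk.
have [q1 [q2 [q12 -> _]]] := star_coefficients hz hk (erefl _).
have b0 : 0 < 1 - alpha by rewrite subr_gt0.
rewrite nrN !nrM hk mulr1 (nr_nat _ 2) nrR gtr0_norm//.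
have h0 := nr_ge0 (q2 - q1 ^+ 2 / 2).
(* The right side of Caratheodory's inequality has to be nonnegative. *)
have q1le : nr q1 <= 2.
  rewrite -(@ler_pXn2r _ 2)// ?nnegrE ?nr_ge0//; lra.
have := ler_wpM2l (ltW b0) q1le; lra.
Qed.

End StarlikeLine.

(** * The upper bound *)

Section Multilinear.
Variables (R : realType) (V : lmodType R[i]).
Implicit Types (a c s t : R[i]) (e u v w x : V).

Section Bilinear.
Variable B : V -> V -> R[i].
Hypothesis BC : forall u v, B u v = B v u.
Hypothesis B_l : forall a u v w, B (a *: u + v) w = a * B u w + B v w.

Lemma bilinear_r a u v w : B w (a *: u + v) = a * B w u + B w v.
Proof. by rewrite BC B_l !(BC _ w). Qed.

Lemma bilinear_0l u : B 0 u = 0.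
Proof.
by have := B_l (-1) u u u; rewrite scaleN1r addNr mulN1r addNr.
Qed.

Lemma bilinear_Zl a u v : B (a *: u) v = a * B u v.
Proof. by rewrite -[a *: u]addr0 B_l bilinear_0l addr0. Qed.

Lemma bilinear_Zr a u v : B u (a *: v) = a * B u v.
Proof. by rewrite BC bilinear_Zl BC. Qed.

(* The weights 1/2, 1/4, 1/4 at [t = 1, 'i, - 'i] form the positive kernel
   [1 + cos], which keeps the constant term and half of the linear term. *)
Lemma bilinear_average (G : R[i] -> R[i]) c e w :
  (forall t, G t = B (t *: w + c *: e) (t *: w + c *: e)) ->
  c * B e (c *: e + w) = (2 * G 1 + G (Complex 0 1) + G (- Complex 0 1)) / 4.
Proof.
move=> hG.
have GE t : G t = t ^+ 2 * B w w + 2 * t * c * B e w + c ^+ 2 * B e e.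
  by rewrite hG B_l !bilinear_r !bilinear_Zl !bilinear_Zr (BC w e); ring.
have i2 : (Complex 0 1 : R[i]) ^+ 2 = -1 by apply: eqC => /=; ring.
by rewrite bilinear_r !GE sqrrN i2; field.
Qed.

End Bilinear.

Section Trilinear.
Variable T : V -> V -> V -> R[i].
Hypothesis T_swap1 : forall u v w, T u v w = T v u w.
Hypothesis T_swap2 : forall u v w, T u v w = T u w v.
Hypothesis T_1 : forall a u v w x, T (a *: u + v) w x = a * T u w x + T v w x.

Lemma trilinear_2 a u v w x : T w (a *: u + v) x = a * T w u x + T w v x.
Proof. by rewrite T_swap1 T_1 !(T_swap1 _ w). Qed.

Lemma trilinear_3 a u v w x : T w x (a *: u + v) = a * T w x u + T w x v.
Proof. by rewrite T_swap2 trilinear_2 !(T_swap2 w x). Qed.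

Lemma trilinear_0 u v : T 0 u v = 0.
Proof.
by have := T_1 (-1) u u u v; rewrite scaleN1r addNr mulN1r addNr.
Qed.

Lemma trilinear_line s e w : T (s *: e + w) (s *: e + w) (s *: e + w) =
  s ^+ 3 * T e e e + 3 * s ^+ 2 * T e e w + 3 * s * T e w w + T w w w.
Proof.
rewrite !(T_1, trilinear_2, trilinear_3).
have -> : T w e w = T e w w by rewrite T_swap1.
have -> : T w w e = T e w w by rewrite T_swap2 T_swap1.
have -> : T w e e = T e e w by rewrite T_swap1 T_swap2.
have -> : T e w e = T e e w by rewrite T_swap2.
by ring.
Qed.

Lemma trilinear_scale a u : T (a *: u) (a *: u) (a *: u) = a ^+ 3 * T u u u.
Proof.
rewrite -[a *: u]addr0 trilinear_line (T_swap2 u u 0) (T_swap1 u 0).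
by rewrite !trilinear_0 T_swap1 trilinear_0; ring.
Qed.

End Trilinear.
End Multilinear.

Lemma quadratic_algebra (R : realType) (c x D b beta s : R[i]) : b != 0 ->
  2 * (2^-1 * c) * (2^-1 * (2^-1 * x)) * 2^-1 -
    b^-1 * (2^-1 * D) ^+ 2 * 2^-1 ^+ 2 = beta * (2^-1 * c) ^+ 2 * s ->
  c * x / 2 - D ^+ 2 / (4 * b) = beta * c ^+ 2 * s.
Proof.
move=> b0 E; transitivity (4 * (beta * (2^-1 * c) ^+ 2 * s)); last by field.
by rewrite -E; field.
Qed.

Lemma third_algebra (R : realType) (c x b beta s q1 q2 t : R[i]) :
  b != 0 -> c != 0 ->
  c * x / 2 - (- (2 * c * b * q1)) ^+ 2 / (4 * b) = beta * c ^+ 2 * s ->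
  t / 3 = x / 2 - c * b * q2 ->
  t = 3 * (c * (beta * s + b * (q1 ^+ 2 / 2) - b * (q2 - q1 ^+ 2 / 2))).
Proof.
move=> b0 c0 E tE.
have xE : x / 2 = beta * c * s + b * c * q1 ^+ 2.
  apply: (mulfI c0); transitivity (beta * c ^+ 2 * s + c * (b * c * q1 ^+ 2)).
    by rewrite -E; field.
  by ring.
have -> : t = 3 * (t / 3) by field.
by rewrite tE xE; field.
Qed.

Section UpperBound.
Variables (R : realType) (n : nat) (alpha : R).
Variable f : 'rV[R[i]]_n -> 'rV[R[i]]_n.
Hypothesis alpha_le : alpha <= 1 / 2.
Hypothesis f_star : almost_starlike alpha f.
Local Notation row := 'rV[R[i]]_n.

Let alpha_lt1 : alpha < 1. Proof. by move: alpha_le; lra. Qed.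
Let b_gt0 : 0 < 1 - alpha. Proof. by rewrite subr_gt0. Qed.
Let n0 : nr (0 : row) < 1. Proof. by rewrite nr0. Qed.
Let comp_diff k := star_comp_diff f_star k.

Let B k (u v : row) : R[i] := frechet (component f k) [:: u; v] 0.
Let T k (u v w : row) : R[i] := frechet (component f k) [:: u; v; w] 0.

Let BC k u v : B k u v = B k v u.
Proof. exact: (frechet_swap (comp_diff k)). Qed.

Let B_l k a u v w : B k (a *: u + v) w = a * B k u w + B k v w.
Proof. exact: frechet_head. Qed.

Let T_swap1 k u v w : T k u v w = T k v u w.
Proof. exact: (frechet_swap (comp_diff k)). Qed.

Let T_swap2 k u v w : T k u v w = T k u w v.
Proof. exact: (frechet_swap2 (comp_diff k)). Qed.

Let T_1 k a u v w x : T k (a *: u + v) w x = a * T k u w x + T k v w x.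
Proof. exact: frechet_head. Qed.

Lemma coef2E m l : coef2 f m l = 2^-1 * B m (delta_mx 0 m) (delta_mx 0 l).
Proof.
rewrite /coef2; congr (_ * _).
have [] := @diff_eq_near R _ _ (frechet (component f m) [:: delta_mx 0 l])
  (fun z => 'D_(delta_mx 0 l) (component f m) z) 0 1 ltr01.
- move=> y; rewrite subr0 => hy /=; symmetry; apply: deriveE; exact: comp_diff.
- by apply: frechet_diff => // x; exact: comp_diff.
- by move=> hd hE; exact: (etrans (deriveE _ hd) (hE _)).
Qed.

Let nr_i : nr (Complex 0 1 : R[i]) = 1.
Proof. by rewrite nr_eq/= expr0n expr1n add0r sqrtr1. Qed.

(** Rotating by [t] every coordinate of [w] but the m-th stays on the torus, so [star_second] bounds
    the quadratic form there. Averaging over [t] with the weights of [bilinear_average] isolates the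
    terms that contain the m-th coordinate. *)
Lemma coef_form_le m (w : row) : (forall l, nr (w 0 l) = 1) ->
  nr (B m (delta_mx 0 m) w) <= 4 * (1 - alpha).
Proof.
have aux (x1 x2 x3 M : R) : x1 <= M -> x2 <= M -> x3 <= M ->
    2 * x1 + x2 + x3 <= M * 4 by lra.
move=> hw; set e := delta_mx 0 m; pose c := w 0 m.
pose w' := - c *: e + w.
pose z t := t *: w' + c *: e.
pose G t := B m (z t) (z t).
have zc t l : z t 0 l = if l == m then c else t * w 0 l.
  rewrite !mxE eqxx /=; case: eqP => [->|_]; rewrite /c; simpl; ring.
have hz t : nr t = 1 -> nr (z t) = 1 /\ nr (z t 0 m) = 1.
  move=> t1; have zm : nr (z t 0 m) = 1 by rewrite zc eqxx hw.
  split=> //; apply/eqP; rewrite eq_le; apply/andP; split.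
    apply: nr_row_le => // l; rewrite zc; case: eqP => _; first by rewrite hw.
    by rewrite nrM t1 hw mulr1.
  by rewrite -zm nr_coord.
have G_le t : nr t = 1 -> nr (G t) <= 4 * (1 - alpha).
  by move=> /hz[h1 h2]; exact: star_second.
have E : c * B m e w = (2 * G 1 + G (Complex 0 1) + G (- Complex 0 1)) / 4.
  have -> : w = c *: e + w' by rewrite /w' scaleNr addrA subrr add0r.
  exact: (bilinear_average (BC m) (B_l m)).
have -> : nr (B m e w) = nr (c * B m e w) by rewrite nrM hw mul1r.
rewrite E nrM nrV (nr_nat _ 4) ler_pdivrMr//.
apply: le_trans (nrD _ _) _; apply: le_trans (lerD (nrD _ _) (lexx _)) _.
rewrite nrM (nr_nat _ 2).
have l1 := G_le 1 (nr1 R); have l2 := G_le _ nr_i.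
have l3 : nr (G (- Complex 0 1)) <= 4 * (1 - alpha).
  by apply: G_le; rewrite nrN nr_i.
exact: aux l1 l2 l3.
Qed.

(** The phases of [w] in [coef_form_le] are free, so they can be chosen to make all the terms
    positive at once. *)
Lemma coef2_sum_le m : \sum_l nr (coef2 f m l) <= 2 * (1 - alpha).
Proof.
pose e : row := delta_mx 0 m; pose b l := B m e (delta_mx 0 l).
have /choice[c hc] : forall l, exists c : R[i], nr c = 1 /\ c * b l = (nr (b l))%:C.
  by move=> l; have [c c1 cE] := rotate_norm (b l); exists c.
have := @coef_form_le m (\row_l c l).
have -> : B m e (\row_l c l) = (\sum_l nr (b l))%:C.
  rewrite BC [LHS]diff_row_sum rmorph_sum; apply: eq_bigr => l _ /=.
  rewrite mxE -(hc l).2; congr (_ * _); exact: BC.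
rewrite nrR ger0_norm; last by rewrite sumr_ge0// => l _; exact: nr_ge0.
move=> /(_ _)-le; have {}le : \sum_l nr (b l) <= 4 * (1 - alpha).
  by apply: le => l; rewrite mxE (hc l).1.
have -> : \sum_l nr (coef2 f m l) = 2^-1 * \sum_l nr (b l).
  by rewrite mulr_sumr; apply: eq_bigr => l _; rewrite coef2E nrM nrV (nr_nat _ 2).
lra.
Qed.

Let S k (z : row) := \sum_(m < n) coef2 f k m * z 0 m *
  (\sum_(l < n) coef2 f m l * z 0 l).

Lemma coef_product_le k (z : row) : nr z <= 1 ->
  nr (S k z) <= 4 * (1 - alpha) ^+ 2.
Proof.
move=> hz; have zl l : nr (z 0 l) <= 1 := le_trans (nr_coord _ _) hz.
apply: le_trans (nr_sum _) _.
apply: le_trans (_ : \sum_m nr (coef2 f k m) * (2 * (1 - alpha)) <= _).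
  apply: ler_sum => m _; rewrite nrM (nrM _ (z 0 m)).
  apply: ler_pM; rewrite ?mulr_ge0 ?nr_ge0//.
    by rewrite ler_piMr ?nr_ge0.
  apply: le_trans (nr_sum _) _; apply: le_trans (coef2_sum_le m).
  by apply: ler_sum => l _; rewrite nrM ler_piMr ?nr_ge0.
rewrite -mulr_suml.
have := ler_wpM2r (ltW (mulr_gt0 (ltr0Sn R 1) b_gt0)) (coef2_sum_le k).
by move=> /le_trans; apply; rewrite le_eqVlt; apply/orP; left; apply/eqP; ring.
Qed.

Hypothesis f_quad : quadratic_condition alpha f.

Let P (z : row) : row := frechet f [:: z; z] 0.

Lemma quadratic_at (z0 : row) k : nr z0 = 1 ->
  z0 0 k * B k z0 (P z0) / 2 - (B k z0 z0) ^+ 2 / (4 * (1 - alpha)%:C) =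
  ((1 - 2 * alpha) / (1 - alpha))%:C * z0 0 k ^+ 2 * S k z0.
Proof.
(* The condition is assumed in the open polydisk only, which excludes [z0]. It is read at z0 / 2;
   both of its sides are of degree 2 in the radius. *)
move=> hz; pose z := (2^-1 : R[i]) *: z0.
have nz : nr z = 2^-1 by rewrite nrZ nrV (nr_nat _ 2) hz mulr1.
have hz1 : polydisk z by apply/polydiskE; rewrite nz; lra.
have zN0 : z != 0.
  apply/eqP => h; move: nz; rewrite h nr0 => /eqP.
  by rewrite eq_sym invr_eq0 pnatr_eq0.
have := f_quad hz1 zN0 k; cbv beta zeta.
have -> : `|z| = 2^-1 :> R[i] by rewrite normE nz fmorphV rmorph_nat.
have -> : (2^-1)^-1 *: z = z0 by rewrite /z scalerA invrK mulfV ?scale1r// pnatr_eq0.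
have -> : frechet (component f k) [:: z0; (2`!)%:R^-1 *: frechet f [:: z0; z0] 0] 0
   = 2^-1 * B k z0 (P z0).
  exact: (bilinear_Zr (BC k) (B_l k)).
rewrite -/(B k z0 z0).
have -> : \sum_(m < n) coef2 f k m * (z 0 m / 2^-1) *
    (\sum_(l < n) coef2 f m l * (z 0 l / 2^-1)) = S k z0.
  have zE l : z 0 l / 2^-1 = z0 0 l by rewrite mxE; field.
  apply: eq_bigr => m _; rewrite zE; congr (_ * _).
  by apply: eq_bigr => l _; rewrite zE.
rewrite mxE; set b := (1 - alpha)%:C; set x := B k z0 (P z0).
set s := S k z0; set D := B k z0 z0; set c := z0 0 k; set beta := (_ / _)%:C.
have bV : ((1 - alpha)^-1)%:C = b^-1 :> R[i] by exact: fmorphV.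
have b0 : b != 0 by rewrite eq_complex/= gt_eqF.
by rewrite bV; exact: quadratic_algebra b0.
Qed.

Lemma third_on_torus (z0 : row) k : nr z0 = 1 -> nr (z0 0 k) = 1 ->
  nr (T k z0 z0 z0) <= 6 * ((1 - alpha) * (3 - 4 * alpha)).
Proof.
move=> hz hk.
have [q1 [q2 [q12 D2E D3E]]] := star_coefficients alpha_lt1 f_star hz hk (erefl _).
have := quadratic_at k hz.
rewrite -/(B k z0 z0) in D2E; rewrite -/(T k z0 z0 z0) in D3E.
rewrite -/(P z0) -/(B k z0 (P z0)) in D3E.
rewrite D2E; move: D3E; set x := B k z0 (P z0); set c := z0 0 k.
set b := (1 - alpha)%:C; set beta := (_ / _)%:C; set s := S k z0.
set t := T k z0 z0 z0 => tE E.
have c0 : c != 0 by apply/eqP => c0; move: hk; rewrite -/c c0 nr0 => /eqP;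
  rewrite eq_sym oner_eq0.
have b0 : b != 0 by rewrite eq_complex/= gt_eqF.
rewrite (third_algebra b0 c0 E tE).
rewrite !nrM (nr_nat _ 3) hk mul1r.
have beta0 : 0 <= (1 - 2 * alpha) / (1 - alpha).
  by apply: divr_ge0; [move: alpha_le; lra|exact: ltW].
have nbs : nr (beta * s) <= (1 - 2 * alpha) / (1 - alpha) * (4 * (1 - alpha) ^+ 2).
  rewrite nrM nrR ger0_norm// ler_wpM2l//; apply: coef_product_le; lra.
have nbq : nr (b * (q1 ^+ 2 / 2)) = (1 - alpha) * (nr q1 ^+ 2 / 2).
  by rewrite nrM (nrM _ 2^-1) nrX nrV (nr_nat _ 2) nrR gtr0_norm.
have nbr : nr (b * (q2 - q1 ^+ 2 / 2)) <= (1 - alpha) * (2 - nr q1 ^+ 2 / 2).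
  by rewrite nrM nrR gtr0_norm// ler_wpM2l// ltW.
have sE : (1 - 2 * alpha) / (1 - alpha) * (4 * (1 - alpha) ^+ 2) =
    4 * (1 - 2 * alpha) * (1 - alpha) by field; rewrite gt_eqF.
(* The terms in [nr q1] cancel, and 4 (1 - 2 alpha) + 2 = 2 (3 - 4 alpha). *)
have le : nr (beta * s + b * (q1 ^+ 2 / 2) - b * (q2 - q1 ^+ 2 / 2)) <=
    2 * ((1 - alpha) * (3 - 4 * alpha)).
  apply: le_trans (nrB _ _) _; apply: le_trans (lerD (nrD _ _) (lexx _)) _.
  rewrite nbq; move: nbs nbr; rewrite sE; lra.
have := ler_wpM2l (ler0n R 3) le; lra.
Qed.

Lemma third_on_sphere (z0 : row) k : nr z0 = 1 ->
  nr (T k z0 z0 z0) <= 6 * ((1 - alpha) * (3 - 4 * alpha)).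
Proof.
move=> hz; have [hk|hk] := eqVneq (nr (z0 0 k)) 1; first exact: third_on_torus.
have hlt : nr (z0 0 k) < 1 by rewrite lt_neqAle hk -hz nr_coord.
set e : row := delta_mx 0 k; pose w := - z0 0 k *: e + z0.
pose y t := t *: e + w.
(* [y t] is [z0] with its k-th coordinate replaced by [t], so [phi] is a cubic polynomial, and for
   [nr t = 1] it is evaluated on the torus. *)
pose phi t := T k (y t) (y t) (y t).
have yz : y (z0 0 k) = z0 by rewrite /y /w addrA scaleNr subrr add0r.
have -> : T k z0 z0 z0 = phi (z0 0 k) by rewrite /phi yz.
apply: maximum_modulus hlt.
  move=> t; pose p : {poly R[i]} := T k e e e *: 'X^3
    + (3 * T k e e w) *: 'X^2 + (3 * T k e w w) *: 'X + (T k w w w)%:P.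
  exists p^`().[t]; have := cder_horner p t; congr cder; apply: funext => s.
  rewrite /phi /y (trilinear_line (T_swap1 k) (T_swap2 k) (T_1 k)) /p.
  rewrite !(hornerD, hornerZ, hornerXn, hornerX, hornerC).
  move: (T k e e e) (T k e e w) (T k e w w) (T k w w w) => a1 a2 a3 a4; ring.
move=> t t1.
have yc l : y t 0 l = if l == k then t else z0 0 l.
  rewrite !mxE eqxx /=; case: eqP => [->|_]; rewrite /=; ring.
have yk : nr (y t 0 k) = 1 by rewrite yc eqxx.
apply: third_on_torus => //; apply/eqP; rewrite eq_le; apply/andP; split.
  apply: nr_row_le => // l; rewrite yc; case: eqP => _; first by rewrite t1.
  by rewrite -hz nr_coord.
by rewrite -yk nr_coord.
Qed.

Theorem third_derivative_le (z : row) : polydisk z ->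
  `|frechet f [:: z; z; z] 0| / 3`!%:R
    <= ((1 - alpha) * (3 - 4 * alpha))%:C * `|z| ^+ 3.
Proof.
move=> _; set K := (1 - alpha) * (3 - 4 * alpha).
have K0 : 0 <= K by apply: mulr_ge0; [exact: ltW|move: alpha_le; lra].
suff le : nr (frechet f [:: z; z; z] 0) <= 6 * K * nr z ^+ 3.
  rewrite !normE ler_pdivrMr; last by rewrite ltr0n.
  have -> : (3`!)%:R = (6 : R)%:C :> R[i] by rewrite rmorph_nat.
  rewrite -rmorphXn -!rmorphM/= lecR; apply: le_trans le _.
  by rewrite le_eqVlt; apply/orP; left; apply/eqP; ring.
apply: nr_row_le => [|k].
  by apply: mulr_ge0; [apply: mulr_ge0|apply: exprn_ge0; exact: nr_ge0].
have [_ ->] := frechet_coord (star_diff f_star) [:: z; z; z] k n0.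
rewrite -[X in nr X <= _]/(T k z z z).
have [->|zN0] := eqVneq z 0.
  by rewrite (trilinear_0 (T_1 k)) !nr0 expr0n mulr0.
have nz := nr_gt0 zN0; pose z0 := ((nr z)^-1)%:C *: z.
have hz0 : nr z0 = 1 by rewrite nrZ nrR gtr0_norm ?invr_gt0// mulVf// gt_eqF.
have zE : z = (nr z)%:C *: z0.
  by rewrite scalerA -rmorphM/= mulfV ?scale1r// gt_eqF.
rewrite [in X in X <= _]zE (trilinear_scale (T_swap1 k) (T_swap2 k) (T_1 k)).
rewrite nrM nrX nrR (gtr0_norm nz) mulrC.
by rewrite ler_wpM2r ?exprn_ge0 ?nr_ge0//; exact: third_on_sphere.
Qed.

End UpperBound.

(** * Extremal maps *)

Lemma diagonal_algebra (R : realType) (c D r b : R[i]) : b != 0 -> r != 0 ->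
  2 * c * (2^-1 * (D * (r^-1 * c * (2^-1 * (D * (r^-1 * c * (r^-1 * c))))))) * r
  - b^-1 * (2^-1 * (D * (r^-1 * c * (r^-1 * c)))) ^+ 2 * r ^+ 2 =
  (2 * b - 1) * b^-1 * c ^+ 2 * (2^-1 * D * (c / r) * (2^-1 * D * (c / r))).
Proof. by move=> b0 r0; field; rewrite b0 r0. Qed.

Section PolynomialCoordinates.
Variables (R : realType) (n : nat).
Local Notation row := 'rV[R[i]]_n.
Implicit Types (F G : {poly R[i]}) (x v w : row).

Definition diagonal_map F (z : row) : row := \row_k F.[z 0 k].

Lemma diff_of_coord (g : R[i] -> R[i]) (a : R[i]) x k : cder g (x 0 k) a ->
  differentiable (fun y : row => g (y 0 k)) x /\
  forall v, 'd (fun y : row => g (y 0 k)) x v = a * v 0 k.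
Proof.
move=> hg; apply: (@hd_diff R _ _ _ x (fun v => a * v 0 k) (nr a)).
- by move=> c u v; rewrite !mxE -[c *: (_ : R[i])]/(c * _); ring.
- by move=> h; rewrite nrM ler_wpM2l ?nr_ge0 ?nr_coord.
move=> e e0; have [d d0 hd] := hg e e0; exists d => // h hh.
rewrite mxE; apply: le_trans (hd _ (le_lt_trans (nr_coord _ _) hh)) _.
by rewrite ler_wpM2l ?nr_coord// ltW.
Qed.

(** An equality of functions, so that the induction hypothesis can be rewritten under the
    differential. *)
Lemma frechet_diagonal F k (vs : seq row) :
  frechet (component (diagonal_map F) k) vs =
  fun x => F^`(size vs).[x 0 k] * \prod_(v <- vs) v 0 k.
Proof.
elim: vs => [|v vs ih].
  by apply: funext => x; rewrite /= big_nil mulr1 /component mxE.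
apply: funext => x; rewrite [LHS]/= ih big_cons.
set c := \prod_(_ <- _) _; set G := F^`(size vs).
have h := cderM (cder_horner G (x 0 k)) (cder_cst (x 0 k) c).
have [_ ->] := diff_of_coord h.
by rewrite derivnS -/G mulr0 addr0; ring.
Qed.

Lemma diagonal_diff F x : differentiable (diagonal_map F) x.
Proof.
apply: diff_row => k; have [h _] := diff_of_coord (cder_horner F (x 0 k)).
by have -> : (fun y => diagonal_map F y 0 k) = (fun y => F.[y 0 k]) by
  apply: funext => y; rewrite mxE.
Qed.

Lemma diagonal_jacobian F x :
  'J (diagonal_map F) x = diag_mx (\row_k F^`().[x 0 k]).
Proof.
apply/matrixP => i j; rewrite !mxE.
have [_ <-] := diff_coord j (diagonal_diff F x).
have -> : 'd (fun y => diagonal_map F y 0 j) x (delta_mx 0 i) =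
  frechet (component (diagonal_map F) j) [:: delta_mx 0 i] x by [].
rewrite frechet_diagonal big_seq1 mxE eqxx /= (eq_sym j).
by case: eqP => [->|_]; rewrite ?mulr1 ?mulr0 ?mulr1n ?mulr0n.
Qed.

Lemma diagonal_quotient F x : (forall k, F^`().[x 0 k] != 0) ->
  'J (diagonal_map F) x \in unitmx /\
  diagonal_map F x *m invmx ('J (diagonal_map F) x) =
    \row_k (F.[x 0 k] / F^`().[x 0 k]).
Proof.
move=> h; set J := 'J _ x.
have JU : J \in unitmx.
  rewrite /J diagonal_jacobian unitmxE det_diag unitfE.
  by apply/prodf_neq0 => k _; rewrite mxE.
split=> //; apply: (can_inj (mulmxK JU)).
rewrite mulmxKV// /J diagonal_jacobian mul_mx_diag.
by apply/rowP => k; rewrite !mxE divfK.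
Qed.

(** Since T(x) = ||x||, equality holds throughout |sum x_k t_k| <= sum |x_k t_k| <= ||x|| sum |t_k|
    <= ||x||, which forces every term x_k t_k to be a nonnegative real. *)
Lemma supporting_spread (x : row) (T : {linear row -> R[i]}) : x != 0 ->
  supporting x T -> exists s : 'I_n -> R,
  [/\ forall k, 0 <= s k, forall k, x 0 k * T (delta_mx 0 k) = (s k)%:C &
      \sum_k s k = nr x].
Proof.
move=> x0 [Top Tx]; pose t k := T (delta_mx 0 k).
have TE (v : row) : T v = \sum_k v 0 k * t k.
  rewrite {1}(row_sum_delta v) linear_sum; apply: eq_bigr => k _.
  exact: linearZ.
have T_le (v : row) : nr v <= 1 -> nr (T v) <= 1.
  move=> hv; rewrite -Top /opnorm; apply: ub_le_sup.
    set E := [set _ | _ in _]%classic in Top *.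
    (* [sup] takes the value 0 on a set without supremum, which norm 1 rules out. *)
    have [[]//|hns] := pselect (has_sup E).
    by move: Top; rewrite /opnorm -/E sup_out// => /eqP; rewrite eq_sym oner_eq0.
  by exists v => //=; rewrite normE -[1 : R[i]]/(1%:C) lecR.
have t_sum : \sum_k nr (t k) <= 1.
  have /choice[c hc] : forall k, exists c : R[i],
      nr c = 1 /\ c * t k = (nr (t k))%:C.
    by move=> k; have [c c1 cE] := rotate_norm (t k); exists c.
  have := T_le (\row_k c k); rewrite TE.
  have -> : \sum_k (\row_k c k) 0 k * t k = (\sum_k nr (t k))%:C.
    rewrite rmorph_sum; apply: eq_bigr => k _; rewrite mxE; exact: (hc k).2.
  rewrite nrR ger0_norm; last by rewrite sumr_ge0// => k _; exact: nr_ge0.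
  by apply; apply: nr_row_le => // k; rewrite mxE (hc k).1.
have re_sum : \sum_k complex.Re (x 0 k * t k) = nr x.
  have := congr1 (@complex.Re R) Tx; rewrite TE normE /= => <-.
  by elim/big_ind2: _ => // a a' b b' -> ->; rewrite ReD.
have nr_sum : \sum_k nr (x 0 k * t k) <= nr x.
  apply: le_trans (_ : \sum_k nr x * nr (t k) <= _).
    by apply: ler_sum => k _; rewrite nrM ler_wpM2r ?nr_ge0 ?nr_coord.
  by rewrite -mulr_sumr ler_piMr ?nr_ge0.
have eqk k : nr (x 0 k * t k) - complex.Re (x 0 k * t k) = 0.
  have h : \sum_k (nr (x 0 k * t k) - complex.Re (x 0 k * t k)) = 0.
    apply/eqP; rewrite eq_le sumr_ge0 ?andbT; last first.
      by move=> j _; rewrite subr_ge0 Re_le.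
    by rewrite sumrB re_sum subr_le0.
  apply: (psumr_eq0P _ h) => // j _; by rewrite subr_ge0 Re_le.
exists (fun k => nr (x 0 k * t k)); split=> [k|k|]; first exact: nr_ge0.
  have /eqP := eqk k; rewrite subr_eq0 => /eqP hk.
  apply: eqC; rewrite /= ?hk//.
  have := nr_sqr (x 0 k * t k); rewrite hk.
  move=> /eqP; rewrite eq_sym addrC -subr_eq0 addrK sqrf_eq0 => /eqP.
  exact.
rewrite -re_sum; apply: eq_bigr => k _.
by have /eqP := eqk k; rewrite subr_eq0 => /eqP.
Qed.

(** By [supporting_spread], any supporting functional applied to Df(x)^-1 f(x) is a sum of the
    one-variable quotients F(x_k) / (x_k F'(x_k)) with nonnegative weights of total ||x||. *)
Lemma diagonal_starlike F (alpha : R) : F.[0] = 0 -> F^`().[0] = 1 ->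
  (forall z : R[i], nr z < 1 -> F^`().[z] != 0) ->
  (forall z : R[i], 0 < nr z < 1 ->
    alpha <= complex.Re (F.[z] / (z * F^`().[z]))) ->
  almost_starlike alpha (diagonal_map F).
Proof.
move=> F0 F1 FN0 Fre.
have xk (x : row) : polydisk x -> forall k, nr (x 0 k) < 1.
  by move=> /polydiskE hx k; exact: le_lt_trans (nr_coord _ _) hx.
split.
- split; first by apply/rowP => k; rewrite !mxE F0.
  rewrite diagonal_jacobian; apply/matrixP => i j; rewrite !mxE F1.
  by case: eqP.
- split; first by move=> z _; exact: diagonal_diff.
  by move=> x /xk hx; have [] // := @diagonal_quotient F x _ => k; exact: FN0.
move=> x /xk hx x0 T /(supporting_spread x0)[s [s0 sE s_sum]].
have [_ ->] := @diagonal_quotient F x (fun k => FN0 _ (hx k)).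
rewrite -[complex.Re `|x|]/(nr x) -s_sum mulr_sumr.
set w := \row_k _.
have -> : T w = \sum_k w 0 k * T (delta_mx 0 k).
  rewrite [in LHS](row_sum_delta w) linear_sum; apply: eq_bigr => k _.
  exact: linearZ.
have -> : complex.Re (\sum_k w 0 k * T (delta_mx 0 k)) =
    \sum_k complex.Re (w 0 k * T (delta_mx 0 k)).
  by elim/big_ind2: _ => // a a' b b' <- <-; rewrite ReD.
apply: ler_sum => k _; rewrite mxE.
have [xk0|xkN0] := eqVneq (x 0 k) 0.
  have sk0 : s k = 0 by apply: complexI; rewrite -sE xk0 mul0r.
  by rewrite xk0 F0 sk0 mulr0 !mul0r.
have -> : F.[x 0 k] / F^`().[x 0 k] * T (delta_mx 0 k) =
    (s k)%:C * (F.[x 0 k] / (x 0 k * F^`().[x 0 k])).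
  by rewrite -sE; have := FN0 _ (hx k); move: (T _) => t h; field; rewrite xkN0 h.
rewrite ReRM mulrC ler_wpM2l//; apply: Fre.
by rewrite hx nr_gt0.
Qed.

(** Here a_{ml} = 0 for m != l, and with D = F''(0) both sides equal (2 - 1 / (1 - alpha)) D^2 z_k^4
    / (4 ||z||^2), for every value of D. *)
Lemma diagonal_quadratic F (alpha : R) : alpha < 1 ->
  almost_starlike alpha (diagonal_map F) ->
  quadratic_condition alpha (diagonal_map F).
Proof.
move=> a1 hF z hz z0N k; cbv beta zeta.
set b := (1 - alpha)%:C; have b0 : b != 0 by rewrite eq_complex/= gt_eqF// subr_gt0.
have n0 : nr (0 : row) < 1 by rewrite nr0.
pose D := F^`(2).[0].
have BE j (u v : row) : frechet (component (diagonal_map F) j) [:: u; v] 0 =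
    D * (u 0 j * v 0 j).
  by rewrite frechet_diagonal big_cons big_seq1 mxE.
have PE (u v : row) j : frechet (diagonal_map F) [:: u; v] 0 0 j =
    D * (u 0 j * v 0 j).
  have [_ ->] := frechet_coord (fun y _ => diagonal_diff F y) [:: u; v] j n0.
  exact: BE.
have cE m l : coef2 (diagonal_map F) m l = 2^-1 * (D * (l == m)%:R).
  rewrite (coef2E hF) BE !mxE !eqxx /= mul1r eq_sym; reflexivity.
have nz : `|z| != 0 by rewrite normr_eq0.
set r := `|z| in nz *.
have sumE m : \sum_(l < n) coef2 (diagonal_map F) m l * (z 0 l / r) =
    2^-1 * D * (z 0 m / r).
  rewrite (bigD1 m)//= cE eqxx big1 ?addr0 ?mulr1// => l /negbTE lm.
  by rewrite cE lm mulr0n !(mulr0, mul0r).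
under eq_bigr do rewrite sumE.
have -> : \sum_(m < n) coef2 (diagonal_map F) k m * (z 0 m / r) *
    (2^-1 * D * (z 0 m / r)) = 2^-1 * D * (z 0 k / r) * (2^-1 * D * (z 0 k / r)).
  rewrite (bigD1 k)//= cE eqxx big1 ?addr0 ?mulr1// => m /negbTE mk.
  by rewrite cE mk mulr0n !(mulr0, mul0r).
rewrite !BE !mxE PE !mxE.
have -> : ((1 - alpha)^-1)%:C = b^-1 :> R[i] by exact: fmorphV.
have -> : ((1 - 2 * alpha) / (1 - alpha))%:C = (2 * b - 1) * b^-1 :> R[i].
  rewrite rmorphM fmorphV -/b; congr (_ * _); rewrite /b !rmorphB/= rmorphM/=.
  by rewrite rmorph1 rmorph_nat; ring.
by rewrite (_ : (2`!)%:R = 2)//; exact: diagonal_algebra.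
Qed.

End PolynomialCoordinates.

Section ExtremalPolynomial.
Variable R : realType.
Implicit Types (z : R[i]).

(* With [b = 1 - 2 * alpha], the extremal function on the disc is
   [z * (1 - b z)^(- (1 + b) / b)], whose logarithmic part has derivative
   [(1 + b) / (1 - b z)].  Dilating by [r < 1], truncating that geometric series
   after [N] terms and replacing [exp q] by [(1 + q / M) ^ M] turns it into a
   polynomial and costs arbitrarily little. *)
Variables (b r : R) (N M : nat).
Hypothesis b_ge0 : 0 <= b.
Hypothesis b_le1 : b <= 1.
Hypothesis r_gt0 : 0 < r.
Hypothesis r_lt1 : r < 1.
Hypothesis N_gt1 : (1 < N)%N.

(** The coefficients of (1 + b) r / (1 - b r z). At [b = 0] only the first survives, so the case
    alpha = 1/2, where the power (1 + b) / b has no meaning, needs no separate treatment. *)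
Let co j : R := (1 + b) * b ^+ j * r ^+ j.+1.
Let q' : {poly R[i]} := \poly_(j < N) (co j)%:C.
Let q : {poly R[i]} :=
  \poly_(j < N.+1) (if j is j'.+1 then (co j')%:C / j'.+1%:R else 0).
Let Q : {poly R[i]} := 1 + M.+1%:R^-1 *: q.
Definition extremal_poly : {poly R[i]} := 'X * Q ^+ M.+1.
Let F := extremal_poly.

Let deriv_q : q^`() = q'.
Proof.
apply/polyP => i; rewrite coef_deriv !coef_poly ltnS.
case: ifP => _; last by rewrite mul0rn.
by rewrite -[LHS]mulr_natr divfK// pnatr_eq0.
Qed.

Let M0 : (M.+1%:R : R[i]) != 0. Proof. by rewrite pnatr_eq0. Qed.

Let deriv_Q : Q^`() = M.+1%:R^-1 *: q'.
Proof. by rewrite derivD derivC add0r derivZ deriv_q. Qed.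

Let derivG m : (Q ^+ m)^`() = (m%:R / M.+1%:R) *: (q' * Q ^+ m.-1).
Proof. by rewrite deriv_exp deriv_Q /= -scalerAl -scaler_nat scalerA. Qed.

Let deriv_F : F^`() = Q ^+ M * (Q + 'X * q').
Proof.
rewrite /F /extremal_poly derivM derivX mul1r derivG mulfV// scale1r exprSr; ring.
Qed.

Let q0 : q.[0] = 0. Proof. by rewrite horner_coef0 coef_poly. Qed.
Let Q0 : Q.[0] = 1. Proof. by rewrite !hornerE q0 mulr0 addr0. Qed.
Let q'0 : q'.[0] = (co 0)%:C.
Proof. by rewrite horner_coef0 coef_poly (ltn_trans _ N_gt1). Qed.
Let q'1 : q'^`().[0] = (co 1)%:C.
Proof. by rewrite horner_coef0 coef_deriv coef_poly N_gt1. Qed.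

Lemma extremal_0 : F.[0] = 0.
Proof. by rewrite /F /extremal_poly hornerM hornerX mul0r. Qed.

Lemma extremal_1 : F^`().[0] = 1.
Proof.
rewrite deriv_F hornerM horner_exp Q0 expr1n mul1r hornerD hornerM hornerX.
by rewrite Q0 mul0r addr0.
Qed.

(** As r -> 1 and M -> infinity the value tends to 3 (1 + b) (1 + 2 b), which for b = 1 - 2 alpha is
    6 (1 - alpha) (3 - 4 alpha). *)
Lemma extremal_3 : F^`(3).[0] =
  (3 * ((1 + b) * r ^+ 2 * (b + (M%:R / M.+1%:R) * (1 + b))))%:C.
Proof.
have -> : F^`(3).[0] = 3 * ((Q ^+ M.+1)^`()^`()).[0].
  rewrite -[F^`(3)]/(F^`()^`()^`()) /F /extremal_poly.
  rewrite !(derivM, derivD, derivX, derivC).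
  by rewrite !(hornerD, hornerM, hornerX, hornerC); ring.
have -> : ((Q ^+ M.+1)^`()^`()).[0] = (co 1)%:C + (M%:R / M.+1%:R) * (co 0)%:C ^+ 2.
  rewrite derivG mulfV// scale1r derivM hornerD !hornerM horner_exp Q0 expr1n.
  rewrite mulr1 q'1 q'0 derivG hornerZ hornerM horner_exp Q0 expr1n q'0.
  by ring.
rewrite /co expr0 !expr1 mulr1.
by rewrite !(rmorphM, rmorphD, rmorphXn, fmorphV, rmorph_nat, rmorph1)/=; ring.
Qed.

(** The untruncated dilated function satisfies its inequality with margin at least (1 - r^2) / 2 = 8
    [eps]. Half of [eps] is allotted to the truncation and half to the replacement of the
    exponential. *)
Let eps := (1 - r ^+ 2) / 16.
Hypothesis N_big : 2 * r ^+ N <= eps / 2.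
Hypothesis M_big : 4 * N.+1%:R / M.+1%:R <= eps / 2.

Let co_ge0 j : 0 <= co j.
Proof. by rewrite !mulr_ge0 ?exprn_ge0 ?addr_ge0// ltW. Qed.

Let co_le2 j : co j <= 2.
Proof.
have h1 : b ^+ j <= 1 by rewrite exprn_ile1.
have h2 : r ^+ j.+1 <= 1 by rewrite exprn_ile1// ltW.
have h3 : 0 <= b ^+ j by rewrite exprn_ge0.
have h4 : 0 <= r ^+ j.+1 by rewrite exprn_ge0// ltW.
have h5 := mulr_ile1 h3 h4 h1 h2; rewrite /co -mulrA.
have := b_le1; have := b_ge0; have := mulr_ge0 h3 h4; nra.
Qed.

Let q_le z : nr z <= 1 -> nr q.[z] <= 2 * N.+1%:R.
Proof.
move=> hz; rewrite horner_poly.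
apply: le_trans (nr_sum _) _.
apply: le_trans (_ : \sum_(i < N.+1) 2 <= _); last first.
  by rewrite sumr_const card_ord mulr_natr.
apply: ler_sum => -[[|j] hj] _ /=; first by rewrite mul0r nr0.
rewrite nrM nrX; apply: le_trans (_ : nr ((co j)%:C / j.+1%:R) <= _).
  by rewrite ler_piMr ?nr_ge0// exprn_ile1// nr_ge0.
rewrite nrM nrV nrR ger0_norm// nr_nat ler_pdivrMr ?ltr0n//.
by apply: le_trans (co_le2 j) _; rewrite ler_peMr// ler1n.
Qed.

Let q'_sum z : (1 - (b * r)%:C * z) * (z * q'.[z]) =
  ((1 + b) * r)%:C * z * (1 - ((b * r)%:C * z) ^+ N).
Proof.
set x := (b * r)%:C * z.
have -> : z * q'.[z] = ((1 + b) * r)%:C * z * \sum_(j < N) x ^+ j.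
  rewrite horner_poly !mulr_sumr; apply: eq_bigr => j _.
  rewrite /x exprMn -rmorphXn/= /co exprMn exprS.
  have -> : ((1 + b) * b ^+ j * (r * r ^+ j))%:C =
    ((1 + b) * r)%:C * (b ^+ j * r ^+ j)%:C :> R[i].
    by rewrite -rmorphM/=; congr _%:C; ring.
  by ring.
rewrite mulrCA; congr (_ * _).
by rewrite -[1 in RHS](expr1n _ N) subrXX; congr (_ * _);
  apply: eq_bigr => j _; rewrite expr1n mul1r.
Qed.

(** The real part changes by at most 4 e + e^2 and the subtracted term by at most half of that; with
    e^2 <= e this is 15/2 e in all, whence the 8 in the hypothesis on [m]. *)
Lemma perturbed_positive (U V e1 e2 : R[i]) (a e m : R) :
  0 <= e -> e <= 1 -> 0 <= a -> a <= 1 / 2 -> nr U <= 2 -> nr V <= 2 ->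
  nr e1 <= e -> nr e2 <= e -> 8 * e <= m -> 0 < m ->
  complex.Re (U * cj V) - a * nr V ^+ 2 = m ->
  0 < complex.Re ((U + e1) * cj (V + e2)) - a * nr (V + e2) ^+ 2.
Proof.
move=> e0 e1' a0 a1 hU hV h1 h2 hm m0 E.
have hVe : nr (V + e2) <= nr V + e by apply: le_trans (nrD _ _) _; rewrite lerD2l.
have s1 : nr (V + e2) ^+ 2 <= (nr V + e) ^+ 2.
  by rewrite lerXn2r ?nnegrE ?nr_ge0// addr_ge0 ?nr_ge0.
have Rex : complex.Re ((U + e1) * cj (V + e2)) =
    complex.Re (U * cj V) + complex.Re (U * cj e2 + e1 * cj (V + e2)).
  by rewrite -ReD cjD; congr complex.Re; ring.
have low : - (4 * e + e ^+ 2) <= complex.Re (U * cj e2 + e1 * cj (V + e2)).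
  rewrite -[leRHS]opprK lerN2 -ReN.
  apply: le_trans (Re_le _) _; rewrite nrN.
  apply: le_trans (nrD _ _) _; rewrite !nrM !nrJ.
  have p1 := ler_pM (nr_ge0 _) (nr_ge0 _) hU h2.
  have p2 := ler_pM (nr_ge0 _) (nr_ge0 _) h1 hVe.
  have := ler_wpM2l e0 hV; nra.
have s2 : (nr V + e) ^+ 2 <= nr V ^+ 2 + 4 * e + e ^+ 2.
  have := ler_wpM2l e0 hV; nra.
have s3 : a * nr (V + e2) ^+ 2 <= a * nr V ^+ 2 + a * (4 * e + e ^+ 2).
  have := ler_wpM2l a0 (le_trans s1 s2); lra.
have s4 : a * (4 * e + e ^+ 2) <= 1 / 2 * (4 * e + e ^+ 2).
  by apply: ler_wpM2r => //; rewrite addr_ge0 ?mulr_ge0 ?exprn_ge0.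
have s5 : e ^+ 2 <= e by rewrite expr2 ler_piMr.
rewrite Rex; move: s3 s4 s5 low hm m0 E.
set A := complex.Re (U * cj V); set B := complex.Re (_ + _).
set X := a * nr (V + e2) ^+ 2; set Y := a * nr V ^+ 2; set Z := a * (_ + _).
set W := e ^+ 2; lra.
Qed.

Let alpha := (1 - b) / 2.

(** F / (z F') equals Q / (Q + z q'), and the bound on its real part is cleared of its denominator.
    Multiplying by 1 - b r z collapses the geometric sum, leaving 1 - b r z and 1 + r z up to the
    errors [e1] and [e2]. *)
Lemma extremal_positive z : nr z < 1 ->
  0 < complex.Re (Q.[z] * cj (Q.[z] + z * q'.[z]))
      - alpha * nr (Q.[z] + z * q'.[z]) ^+ 2.
Proof.
move=> hz; have hz1 := ltW hz; have z0 := nr_ge0 z.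
set A := Q.[z] + _; set x := (b * r)%:C * z.
have r2 : r ^+ 2 < 1 by rewrite exprn_ilt1// ltW.
have r20 : 0 <= r ^+ 2 by rewrite exprn_ge0// ltW.
have eps0 : 0 < eps by rewrite divr_gt0// subr_gt0.
have eps1 : eps <= 1 by rewrite /eps; lra.
have bb1 := b_le1; have bb0 := b_ge0; have rr0 := r_gt0; have rr1 := r_lt1.
have br0 : 0 <= b * r by rewrite mulr_ge0// ltW.
have br1 : b * r <= r by rewrite ler_piMl// ltW.
have nx : nr x <= r.
  by rewrite nrM nrR ger0_norm//; apply: le_trans (ler_piMr br0 hz1) br1.
have nx1 : nr x <= 1 by apply: le_trans nx _; exact: ltW.
have nrz : nr (r%:C * z) <= 1.
  by rewrite nrM nrR (gtr0_norm rr0) mulr_ile1// ltW.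
pose e1 := (1 - x) * (M.+1%:R^-1 * q.[z]).
pose e2 := e1 - ((1 + b) * r)%:C * z * x ^+ N.
have QE : Q.[z] = 1 + M.+1%:R^-1 * q.[z] by rewrite !hornerE.
have UE : (1 - x) * Q.[z] = (1 - x) + e1 by rewrite QE mulrDr mulr1.
have VE : (1 - x) * A = (1 + r%:C * z) + e2.
  rewrite mulrDr UE q'_sum -/x /e2 mulrBr mulr1.
  have -> : x = (b * r)%:C * z by [].
  have -> : ((1 + b) * r)%:C = r%:C + (b * r)%:C :> R[i].
    by rewrite -rmorphD; congr _%:C; rewrite mulrDl mul1r.
  by move: (e1) (((b * r)%:C * z) ^+ N) => E1 XN; ring.
have n1x : nr (1 - x) <= 2.
  by apply: le_trans (nrB _ _) _; rewrite nr1 -[leRHS]/(1 + 1) lerD2l.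
have nV : nr (1 + r%:C * z) <= 2.
  by apply: le_trans (nrD _ _) _; rewrite nr1 -[leRHS]/(1 + 1) lerD2l.
have ne1 : nr e1 <= eps / 2.
  apply: le_trans M_big; rewrite !nrM nrV nr_nat.
  have h := ler_pM (nr_ge0 _) (nr_ge0 _) n1x (q_le hz1).
  rewrite mulrCA mulrC ler_pM2r ?invr_gt0 ?ltr0n//.
  by apply: le_trans h _; rewrite mulrA; have -> : (2 * 2 = 4 :> R) by ring.
have ne2 : nr e2 <= eps.
  apply: le_trans (nrB _ _) _; rewrite [leRHS]splitr; apply: lerD => //.
  apply: le_trans N_big; rewrite !nrM nrX nrR ger0_norm; last first.
    by rewrite mulr_ge0 ?addr_ge0// ltW.
  apply: ler_pM; rewrite ?mulr_ge0 ?addr_ge0 ?exprn_ge0 ?nr_ge0// ?(ltW rr0)//.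
    apply: le_trans (_ : 2 * 1 <= _); last by rewrite mulr1.
    apply: ler_pM; rewrite ?mulr_ge0 ?addr_ge0// ?(ltW rr0)//.
    by nra.
  by rewrite lerXn2r ?nnegrE ?nr_ge0// ltW.
(* The terms linear in [z] cancel exactly because [alpha] is (1 - b) / 2. *)
have main : complex.Re ((1 - x) * cj (1 + r%:C * z)) - alpha * nr (1 + r%:C * z) ^+ 2
    = (1 + b) / 2 * (1 - r ^+ 2 * nr z ^+ 2).
  rewrite !nr_sqr /x /alpha /cj; case: (z) => s t /=.
  by field.
have z2 : nr z ^+ 2 <= 1 by rewrite exprn_ile1.
have rz : r ^+ 2 * nr z ^+ 2 <= r ^+ 2 by rewrite ler_piMr.
have m8 : 8 * eps <= (1 + b) / 2 * (1 - r ^+ 2 * nr z ^+ 2).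
  rewrite /eps; move: rz r2; set Y := r ^+ 2 * _; set X := r ^+ 2; nra.
have al0 : 0 <= alpha by rewrite /alpha; lra.
have al1 : alpha <= 1 / 2 by rewrite /alpha; lra.
have ne1' : nr e1 <= eps by lra.
have m0 : 0 < (1 + b) / 2 * (1 - r ^+ 2 * nr z ^+ 2).
  by apply: lt_le_trans m8; rewrite mulr_gt0.
have := perturbed_positive (ltW eps0) eps1 al0 al1 n1x nV ne1' ne2 m8 m0 main.
rewrite -UE -VE cjM.
have -> : (1 - x) * Q.[z] * (cj (1 - x) * cj A) =
    (nr (1 - x) ^+ 2)%:C * (Q.[z] * cj A) by rewrite -mulJ; ring.
rewrite ReRM nrM exprMn (mulrCA alpha) -mulrBr.
have n1x0 : 0 < nr (1 - x).
  have : nr (1 : R[i]) <= nr (1 - x) + nr x by rewrite -{1}(subrK x 1); exact: nrD.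
  by rewrite nr1; lra.
by rewrite pmulr_rgt0 ?exprn_gt0.
Qed.

Lemma extremal_ratio z : nr z < 1 -> F^`().[z] != 0 /\
  (0 < nr z -> alpha <= complex.Re (F.[z] / (z * F^`().[z]))).
Proof.
move=> hz; have := extremal_positive hz.
have -> : F^`().[z] = Q.[z] ^+ M * (Q.[z] + z * q'.[z]).
  by rewrite deriv_F hornerM horner_exp (hornerD Q) (hornerM 'X) hornerX.
have -> : F.[z] = z * Q.[z] ^+ M.+1.
  by rewrite /F /extremal_poly hornerM horner_exp hornerX.
move: (Q.[z]) (q'.[z]) => u v; set A := u + z * v => pos.
have al0 : 0 <= alpha by have := b_le1; rewrite /alpha; lra.
have u0 : u != 0.
  apply/eqP => u0; move: pos; rewrite u0 mul0r/= sub0r oppr_gt0 => pos.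
  have : 0 <= alpha * nr A ^+ 2 by rewrite mulr_ge0// exprn_ge0// nr_ge0.
  by rewrite leNgt pos.
have A0 : A != 0.
  apply/eqP => A0; move: pos.
  have c0 : cj (0 : R[i]) = 0 := conjc0 R.
  by rewrite A0 nr0 expr0n mulr0 subr0 c0 mulr0 ltxx.
split=> [|z0]; first by rewrite mulf_neq0// expf_neq0.
have zN0 : z != 0 by apply: contraTneq z0 => ->; rewrite nr0 ltxx.
have nA : 0 < nr A ^+ 2 by rewrite exprn_gt0// nr_gt0.
have -> : z * u ^+ M.+1 / (z * (u ^+ M * A)) = ((nr A ^+ 2)^-1)%:C * (u * cj A).
  have -> : ((nr A ^+ 2)^-1)%:C = (A * cj A)^-1 :> R[i].
    by rewrite mulJ; exact: fmorphV.
  rewrite exprS; have uM : u ^+ M != 0 by rewrite expf_neq0.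
  have cA : cj A != 0 by apply: contra_neq A0 => h; rewrite -[A]cjK h /cj conjc0.
  by move: (u ^+ M) uM (cj A) cA => w w0 c c0; field; rewrite zN0 w0 A0 c0.
by rewrite ReRM mulrC ler_pdivlMr// -subr_ge0 ltW.
Qed.

End ExtremalPolynomial.

Section Sharpness.
Variable R : realType.

Lemma exists_small_pow (r d : R) : 0 < r -> r < 1 -> 0 < d ->
  exists2 N, (1 < N)%N & r ^+ N < d.
Proof.
move=> r0 r1 d0; have nr1 : `|r| < 1 by rewrite gtr0_norm.
have /cvgrPdist_lt/(_ d d0) := cvg_expr nr1.
move=> [n _ hn]; exists n.+2 => //.
have /hn : (n <= n.+2)%N by rewrite (leq_trans (leqnSn _)).
by rewrite /= sub0r normrN ger0_norm// exprn_ge0// ltW.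
Qed.

Lemma exists_small_inv (K d : R) : 0 < d -> exists M, K / M.+1%:R < d.
Proof.
move=> d0; have [K0|K0] := leP K 0.
  by exists 0%N; rewrite divr1; exact: le_lt_trans d0.
have := archi_boundP (ltW (divr_gt0 K0 d0)); set m := Num.bound _ => hm.
exists m; rewrite ltr_pdivrMr ?ltr0n// mulrC -ltr_pdivrMr//.
by apply: lt_trans hm _; rewrite ltr_nat.
Qed.

Lemma extremal_family n (alpha r e : R) : 0 <= alpha -> alpha <= 1 / 2 ->
  0 < r -> r < 1 -> 0 < e ->
  exists F : {poly R[i]}, exists2 t : R, 1 - e < t /\
    almost_starlike alpha (@diagonal_map R n F) &
    F^`(3).[0] = (6 * ((1 - alpha) * r ^+ 2 *
      (1 - 2 * alpha + t * (2 * (1 - alpha)))))%:C.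
Proof.
move=> a0 a1 r0 r1 e0; pose b := 1 - 2 * alpha.
have b0 : 0 <= b by rewrite /b; lra.
have b1 : b <= 1 by rewrite /b; lra.
have r2 : 0 < 1 - r ^+ 2 by rewrite subr_gt0 exprn_ilt1// ltW.
pose eps := (1 - r ^+ 2) / 16; have eps0 : 0 < eps by rewrite divr_gt0.
have eps4 : 0 < eps / 4 by rewrite divr_gt0.
have [N N1 hN] := exists_small_pow r0 r1 eps4.
have hN' : 2 * r ^+ N <= (1 - r ^+ 2) / 16 / 2 by rewrite -/eps; lra.
(* The bound [eps / 2] meets the hypothesis on [M]; the bound [4 * e] gives 1 - M / (M + 1) <= (N +
   1) / (M + 1) < e. *)
have m0 : 0 < Num.min (eps / 2) (4 * e) by rewrite lt_min divr_gt0//= mulr_gt0.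
have [M hM] := exists_small_inv (4 * N.+1%:R) m0.
move: hM; rewrite lt_min => /andP[hM1 hM2].
have hM' := ltW hM1; rewrite /eps in hM'.
have aE : (1 - b) / 2 = alpha by rewrite /b; field.
exists (extremal_poly b r N M), (M%:R / M.+1%:R); last first.
  rewrite (extremal_3 b r M N1); congr _%:C; rewrite /b; ring.
split.
  have Mp : 0 < M.+1%:R :> R by rewrite ltr0n.
  have -> : M%:R / M.+1%:R = 1 - M.+1%:R^-1 :> R.
    by rewrite -natr1; field; rewrite natr1 gt_eqF.
  rewrite ltrD2l ltrN2; apply: le_lt_trans (_ : N.+1%:R / M.+1%:R < e).
    by rewrite ler_peMl ?invr_ge0 ?(ltW Mp)// ler1n.
  by move: hM2; rewrite -mulrA ltr_pM2l.
apply: diagonal_starlike.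
- exact: extremal_0.
- exact: extremal_1.
- by move=> z hz; have [] := extremal_ratio b0 b1 r0 r1 hN' hM' hz.
- move=> z /andP[z0 hz]; rewrite -aE.
  by have [_] := extremal_ratio b0 b1 r0 r1 hN' hM' hz; apply.
Qed.

Theorem third_derivative_sharp n (alpha c : R) : (1 <= n)%N -> 0 <= alpha ->
  alpha <= 1 / 2 ->
  (forall f : 'rV[R[i]]_n -> 'rV[R[i]]_n,
     almost_starlike alpha f -> quadratic_condition alpha f ->
     forall z : 'rV[R[i]]_n, polydisk z ->
       `|frechet f [:: z; z; z] 0| / 3`!%:R <= c%:C * `|z| ^+ 3) ->
  (1 - alpha) * (3 - 4 * alpha) <= c.
Proof.
move=> n1 a0 a1 h; have k : 'I_n by exact: Ordinal n1.
have alt1 : alpha < 1 by lra.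
have bnd (r e : R) : 0 < r -> r < 1 -> 0 < e ->
    (1 - alpha) * r ^+ 2 * (1 - 2 * alpha + (1 - e) * (2 * (1 - alpha))) <= c.
  move=> r0 r1 e0.
  have [F [t [te hF] F3]] := @extremal_family n alpha r e a0 a1 r0 r1 e0.
  (* All coordinates have the modulus of the norm, so the factors 1/8 on the two sides cancel. *)
  pose z : 'rV[R[i]]_n := const_mx 2^-1.
  have n2 : nr (2^-1 : R[i]) = 2^-1.
    by rewrite nrV nr_nat.
  have nz : nr z <= 2^-1.
    by apply: nr_row_le => [|j]; rewrite ?mxE ?n2// invr_ge0.
  have nz' : nr z = 2^-1.
    by apply/eqP; rewrite eq_le nz -{1}n2; have := nr_coord z k; rewrite mxE.
  have zd : polydisk z by apply/polydiskE; rewrite nz'; lra.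
  have := h _ hF (diagonal_quadratic alt1 hF) z zd.
  rewrite !normE nz' ler_pdivrMr; last by rewrite ltr0n.
  have -> : (3`!)%:R = (6 : R)%:C :> R[i] by rewrite rmorph_nat.
  rewrite -rmorphXn -!rmorphM/= lecR => le.
  have n0 : nr (0 : 'rV[R[i]]_n) < 1 by rewrite nr0.
  have := nr_coord (frechet (diagonal_map F) [:: z; z; z] 0) k.
  have [_ ->] := frechet_coord (fun y _ => diagonal_diff F y) [:: z; z; z] k n0.
  rewrite -[X in nr X <= _]/(frechet (component (diagonal_map F) k) [:: z; z; z] 0).
  rewrite frechet_diagonal !big_cons big_nil mulr1 !mxE [size _]/= F3.
  rewrite !nrM n2 nrR => le2.
  have {le le2} := le_trans (le_trans (ler_wpM2r _ (ler_norm _)) le2) le.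
  have p0 : 0 <= 2^-1 * (2^-1 / 2) :> R by rewrite !mulr_ge0 ?invr_ge0.
  move=> /(_ p0) le.
  have K0 : 0 <= (1 - alpha) * r ^+ 2 * (2 * (1 - alpha)).
    by rewrite !mulr_ge0 ?exprn_ge0// ?(ltW r0)//; lra.
  have := ler_wpM2l K0 (ltW te); lra.
(* With r = 1 - e' / 2, so that r^2 >= 1 - e', the deficit is at most e' (1 - alpha) (2 (1 - alpha)
   + X) with X <= 3, hence at most 5 e'. The cap e' <= 1/2 keeps r positive. *)
apply: (@dominates_le _ _ _ 5) => // e e0; rewrite -lerBlDr.
pose e' := Num.min e (1 / 2).
have e'0 : 0 < e' by rewrite lt_min e0/=; lra.
have e'e : e' <= e by rewrite ge_min lexx.
have e'1 : e' <= 1 / 2 by rewrite ge_min lexx orbT.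
have r0 : 0 < 1 - e' / 2 by lra.
have r1 : 1 - e' / 2 < 1 by lra.
apply: le_trans (bnd _ _ r0 r1 e'0).
have sq : 1 - e' <= (1 - e' / 2) ^+ 2 by have := sqr_ge0 (e' / 2); nra.
set X := 1 - 2 * alpha + (1 - e') * (2 * (1 - alpha)).
have X0 : 0 <= X by rewrite /X addr_ge0 ?mulr_ge0//; lra.
have al : 0 <= 1 - alpha by lra.
apply: le_trans (_ : (1 - alpha) * (1 - e') * X <= _).
  have p1 : 0 <= e' * alpha by rewrite mulr_ge0// ltW.
  have p2 : 0 <= e' * (1 - alpha) * (5 - 2 * (1 - alpha) - X).
    rewrite !mulr_ge0 ?(ltW e'0)// /X; move: p1; nra.
  move: p2; rewrite /X; lra.
by rewrite ler_wpM2r// ler_wpM2l.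
Qed.

End Sharpness.

Unset Implicit Arguments.

Theorem theorem3p3 (R : realType) (n : nat) (alpha : R)
    (n_ge1 : (1 <= n)%N) (alpha_ge0 : 0 <= alpha) (alpha_le : alpha <= 1 / 2) :
  (forall f : 'rV[R[i]]_n -> 'rV[R[i]]_n,
     almost_starlike alpha f -> quadratic_condition alpha f ->
     forall z : 'rV[R[i]]_n, polydisk z ->
       `|frechet f [:: z; z; z] 0| / 3`!%:R
       <= ((1 - alpha) * (3 - 4 * alpha))%:C * `|z| ^+ 3)
  /\
  (forall c : R,
     (forall f : 'rV[R[i]]_n -> 'rV[R[i]]_n,
        almost_starlike alpha f -> quadratic_condition alpha f ->
        forall z : 'rV[R[i]]_n, polydisk z ->
          `|frechet f [:: z; z; z] 0| / 3`!%:R <= c%:C * `|z| ^+ 3) ->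
     (1 - alpha) * (3 - 4 * alpha) <= c).
Proof.
split=> [f f_star f_quad z zP|c].
  exact: (third_derivative_le alpha_le f_star f_quad zP).
exact: third_derivative_sharp.
Qed.
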